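(* Let $T$ be a countable weakly quasi-o-minimal theory with few countable models, i.e. $I(T,\aleph_0)<2^{\aleph_0}$. (a) If $T$ has finite convexity rank, then $T$ satisfies (R). (b) If $T$ is rosy, then $T$ satisfies (R). Here (R) is the condition: for all $A\subseteq\mathfrak C$ and all $p\in S_1(A)$, every equivalence relation $E\in\mathcal E_p$ is relatively $0$-definable.
   Context: $T$ is a complete one-sorted first-order theory with monster model $\mathfrak C$; parameter sets are small; $I(T,\aleph_0)$ is the number of countable models of $T$ up to isomorphism. $T$ is weakly quasi-o-minimal if there is a $0$-definable linear order $<$ on $\mathfrak C$ such that every parametrically definable subset of $\mathfrak C$ is a finite Boolean combination of $0$-definable sets and $<$-convex sets. For $p\in S_1(A)$, $p(\mathfrak C)$ is its set of realizations; a set $X\subseteq p(\mathfrak C)^n$ is relatively $B$-definable if $X=\phi(\mathfrak C)\cap p(\mathfrak C)^n$ for some $L_B$-formula $\phi$ (relatively $0$-definable if $B=\emptyset$). $\mathcal E_p$ is the set of all relatively $A$-definable equivalence relations on $p(\mathfrak C)$. Convexity rank $RC$ of a unary formula $\phi(x)$ (with parameters): $RC(\phi)\geqslant 0$ if $\phi$ is consistent; $RC(\phi)\geqslant n+1$ if there exist a parametrically definable convex equivalence relation $E(x,y)$ on $\mathfrak C$ (i.e. with $<$-convex classes) and an infinite set $\{b_i\mid i\in\omega\}$ of representatives of different $E$-classes such that $RC(\phi(x)\wedge E(x,b_i))\geqslant n$ for all $i\in\omega$; $RC(\phi)=n$ if $n$ is maximal with $RC(\phi)\geqslant n$, and $RC(\phi)=\infty$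 if there is no such $n$. $T$ has finite convexity rank if $RC(x=x)<\omega$. Rosiness is in the usual sense of thorn-forking. By Ealy and Onshuus, it is equivalent to finiteness of all equivalence ranks $eq\text{-}rk_\Delta(\Pi(\bar x))$, for all partial types $\Pi(\bar x)$ and all finite sets $\Delta$ of formulae, where $eq\text{-}rk_\Delta(\Pi)\geqslant 0$ iff $\Pi$ is consistent, $eq\text{-}rk_\Delta(\Pi)\geqslant\lambda$ for limit $\lambda$ iff it is $\geqslant\alpha$ for all $\alpha<\lambda$, and $eq\text{-}rk_\Delta(\Pi(\bar x))\geqslant\alpha+1$ iff there are an equivalence relation $E(\bar x,\bar y)$ on $\mathfrak C^{|\bar x|}$ defined by $\phi(\bar x,\bar y,\bar c)$ with $\phi(\bar x,\bar y,\bar z)\in\Delta$ and $\bar c\in\mathfrak C$, and representatives $(\bar b_j\mid j\in\omega)$ of different $E$-classes with $eq\text{-}rk_\Delta(\Pi(\bar x)\wedge E(\bar x,\bar b_j))\geqslant\alpha$ for all $j$. *)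

(* Defs.v *)
From mathcomp Require Import all_boot.
From mathcomp Require Import boolp classical_sets functions cardinality.

Set Implicit Arguments.
Unset Strict Implicit.
Unset Printing Implicit Defensive.

Local Open Scope classical_set_scope.
Local Open Scope card_scope.

(** * Tuples *)

(** [tcat a b] is the concatenated tuple [(a, b)]. *)
Definition tcat (X : Type) n m (a : 'I_n -> X) (b : 'I_m -> X)
    : 'I_(n + m) -> X :=
  fun i => match fintype.split i with inl j => a j | inr j => b j end.

(** [tcons x a] puts [x] at index [0] and shifts [a]. *)
Definition tcons (X : Type) n (x : X) (a : 'I_n -> X) : 'I_n.+1 -> X :=
  fun i => oapp a x (unlift ord0 i).

Definition tup1 (X : Type) (x : X) : 'I_1 -> X := fun=> x.

Definition tup2 (X : Type) (x y : X) : 'I_2 -> X :=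
  fun i => if i == ord0 then x else y.

(** * One-sorted first-order logic *)

Record language := Language {
  func : Type;
  func_arity : func -> nat;
  rel_symb : Type;
  rel_arity : rel_symb -> nat }.

Inductive term (L : language) (n : nat) : Type :=
| Var of 'I_n
| App (f : func L) of ('I_(func_arity f) -> term L n).

(** [formula L n]: formulas whose free variables are among [x_0, ..., x_(n-1)].
    The variable bound by [FAll] is the variable [x_0] of its scope. *)
Inductive formula (L : language) : nat -> Type :=
| FFalse n : formula L n
| FEq n of term L n & term L n : formula L n
| FRel n (r : rel_symb L) of ('I_(rel_arity r) -> term L n) : formula L n
| FImp n of formula L n & formula L n : formula L n
| FAll n of formula L n.+1 : formula L n.

Arguments FFalse {L n}.

Definition FNot L n (phi : formula L n) : formula L n := FImp phi FFalse.

Record structure (L : language) := Structure {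
  carrier :> Type;
  carrier_inh : inhabited carrier;
  func_interp : forall f : func L, ('I_(func_arity f) -> carrier) -> carrier;
  rel_interp : forall r : rel_symb L, ('I_(rel_arity r) -> carrier) -> Prop }.

Fixpoint eval L (M : structure L) n (v : 'I_n -> M) (t : term L n) : M :=
  match t with
  | Var i => v i
  | App f ts => @func_interp L M f (fun i => eval v (ts i))
  end.

Fixpoint sat L (M : structure L) n (phi : formula L n) : ('I_n -> M) -> Prop :=
  match phi in formula _ n return ('I_n -> M) -> Prop with
  | FFalse _ => fun=> False
  | FEq _ t u => fun v => eval v t = eval v u
  | FRel _ r ts => fun v => @rel_interp L M r (fun i => eval v (ts i))
  | FImp _ f g => fun v => sat f v -> sat g v
  | FAll _ f => fun v => forall x : M, sat f (tcons x v)
  end.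

Definition holds L (M : structure L) (phi : formula L 0) : Prop :=
  forall v : 'I_0 -> M, sat phi v.

Definition theory (L : language) := set (formula L 0).

Definition model L (T : theory L) (M : structure L) : Prop :=
  forall phi, T phi -> holds M phi.

Definition entails L (T : theory L) (phi : formula L 0) : Prop :=
  forall M : structure L, model T M -> holds M phi.

Definition complete_theory L (T : theory L) : Prop :=
  (exists M : structure L, model T M) /\
  forall phi, entails T phi \/ entails T (FNot phi).

Definition countable_language (L : language) : Prop :=
  countable [set: func L] /\ countable [set: rel_symb L].

Definition isomorphism L (M N : structure L) (h : M -> N) : Prop :=
  [/\ bijective h,
      forall (f : func L) a,
        h (@func_interp L M f a) = @func_interp L N f (h \o a)
    & forall (r : rel_symb L) a,
        @rel_interp L M r a <-> @rel_interp L N r (h \o a)].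

Definition isomorphic L (M N : structure L) : Prop :=
  exists h : M -> N, isomorphism h.

(** * The number of countable models *)

Definition countable_models L (T : theory L) : set (structure L) :=
  [set M | model T M /\ countable [set: M]].

(** Its cardinality is [I(T, aleph_0)]. *)
Definition countable_model_classes L (T : theory L) : set (set (structure L)) :=
  [set c | exists2 M, countable_models T M &
           c = [set N | countable_models T N /\ isomorphic M N]].

(** [I(T, aleph_0) < 2 ^ aleph_0]; as cardinals are linearly ordered, a strict
    inequality is the negation of the converse weak one. *)
Definition few_countable_models L (T : theory L) : Prop :=
  ~ ([set: set nat] #<= countable_model_classes T).

(** * Formulas with parameters and definable sets *)

Record pform L (C : structure L) (n : nat) := PForm {
  pf_arity : nat;
  pf_body : formula L (n + pf_arity);
  pf_par : 'I_pf_arity -> C }.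

Definition psat L (C : structure L) n (f : pform C n) (a : 'I_n -> C) : Prop :=
  sat (pf_body f) (tcat a (@pf_par _ _ _ f)).

Definition pnot L (C : structure L) n (f : pform C n) : pform C n :=
  PForm (FNot (pf_body f)) (@pf_par _ _ _ f).

(** [over A f]: [f] is an [L_A]-formula. *)
Definition over L (C : structure L) n (A : set C) (f : pform C n) : Prop :=
  forall i, A (@pf_par _ _ _ f i).

(** [A]-definable subsets of [C ^ n]; [definable setT] is parametric
    definability, [definable set0] is 0-definability. *)
Definition definable L (C : structure L) n (A : set C) (X : set ('I_n -> C))
    : Prop :=
  exists2 f : pform C n, over A f & X = [set a | psat f a].

Definition definable1 L (C : structure L) (A : set C) (X : set C) : Prop :=
  @definable L C 1 A [set a | X (a ord0)].

Definition definable2 L (C : structure L) (A : set C) (E : C -> C -> Prop)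
    : Prop :=
  @definable L C 2 A [set a | E (a ord0) (a ord_max)].

(** * Types over sets of parameters *)

Definition complete_type L (C : structure L) (A : set C) (p : set (pform C 1))
    : Prop :=
  [/\ forall f, p f -> over A f,
      forall k (f : 'I_k -> pform C 1), (forall i, p (f i)) ->
        exists a, forall i, psat (f i) (tup1 a)
    & forall f, over A f -> p f \/ p (pnot f)].

Definition realizations L (C : structure L) (p : set (pform C 1)) : set C :=
  [set a | forall f, p f -> psat f (tup1 a)].

(** * Monster models *)

(** [small K A]: the cardinality of [A] is smaller than that of [K]. *)
Definition small (K U : Type) (A : set U) : Prop := ~ ([set: K] #<= A).

Definition uncountable_strong_limit (K : Type) : Prop :=
  small K [set: nat] /\
  forall S : set K, small K S -> small K [set X : set K | X `<=` S].

Definition saturated (K : Type) L (C : structure L) : Prop :=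
  forall (A : set C) (p : set (pform C 1)),
    small K A -> complete_type A p -> realizations p !=set0.

Definition partial_elementary L (C : structure L) (A : set C) (h : C -> C)
    : Prop :=
  forall n (phi : formula L n) (a : 'I_n -> C), (forall i, A (a i)) ->
    (sat phi a <-> sat phi (h \o a)).

Definition strongly_homogeneous (K : Type) L (C : structure L) : Prop :=
  forall (A : set C) (h : C -> C), small K A -> partial_elementary A h ->
    exists2 s : C -> C, isomorphism s & forall a, A a -> s a = h a.

(** [C] is a monster model of [T], where "small" means of cardinality smaller
    than that of [K].  The language is meant to be countable, so that the
    cardinality of [K] exceeds that of the language. *)
Definition monster_model (K : Type) L (T : theory L) (C : structure L) : Prop :=
  [/\ uncountable_strong_limit K, model T C, saturated K C
    & strongly_homogeneous K C].

(** * Weak quasi-o-minimality *)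

Definition equivalence_on (X : Type) (D : set X) (E : X -> X -> Prop) : Prop :=
  [/\ forall x, D x -> E x x,
      forall x y, D x -> D y -> E x y -> E y x
    & forall x y z, D x -> D y -> D z -> E x y -> E y z -> E x z].

Definition lt_of L (C : structure L) (lt : formula L 2) (x y : C) : Prop :=
  sat lt (tup2 x y).

Definition strict_linear_order (X : Type) (R : X -> X -> Prop) : Prop :=
  [/\ forall x, ~ R x x,
      forall x y z, R x y -> R y z -> R x z
    & forall x y, [\/ R x y, x = y | R y x]].

Definition convex (X : Type) (R : X -> X -> Prop) (D : set X) : Prop :=
  forall x y z, D x -> D z -> R x y -> R y z -> D y.

Inductive boolean_combination (X : Type) (G : set (set X)) : set X -> Prop :=
| BCgen D : G D -> boolean_combination G D
| BCcompl D : boolean_combination G D -> boolean_combination G (~` D)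
| BCinter D D' : boolean_combination G D -> boolean_combination G D' ->
    boolean_combination G (D `&` D').

(** The theory of [C] is weakly quasi-o-minimal with respect to the order
    defined by [lt]. *)
Definition weakly_quasi_o_minimal_wrt L (C : structure L) (lt : formula L 2)
    : Prop :=
  strict_linear_order (@lt_of L C lt) /\
  forall X : set C, definable1 setT X ->
    boolean_combination
      [set D | definable1 set0 D \/ convex (@lt_of L C lt) D] X.

(** * Convexity rank *)

(** [RC_ge lt n X] is [RC(phi) >= n], where [X] is the solution set of [phi]. *)
Fixpoint RC_ge L (C : structure L) (lt : formula L 2) (n : nat) (X : set C)
    : Prop :=
  match n with
  | 0 => X !=set0
  | n'.+1 => exists E : C -> C -> Prop,
      [/\ definable2 setT E,
          equivalence_on setT E,
          forall c, convex (@lt_of L C lt) [set x | E x c]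
        & exists b : nat -> C,
            (forall i j, i <> j -> ~ E (b i) (b j)) /\
            forall i, RC_ge lt n' (X `&` [set x | E x (b i)])]
  end.

Definition finite_convexity_rank L (C : structure L) (lt : formula L 2)
    : Prop :=
  exists n, RC_ge lt n [set: C] /\ forall m, RC_ge lt m [set: C] -> m <= n.

(** * Imaginaries *)

(** The sorts of [C^eq]: the home sort, and a sort [C^n / E] for every formula
    [E(x, y)] without parameters defining an equivalence relation on [C^n]. *)
Inductive eqsort L (C : structure L) : Type :=
| Home
| Quot n (E : formula L (n + n)) of
    equivalence_on [set: 'I_n -> C] (fun a b => sat E (tcat a b)).

Definition eqclass L (C : structure L) n (E : formula L (n + n))
    (a : 'I_n -> C) : set ('I_n -> C) :=
  [set b | sat E (tcat a b)].

Definition eqsort_carrier L (C : structure L) (s : eqsort C) : Type :=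
  match s with
  | Home => C
  | @Quot _ _ n E _ =>
      {X : set ('I_n -> C) | exists a : 'I_n -> C, X = eqclass E a}
  end.

(** Elements of [C^eq], tagged with their sort. *)
Definition eqelt L (C : structure L) : Type := {s : eqsort C & eqsort_carrier s}.

Definition eqelt_sort L (C : structure L) (e : eqelt C) : eqsort C := projT1 e.

Definition home_elt L (C : structure L) (a : C) : eqelt C :=
  existT (@eqsort_carrier L C) (Home C) a.

Definition quot_elt L (C : structure L) n (E : formula L (n + n))
    (hE : equivalence_on [set: 'I_n -> C] (fun a b => sat E (tcat a b)))
    (a : 'I_n -> C) : eqelt C :=
  existT (@eqsort_carrier L C) (Quot hE)
    (exist _ (eqclass E a) (ex_intro _ a erefl)).

(** [L^eq]-formulas.  Bound variables have a sort, free variables do not: on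
    arguments of the wrong sorts, an atomic formula is false.  Hence on every
    finite product of sorts these formulas define the same relations as
    many-sorted [L^eq]-formulas.  The basic formulas are equality, the
    [L]-formulas on the home sort, and the graphs of the projections
    [C^k -> C^k / E]. *)
Inductive eqform L (C : structure L) : nat -> Type :=
| EFalse n : eqform C n
| EEq n of 'I_n & 'I_n : eqform C n
| EHome n k (phi : formula L k) (x : 'I_k -> 'I_n) : eqform C n
| EProj n k (E : formula L (k + k))
    (hE : equivalence_on [set: 'I_k -> C] (fun a b => sat E (tcat a b)))
    (x : 'I_k -> 'I_n) (y : 'I_n) : eqform C n
| EImp n of eqform C n & eqform C n : eqform C n
| EAll n (s : eqsort C) of eqform C n.+1 : eqform C n.

Fixpoint eqsat L (C : structure L) n (phi : eqform C n)
    : ('I_n -> eqelt C) -> Prop :=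
  match phi in eqform _ n return ('I_n -> eqelt C) -> Prop with
  | EFalse _ => fun=> False
  | EEq _ i j => fun v => v i = v j
  | EHome _ k f x => fun v => exists2 a : 'I_k -> C,
      forall i, v (x i) = home_elt (a i) & sat f a
  | EProj _ k E hE x y => fun v => exists2 a : 'I_k -> C,
      forall i, v (x i) = home_elt (a i) & v y = quot_elt hE a
  | EImp _ f g => fun v => eqsat f v -> eqsat g v
  | EAll _ s f => fun v =>
      forall e : eqelt C, eqelt_sort e = s -> eqsat f (tcons e v)
  end.

(** * Thorn-forking and rosiness *)

(** [L^eq]-formulas with parameters from [C^eq]. *)
Record peqform L (C : structure L) (n : nat) := PEqForm {
  pe_arity : nat;
  pe_body : eqform C (n + pe_arity);
  pe_par : 'I_pe_arity -> eqelt C }.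

Definition peqsat L (C : structure L) n (f : peqform C n)
    (a : 'I_n -> eqelt C) : Prop :=
  eqsat (pe_body f) (tcat a (@pe_par _ _ _ f)).

Definition eqover L (C : structure L) n (A : set (eqelt C)) (f : peqform C n)
    : Prop :=
  forall i, A (@pe_par _ _ _ f i).

(** [tp(a / A) = tp(b / A)] in [C^eq]. *)
Definition same_eqtype L (C : structure L) n (A : set (eqelt C))
    (a b : 'I_n -> eqelt C) : Prop :=
  forall f : peqform C n, eqover A f -> (peqsat f a <-> peqsat f b).

(** [phi(x, a)] strongly divides over [A]: [tp(a / A)] is not algebraic, and
    [{phi(x, a') | a' realizes tp(a / A)}] is [k]-inconsistent for some [k]. *)
Definition strongly_divides L (C : structure L) n (A : set (eqelt C))
    (f : peqform C n) : Prop :=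
  infinite_set [set b | same_eqtype A (@pe_par _ _ _ f) b] /\
  exists k : nat, forall b : 'I_k -> ('I_(pe_arity f) -> eqelt C),
    injective b -> (forall i, same_eqtype A (@pe_par _ _ _ f) (b i)) ->
    ~ exists x : 'I_n -> eqelt C, forall i, eqsat (pe_body f) (tcat x (b i)).

Definition thorn_divides L (C : structure L) n (A : set (eqelt C))
    (f : peqform C n) : Prop :=
  exists m (c : 'I_m -> eqelt C), strongly_divides (A `|` range c) f.

(** A formula thorn-forks if it implies a finite disjunction of formulas that
    thorn-divide. *)
Definition thorn_forks L (C : structure L) n (A : set (eqelt C))
    (f : peqform C n) : Prop :=
  exists k (g : 'I_k -> peqform C n),
    (forall i, thorn_divides A (g i)) /\
    forall x, peqsat f x -> exists i, peqsat (g i) x.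

(** [tp(a / B)] thorn-forks over [A]. *)
Definition type_thorn_forks L (C : structure L) n (A B : set (eqelt C))
    (a : 'I_n -> eqelt C) : Prop :=
  exists f : peqform C n, [/\ eqover B f, peqsat f a & thorn_forks A f].

(** Rosiness as local character of thorn-forking in [C^eq]; the bounding
    cardinal is that of a small set [S]. *)
Definition rosy (K : Type) L (C : structure L) : Prop :=
  forall n (a : 'I_n -> eqelt C), exists2 S : set K, small K S &
    forall B : set (eqelt C), small K B ->
      exists A : set (eqelt C),
        [/\ A `<=` B, A #<= S & ~ type_thorn_forks A B a].

(** * Relatively definable equivalence relations *)

(** [X = phi(C) /\ p(C)^n] for some [L_B]-formula [phi]. *)
Definition relatively_definable L (C : structure L) n (p : set (pform C 1))
    (B : set C) (X : set ('I_n -> C)) : Prop :=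
  exists2 f : pform C n, over B f &
    X = [set a | psat f a /\ forall i, realizations p (a i)].

Definition graph2 (X : Type) (E : X -> X -> Prop) : set ('I_2 -> X) :=
  [set a | E (a ord0) (a ord_max)].

(** [type_equivalences A p E]: [E] is a member of the set of relatively
    [A]-definable equivalence relations on [p(C)]. *)
Definition type_equivalences L (C : structure L) (A : set C)
    (p : set (pform C 1)) : set (C -> C -> Prop) :=
  [set E | relatively_definable p A (graph2 E) /\
           equivalence_on (realizations p) E].

Definition condition_R (K : Type) L (C : structure L) : Prop :=
  forall (A : set C) (p : set (pform C 1)), small K A -> complete_type A p ->
    forall E, type_equivalences A p E -> relatively_definable p set0 (graph2 E).

(* Main.v *)
(** Both hypotheses bound a rank that counts nested convex equivalence relations with many classes,
    uniformly in the parameters.  Suppose that [E] violates (R).  On the locus of a type, [E] agrees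
    with a convex relation [E_c] on the whole model, and compactness yields a conjugate [E_c'] with
    a class that meets several [E_c]-classes; as the rank is finite, it meets finitely many, so that
    the [E_c]-classes in the locus of a type [q] over [c] form a discrete order.  The cut above the
    successors of a class then carries a type, which is stationary enough to have Morley
    sequences indexed by any linear order: independence of [a] and [y] follows once more from the
    finiteness of the rank.  Since no gap between consecutive elements of such a sequence is
    definable, one can omit all further elements that fit in its order; the order of the sequence is
    then an invariant of the countable model, and there are continuum many models. *)

From mathcomp Require Import all_boot all_order all_algebra.
From mathcomp Require Import boolp classical_sets functions cardinality filter.
From mathcomp Require Import zify.
Require Import Defs.

Set Implicit Arguments.
Unset Strict Implicit.
Unset Printing Implicit Defensive.

Local Open Scope classical_set_scope.
Local Open Scope card_scope.

(** The rank fixes one 0-definable family [E] and lets only its parameters vary: it is then bounded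
    by the convexity rank, and in the rosy case all the nested classes belong to a single sort of
    imaginaries. Each level asks for more than continuum many classes. In a countable language there
    are at most continuum many types over a finite tuple, so many classes remain conjugate whatever
    finite data were chosen before. A model that contains a Morley sequence also contains other
    elements close to its members, so the order of the sequence can be read off only up to
    incomparability, the failure of independence in both directions. [lim_split] makes this relation
    compatible with the order; after the omission every relevant element of the model is
    incomparable with a member of the sequence. The orders used are recognized by their maximal
    finite runs of consecutive elements. An isomorphism may move the finitely many parameters behind
    this coding. For each model that leaves only countably many possibilities, and a continuum
    cannot be exhausted by countably many repetitions of fewer objects. *)

Definition up_ren n m (r : 'I_n -> 'I_m) : 'I_n.+1 -> 'I_m.+1 :=
  fun i => oapp (fun j => lift ord0 (r j)) ord0 (unlift ord0 i).

Fixpoint tren L n m (r : 'I_n -> 'I_m) (t : term L n) : term L m :=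
  match t with
  | Var i => Var L (r i)
  | App f ts => App (fun i => tren r (ts i))
  end.

Fixpoint fren L n (phi : formula L n) : forall m, ('I_n -> 'I_m) -> formula L m :=
  match phi in formula _ n return forall m, ('I_n -> 'I_m) -> formula L m with
  | FFalse _ => fun m r => FFalse
  | FEq _ t u => fun m r => FEq (tren r t) (tren r u)
  | FRel _ R ts => fun m r => FRel (fun i => tren r (ts i))
  | FImp _ f g => fun m r => FImp (fren f r) (fren g r)
  | FAll _ f => fun m r => FAll (fren f (up_ren r))
  end.

Lemma tcons_up (X : Type) n m (r : 'I_n -> 'I_m) (x : X) (v : 'I_m -> X) :
  tcons x v \o up_ren r = tcons x (v \o r).
Proof.
apply/funext => i; rewrite /tcons /up_ren /=.
by case: (unlift ord0 i) => [j|] /=; rewrite ?liftK ?unlift_none.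
Qed.

Lemma eval_tren L (M : structure L) n m (r : 'I_n -> 'I_m) (v : 'I_m -> M)
    (t : term L n) : eval v (tren r t) = eval (v \o r) t.
Proof.
by elim: t => [//|f ts IH] /=; congr func_interp; apply/funext => i; exact: IH.
Qed.

Lemma sat_fren L (M : structure L) n (phi : formula L n) m (r : 'I_n -> 'I_m)
    (v : 'I_m -> M) : sat (fren phi r) v <-> sat phi (v \o r).
Proof.
elim: phi m r v => {n} [n|n t u|n R ts|n f IHf g IHg|n f IHf] m r v /=.
- by [].
- by rewrite !eval_tren.
- by under eq_fun do rewrite eval_tren.
- by split=> H /IHf /H /IHg.
- split=> H x; first by move/IHf: (H x); rewrite tcons_up.
  by apply/IHf; rewrite tcons_up.
Qed.

(** * Relations definable with parameters *)

Section Definable.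
Variables (L : language) (C : structure L).
Implicit Types (A : set C).

Definition aval (V : Type) (v : V -> C) (s : V + C) : C :=
  match s with inl w => v w | inr a => a end.

Definition par_in (A : set C) (V : Type) (s : V + C) : Prop :=
  match s with inl _ => True | inr a => A a end.

(** Variables are indexed by an arbitrary type [V], so that definability is
    stated for predicates of assignments. *)
Definition Dfn A (V : Type) (P : (V -> C) -> Prop) : Prop :=
  exists k (phi : formula L k) (x : 'I_k -> V + C),
    (forall i, par_in A (x i)) /\ forall v, P v <-> sat phi (aval v \o x).

Lemma Dfn_ext A V (P Q : (V -> C) -> Prop) :
  (forall v, P v <-> Q v) -> Dfn A P -> Dfn A Q.
Proof.
by move=> PQ [k [f [x [xA H]]]]; exists k, f, x; split=> // v; rewrite -PQ.
Qed.

Lemma Dfn_mono A A' V (P : (V -> C) -> Prop) : A `<=` A' -> Dfn A P -> Dfn A' P.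
Proof.
move=> sAA' [k [f [x [xA H]]]]; exists k, f, x; split=> // i.
by move: (xA i); case: (x i) => //= a /sAA'.
Qed.

Lemma Dfn_sub A V W (f : V -> W + C) (P : (V -> C) -> Prop) :
  (forall i, par_in A (f i)) -> Dfn A P -> Dfn A (fun w => P (aval w \o f)).
Proof.
move=> fA [k [phi [x [xA H]]]].
exists k, phi, (fun i => match x i with inl w => f w | inr a => inr a end).
split=> [i|w].
  by move: (xA i); case: (x i) => //= w _; exact: fA.
rewrite H; set u := _ \o _; set u' := _ \o _.
by have -> : u = u' by apply/funext => i; rewrite /u /u' /=; case: (x i).
Qed.

Lemma Dfn_ren A V W (f : V -> W) (P : (V -> C) -> Prop) :
  Dfn A P -> Dfn A (fun w => P (w \o f)).
Proof. by move=> H; apply: (@Dfn_sub A V W (inl \o f) P). Qed.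

Lemma Dfn_sat k (phi : formula L k) : Dfn set0 (fun v : 'I_k -> C => sat phi v).
Proof. by exists k, phi, inl; split. Qed.

Lemma Dfn_False A V : Dfn A (fun _ : V -> C => False).
Proof.
by exists 0, FFalse, (fun i : 'I_0 => False_rect _ (notF (ltn_ord i))); split=> // -[].
Qed.

Lemma Dfn_imp A V (P Q : (V -> C) -> Prop) :
  Dfn A P -> Dfn A Q -> Dfn A (fun v => P v -> Q v).
Proof.
move=> [k [f [x [xA Hf]]]] [l [g [y [yA Hg]]]].
exists (k + l), (FImp (fren f (lshift l)) (fren g (@rshift k l))).
exists (tcat x y); split=> [i|v /=].
  by rewrite /tcat; case: (fintype.split i).
rewrite !sat_fren Hf Hg.
set u := _ \o x; set u' := _ \o y; set w := _ \o lshift l; set w' := _ \o _.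
suff [-> ->] : u = w /\ u' = w' by [].
split; apply/funext => i; rewrite /u /u' /w /w' /= /tcat.
  by rewrite -[lshift l i]/(unsplit (inl i)) unsplitK.
by rewrite -[rshift k i]/(unsplit (inr i)) unsplitK.
Qed.

Lemma Dfn_not A V (P : (V -> C) -> Prop) : Dfn A P -> Dfn A (fun v => ~ P v).
Proof. by move=> dP; apply: Dfn_imp dP (Dfn_False A V). Qed.

Lemma Dfn_and A V (P Q : (V -> C) -> Prop) :
  Dfn A P -> Dfn A Q -> Dfn A (fun v => P v /\ Q v).
Proof.
move=> dP dQ; apply: Dfn_ext (Dfn_not (Dfn_imp dP (Dfn_not dQ))) => v.
by split=> [/not_implyP[p /contrapT q]//|[p q] H]; exact: H p q.
Qed.

Lemma Dfn_or A V (P Q : (V -> C) -> Prop) :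
  Dfn A P -> Dfn A Q -> Dfn A (fun v => P v \/ Q v).
Proof.
move=> dP dQ; apply: Dfn_ext (Dfn_imp (Dfn_not dP) dQ) => v.
by split=> [H|[p|q] //]; case: (pselect (P v)) => p; [left|right; exact: H].
Qed.

Lemma Dfn_iff A V (P Q : (V -> C) -> Prop) :
  Dfn A P -> Dfn A Q -> Dfn A (fun v => P v <-> Q v).
Proof. by move=> dP dQ; apply: Dfn_and; apply: Dfn_imp. Qed.

Lemma Dfn_True A V : Dfn A (fun _ : V -> C => True).
Proof. by apply: Dfn_ext (Dfn_imp (Dfn_False A V) (Dfn_False A V)) => v; split. Qed.

Lemma Dfn_const A V (P : Prop) : Dfn A (fun _ : V -> C => P).
Proof.
case: (pselect P) => p; first by apply: Dfn_ext (Dfn_True A V) => v; split.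
by apply: Dfn_ext (Dfn_False A V) => v; split.
Qed.

Definition ocons V (a : C) (v : V -> C) : option V -> C :=
  fun o => match o with Some w => v w | None => a end.

(** [FAll] binds one variable, whereas [None] may occur at any number of positions of [x]. The
    positions outside [S] are all renamed to the bound variable; those in [S] are enumerated to form
    the new context. *)
Lemma Dfn_all_ A V (P : (option V -> C) -> Prop) :
  Dfn A P -> Dfn A (fun v => forall a, P (ocons a v)).
Proof.
move=> [k [f [x [xA Hf]]]]; have [c0] := carrier_inh C.
pose S := [set i : 'I_k | if x i is inl None then false else true]%SET.
pose y (j : 'I_#|S|) : V + C := match x (enum_val j) with
  | inl (Some w) => inl w | inr a => inr a | inl None => inr c0 end.
pose r (i : 'I_k) : 'I_#|S|.+1 := match @idP (i \in S) with
  | ReflectT h => lift ord0 (enum_rank_in h i) | ReflectF _ => ord0 end.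
exists _, (FAll (fren f r)), y; split=> [j|v /=].
  rewrite /y; move: (enum_valP j) (xA (enum_val j)); rewrite inE.
  by case: (x _) => [[w|]|a].
have E a : aval (ocons a v) \o x = tcons a (aval v \o y) \o r.
  apply/funext => i; rewrite /= /r; case: {-}_ / (@idP (i \in S)) => [h|h].
    rewrite /tcons liftK /= /y enum_rankK_in //.
    by move: h; rewrite inE; case: (x i) => [[w|]|b].
  rewrite /tcons unlift_none /=.
  by move: h; rewrite inE; case: (x i) => [[w|]|b].
by split=> H a; move: (H a); rewrite Hf sat_fren E.
Qed.

Lemma Dfn_all A V (R : (V -> C) -> C -> Prop) :
  Dfn A (fun u : option V -> C => R (u \o Some) (u None)) ->
  Dfn A (fun v => forall a, R v a).
Proof. by move=> /Dfn_all_; apply: Dfn_ext. Qed.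

Lemma Dfn_ex A V (R : (V -> C) -> C -> Prop) :
  Dfn A (fun u : option V -> C => R (u \o Some) (u None)) ->
  Dfn A (fun v => exists a, R v a).
Proof.
move=> /Dfn_not /(@Dfn_all _ _ (fun v a => ~ R v a)) /Dfn_not; apply: Dfn_ext => v.
by split=> [/existsNP[a /contrapT]|[a Ra]]; [exists a|move=> /(_ a)].
Qed.

Lemma Dfn_eq A V (i j : V) : Dfn A (fun v => v i = v j).
Proof.
exists 2, (FEq (Var L ord0) (Var L ord_max)), (tup2 (inl i) (inl j)).
by split=> [l|v] //=; rewrite /tup2 /=; case: ifP.
Qed.

End Definable.

(** * Cardinality *)

Lemma card_le_of T U (A : set T) (B : set U) (f : T -> U) :
  (forall x, A x -> B (f x)) ->
  (forall x y, A x -> A y -> f x = f y -> x = y) -> A #<= B.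
Proof.
move=> fAB f_inj.
have [F] : $|{injfun A >-> B}|.
  apply/injfunPex; exists f => // x y /set_mem Ax /set_mem Ay; exact: f_inj.
exact: inj_card_le F.
Qed.

Lemma card_le_fun T U (A : set T) (B : set U) (u0 : U) : A #<= B ->
  exists f : T -> U, (forall x, A x -> B (f x)) /\
    (forall x y, A x -> A y -> f x = f y -> x = y).
Proof.
move=> /card_leP[g].
exists (fun x => match pselect (A x) with
  | left h => val (g (SigSub (mem_set h))) | right _ => u0 end).
split=> [x Ax|x y Ax Ay].
  by case: pselect => // h; exact/set_mem/valP.
case: pselect => // hx; case: pselect => // hy /val_inj E.
have /(_ _ _ E) := @inj _ _ _ g (SigSub (mem_set hx)) (SigSub (mem_set hy)).
by rewrite !inE => /(_ I I) [].
Qed.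

(** Comparability of cardinals by Zorn's lemma for partial injections, represented as relations: a
    maximal one is defined on all of [A] or reaches all of [B]. *)
Lemma card_le_total T U (A : set T) (B : set U) : A #<= B \/ B #<= A.
Proof.
case: (pselect (exists u : U, True)) => [[u0 _]|noU]; last first.
  right; have -> : B = set0 by apply/seteqP; split=> // u; case: noU; exists u.
  exact: card_ge0.
case: (pselect (exists t : T, True)) => [[t0 _]|noT]; last first.
  left; have -> : A = set0 by apply/seteqP; split=> // u; case: noT; exists u.
  exact: card_ge0.
pose ok (R : T -> U -> Prop) := (forall x y, R x y -> A x /\ B y) /\
  forall x y x' y', R x y -> R x' y' -> (x = x' <-> y = y').
pose W := {R : T -> U -> Prop | ok R}.
pose le (R S : W) := `[< forall x y, sval R x y -> sval S x y >].
have [||||R Rmax] := @Zorn W le.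
- by move=> R; apply/asboolP.
- by move=> R S Q /asboolP H1 /asboolP H2; apply/asboolP => x y /H1/H2.
- move=> [R okR] [S okS] /asboolP H1 /asboolP H2.
  by apply: eq_exist; apply/funext => x; apply/funext => y; apply/propext; split;
    [exact: H1|exact: H2].
- move=> ch chT; have ok0 : ok (fun x y => exists2 R, ch R & sval R x y).
    split=> [x y [R _ Rxy]|x y x' y' [R chR Rxy] [S chS Sxy]].
      exact: (svalP R).1 _ _ Rxy.
    have [/asboolP H|/asboolP H] := chT _ _ chR chS.
      exact: (svalP S).2 _ _ _ _ (H _ _ Rxy) Sxy.
    exact: (svalP R).2 _ _ _ _ Rxy (H _ _ Sxy).
  exists (exist _ _ ok0) => R chR; apply/asboolP => x y Rxy; by exists R.
have [domR|/existsNP[x0 /not_implyP[Ax0 nx0]]] :=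
    pselect (forall x, A x -> exists y, sval R x y).
  left; have /choice[f fP] : forall x, exists y, A x -> sval R x y.
    move=> x; case: (pselect (A x)) => [/domR[y]|nA]; first by exists y.
    by exists u0.
  apply: (@card_le_of _ _ _ _ f) => [x Ax|x y Ax Ay E].
    exact: ((svalP R).1 _ _ (fP _ Ax)).2.
  by apply/((svalP R).2 _ _ _ _ (fP _ Ax) (fP _ Ay)).
have [ranR|/existsNP[y0 /not_implyP[By0 ny0]]] :=
    pselect (forall y, B y -> exists x, sval R x y).
  right; have /choice[f fP] : forall y, exists x, B y -> sval R x y.
    move=> y; case: (pselect (B y)) => [/ranR[x]|nA]; first by exists x.
    by exists t0.
  apply: (@card_le_of _ _ _ _ f) => [x Ax|x y Ax Ay E].
    exact: ((svalP R).1 _ _ (fP _ Ax)).1.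
  by apply/((svalP R).2 _ _ _ _ (fP _ Ax) (fP _ Ay)).
exfalso; pose S x y := sval R x y \/ (x = x0 /\ y = y0).
have okS : ok S.
  split=> [x y [/(svalP R).1 //|[-> ->]] //|x y x' y'].
  case=> [Rxy|[-> ->]] [Rxy'|[-> ->]].
  - exact: (svalP R).2 _ _ _ _ Rxy Rxy'.
  - by split=> E; exfalso; [apply: nx0; exists y|apply: ny0; exists x]; rewrite -E.
  - by split=> E; exfalso; [apply: nx0; exists y'|apply: ny0; exists x']; rewrite E.
  - by [].
have lS : le R (exist _ S okS) by apply/asboolP => x y Rxy; left.
have /(congr1 sval) /= E := Rmax _ lS.
by apply: nx0; exists y0; rewrite -E; right.
Qed.

(** * Closure properties of small sets *)

Section Small.
Variables (K : Type) (hK : uncountable_strong_limit K).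

Lemma small_le T U (A : set T) (B : set U) : A #<= B -> small K B -> small K A.
Proof. by move=> AB sB KA; apply: sB; exact: card_le_trans KA AB. Qed.

Lemma small_sub T (A B : set T) : A `<=` B -> small K B -> small K A.
Proof. by move=> /subset_card_le; exact: small_le. Qed.

Lemma small_image T U (A : set T) (f : T -> U) : small K A -> small K (f @` A).
Proof. exact/small_le/card_image_le. Qed.

Lemma small_leK T (A : set T) : small K A -> A #<= [set: K].
Proof. by move=> sA; have [//|/sA] := card_le_total A [set: K]. Qed.

Lemma small_countable T (A : set T) : countable A -> small K A.
Proof. by move=> cA; apply: (small_le _ hK.1). Qed.

Lemma K_inh : exists k : K, True.
Proof.
apply: contrapT => H; apply: hK.1.
have -> : [set: K] = set0 by apply/seteqP; split=> // k _; apply: H; exists k.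
exact: card_ge0.
Qed.

(** The strong limit hypothesis concerns subsets of [K] only, so [A] is first embedded in [K]. *)
Lemma small_pow T (A : set T) : small K A -> small K [set X : set T | X `<=` A].
Proof.
move=> sA; have [k0 _] := K_inh.
have [f [_ f_inj]] := card_le_fun k0 (small_leK sA).
refine (small_le _ (hK.2 _ (@small_image _ _ _ f sA))).
apply: (@card_le_of _ _ _ _ (fun X => f @` X)) => [X /= XA|X Y /= XA YA E].
  exact: image_subset.
apply/seteqP; split=> x xX.
  have : (f @` Y) (f x) by rewrite -E; exists x.
  by move=> [y yY /f_inj <-] //; [exact: YA|exact: XA].
have : (f @` X) (f x) by rewrite E; exists x.
by move=> [y yY /f_inj <-] //; [exact: XA|exact: YA].
Qed.

(** By comparability one of the images of [A] and [B] in [K] bounds both. Its double power set has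
    room for two disjoint copies of it, namely [{{x}}] and [{set0, {x}}]. *)
Lemma small_sum T U (A : set T) (B : set U) : small K A -> small K B ->
  small K [set s : T + U | match s with inl a => A a | inr b => B b end].
Proof.
move=> sA sB; have [k0 _] := K_inh.
have [f [fK f_inj]] := card_le_fun k0 (small_leK sA).
have [g [gK g_inj]] := card_le_fun k0 (small_leK sB).
have sum_le (M : set K) : small K M -> A #<= M -> B #<= M ->
    small K [set s : T + U | match s with inl a => A a | inr b => B b end].
  move=> sM /(card_le_fun k0)[h [hM h_inj]] /(card_le_fun k0)[e [eM e_inj]].
  apply: (small_le _ (small_pow (small_pow sM))).
  apply: (@card_le_of _ _ _ _ (fun s => match s with
    | inl a => [set [set h a]] | inr b => [set set0; [set e b]] end)).
    by move=> [a Aa|b Bb] X /=; [move=> -> _ ->; exact: hM|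
      case=> -> // _ ->; exact: eM].
  move=> [a|b] [a'|b'] /= H H' E.
  - congr inl; apply: h_inj => //.
    have : [set [set h a']] [set h a] by rewrite -E.
    by move=> /= F; have : [set h a'] (h a) by rewrite -F.
  - have : [set [set h a]] set0 by rewrite E; left.
    by move=> /= F; have : set0 (h a) by rewrite F.
  - have : [set [set h a']] set0 by rewrite -E; left.
    by move=> /= F; have : set0 (h a') by rewrite F.
  - congr inr; apply: e_inj => //.
    have : [set set0; [set e b']] [set e b] by rewrite -E; right.
    case=> /= F; last by have : [set e b'] (e b) by rewrite -F.
    by have : set0 (e b) by rewrite -F.
have [AB|BA] := card_le_total (f @` A) (g @` B).
  apply: (sum_le (g @` B)); [exact: small_image| |].
    by apply: card_le_trans AB; apply: (@card_le_of _ _ _ _ f).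
  by apply: (@card_le_of _ _ _ _ g).
apply: (sum_le (f @` A)); [exact: small_image| |].
  by apply: (@card_le_of _ _ _ _ f).
by apply: card_le_trans BA; apply: (@card_le_of _ _ _ _ g).
Qed.

Lemma smallU T (A B : set T) : small K A -> small K B -> small K (A `|` B).
Proof.
move=> sA sB.
apply: (small_sub _ (@small_image _ _ _
  (fun s => match s with inl a => a | inr b => b end) (small_sum sA sB))).
by move=> x [Ax|Bx]; [exists (inl x)|exists (inr x)].
Qed.

Lemma small1 T (a : T) : small K [set a].
Proof. exact/small_countable/countable1. Qed.

Lemma small_set0 T : small K (@set0 T).
Proof. exact/small_countable/countable0. Qed.

Lemma smallT_pow T : small K [set: T] -> small K [set: set T].
Proof. by move=> /small_pow; apply: small_sub. Qed.

End Small.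

(** Applied to the predecessors or the successors of two points, it embeds a finite part of a strict
    order into the integers by counting. *)
Lemma count_lt (T : eqType) (p q : pred T) (l : seq T) x : (forall y, p y -> q y) ->
  x \in l -> ~~ p x -> q x -> count p l < count q l.
Proof.
move=> pq xl npx qx; rewrite -(size_filter q) -(count_predC p) !count_filter.
rewrite -[X in X < _]addn0 (@eq_count _ p (predI p q)) => [|y /=]; last first.
  by case E : (p y); rewrite ?(pq _ E).
by rewrite ltn_add2l -has_count; apply/hasP; exists x => //=; rewrite npx.
Qed.

Fixpoint All (T : Type) (P : T -> Prop) (s : seq T) : Prop :=
  if s is x :: s' then P x /\ All P s' else True.

Lemma All_cat T (P : T -> Prop) s t : All P (s ++ t) <-> All P s /\ All P t.
Proof. by elim: s => [|x s IH] /=; [split=> [|[]]|rewrite IH; tauto]. Qed.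

Lemma All_impl T (P Q : T -> Prop) s : (forall x, P x -> Q x) -> All P s -> All Q s.
Proof. by move=> PQ; elim: s => [|x s IH] //= [/PQ ? /IH ?]. Qed.

(** * Types and automorphisms *)

Section Types.
Variables (L : language) (C : structure L).
Implicit Types (A : set C).

(** Parameters turned into variables can be moved by automorphisms and quantified over. A parameter
    in [A] stays a parameter even if [g] lists it. *)
Lemma Dfn_absorb A A' V I (g : I -> C) (P : (V -> C) -> Prop) :
  A' `<=` A `|` range g -> Dfn A' P ->
  exists Q : (V + I -> C) -> Prop, Dfn A Q /\
    forall v, P v <-> Q (fun s => match s with inl w => v w | inr i => g i end).
Proof.
move=> sA [k [f [x [xA H]]]].
pose y i : (V + I) + C := match x i with
  | inl w => inl (inl w)
  | inr a => if pselect (A a) then inr a else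
      match pselect (exists j, g j = a) with
      | left e => inl (inr (sval (cid e))) | right _ => inr a end end.
exists (fun u => sat f (aval u \o y)); split.
  exists k, f, y; split=> // i; rewrite /y; move: (xA i); case: (x i) => //= a A'a.
  case: pselect => //= nA; case: pselect => //= ne; exfalso.
  by have [//|[j _ E]] := sA _ A'a; apply: ne; exists j.
move=> v; rewrite H; set u := _ \o x; set u' := _ \o y.
have -> // : u = u'; apply/funext => i; rewrite /u /u' /= /y.
case: (x i) => //= a; case: pselect => //= nA.
by case: pselect => //= e; rewrite (svalP (cid e)).
Qed.

Lemma Dfn_finpar A V (P : (V -> C) -> Prop) : Dfn A P ->
  exists d (z : 'I_d -> C), (forall i, A (z i)) /\ Dfn (range z) P.
Proof.
move=> [k [f [x [xA H]]]]; have [c0] := carrier_inh C.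
pose S := [set i : 'I_k | if x i is inr _ then true else false]%SET.
pose z (j : 'I_#|S|) := match x (enum_val j) with inl _ => c0 | inr a => a end.
exists #|S|, z; split=> [j|].
  rewrite /z; move: (enum_valP j) (xA (enum_val j)); rewrite inE.
  by case: (x _).
exists k, f, x; split=> // i.
have : (if x i is inr _ then true else false) -> i \in S by rewrite inE.
case E : (x i) => [|a] //= /(_ isT) iS; exists (enum_rank_in iS i) => //.
by rewrite /z enum_rankK_in // E.
Qed.

Lemma Dfn_unpar A V (P : (V -> C) -> Prop) : Dfn A P ->
  exists d (z : 'I_d -> C) (Q : (V + 'I_d -> C) -> Prop),
    [/\ forall i, A (z i), Dfn set0 Q &
      forall v, P v <-> Q (fun s => match s with inl w => v w | inr i => z i end)].
Proof.
move=> /Dfn_finpar[d [z [zA]]] /(@Dfn_absorb set0)-/(_ _ z) [|Q [dQ PQ]].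
  by move=> a; right.
by exists d, z, Q.
Qed.

Lemma Dfn_pform A n (P : ('I_n -> C) -> Prop) : Dfn A P ->
  exists f : pform C n, over A f /\ forall v, psat f v <-> P v.
Proof.
move=> /Dfn_unpar[d [z [Q [zA [k [phi [x [x0 HQ]]]] HP]]]].
have /choice[r rP] : forall i : 'I_k, exists j : 'I_(n + d), x i = inl (fintype.split j).
  move=> i; move: (x0 i); case: (x i) => // s _.
  by exists (unsplit s); rewrite unsplitK.
exists (PForm (fren phi r) z); split=> // v.
rewrite HP HQ /psat /= sat_fren; set u := _ \o r; set u' := _ \o x.
have -> // : u = u'; apply/funext => i; rewrite /u /u' /= rP /= /tcat.
by case: (fintype.split _).
Qed.

Lemma psat_Dfn A n (f : pform C n) : over A f -> Dfn A (psat f).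
Proof.
move=> fA; exists _, (pf_body f), (tcat inl (inr \o @pf_par _ _ _ f)).
split=> [i|v].
  by rewrite /tcat; case: (fintype.split i) => //= j; exact: fA.
rewrite /psat; set u := tcat _ _; set u' := _ \o _; have -> // : u = u'.
by apply/funext => i; rewrite /u /u' /= /tcat; case: (fintype.split i).
Qed.

Definition eqt A V (v w : V -> C) : Prop :=
  forall P : (V -> C) -> Prop, Dfn A P -> (P v <-> P w).

Definition autom A (s : C -> C) : Prop :=
  isomorphism s /\ forall a, A a -> s a = a.

Lemma eqt_sym A V (v w : V -> C) : eqt A v w -> eqt A w v.
Proof. by move=> H P dP; rewrite (H P dP). Qed.

Lemma eqt_trans A V (u v w : V -> C) : eqt A u v -> eqt A v w -> eqt A u w.
Proof. by move=> H H' P dP; rewrite (H P dP); exact: H'. Qed.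

End Types.

Lemma iso_eval L (M N : structure L) (h : M -> N) : isomorphism h ->
  forall n (t : term L n) v, h (eval v t) = eval (h \o v) t.
Proof.
move=> [_ hf _] n t v; elim: t => [//|f ts IH] /=.
by rewrite hf; congr func_interp; apply/funext => i /=.
Qed.

Lemma iso_sat L (M N : structure L) (h : M -> N) : isomorphism h ->
  forall n (phi : formula L n) v, sat phi v <-> sat phi (h \o v).
Proof.
move=> hI; have [[g hK gK] hf hr] := hI.
move=> n phi; elim: phi => {n} [n|n t u|n R ts|n f IHf g' IHg|n f IHf] v /=.
- by [].
- rewrite -!(iso_eval hI); split=> [->//|/(congr1 g)]; by rewrite !hK.
- rewrite hr; set a := _ \o _; set b := fun i => eval _ _.
  by have -> : a = b by apply/funext => i; rewrite /a /b /= (iso_eval hI).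
- by rewrite -IHf -IHg.
- have E x : h \o tcons x v = tcons (h x) (h \o v).
    by apply/funext => i; rewrite /tcons /=; case: (unlift _ _).
  by split=> H x; [rewrite -[x]gK -E -IHf|rewrite IHf E].
Qed.

Lemma iso_inverse L (M N : structure L) (h : M -> N) : isomorphism h ->
  exists h', [/\ isomorphism h', cancel h h' & cancel h' h].
Proof.
move=> [[g hK gK] hf hr]; exists g; split=> //; split; first by exists h.
  move=> f a; apply: (can_inj hK); rewrite gK hf; congr func_interp.
  by apply/funext => i /=; rewrite gK.
move=> r a; rewrite (hr r (g \o a)); set b := _ \o _; have -> // : b = a.
by apply/funext => i; rewrite /b /= gK.
Qed.

Section Autom.
Variables (L : language) (C : structure L).
Implicit Types (A : set C).

Lemma autom_Dfn A s V (P : (V -> C) -> Prop) : autom A s -> Dfn A P ->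
  forall v, P v <-> P (s \o v).
Proof.
move=> [sI sA] [k [f [x [xA H]]]] v; rewrite !H (iso_sat sI).
set u := s \o _; set u' := _ \o x; have -> // : u = u'.
apply/funext => i; rewrite /u /u' /=; move: (xA i); case: (x i) => //= a; exact: sA.
Qed.

Lemma autom_eqt A s V (v : V -> C) : autom A s -> eqt A v (s \o v).
Proof. by move=> As P dP; exact: (autom_Dfn As dP). Qed.

Lemma autom_sub A A' s : A `<=` A' -> autom A' s -> autom A s.
Proof. by move=> sA [sI H]; split=> // a /sA /H. Qed.

Lemma autom_inv A s : autom A s ->
  exists s', [/\ autom A s', cancel s s' & cancel s' s].
Proof.
move=> [sI sA]; have [g [gI sK gK]] := iso_inverse sI.
by exists g; split=> //; split=> // a Aa; rewrite -{1}(sA _ Aa) sK.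
Qed.

Variables (K : Type) (T : theory L).
Hypothesis hC : monster_model K T C.

Let hK : uncountable_strong_limit K. Proof. by case: hC. Qed.

(** [strongly_homogeneous] speaks of maps on a set, so the correspondence of tuples is made into a
    map [h]. It is well defined and fixes [A] because types decide equality of two coordinates and
    of a coordinate with a parameter. *)
Lemma homog A V (v w : V -> C) : small K (A `|` range v) -> eqt A v w ->
  exists s, autom A s /\ forall i, s (v i) = w i.
Proof.
move=> sm vw.
have vwA i a : A a -> v i = a -> w i = a.
  move=> Aa via; have dP : Dfn A (fun u : V -> C => u i = a).
    have f_in (b : bool) : par_in A (if b then inl i else inr a : V + C) by case: b.
    exact: (Dfn_sub f_in (Dfn_eq A true false)).
  exact/(vw _ dP).
have vwE i j : v i = v j -> w i = w j by move=> E; exact/(vw _ (Dfn_eq A i j)).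
pose h c := match pselect (exists i, v i = c) with
  | left e => w (sval (cid e)) | right _ => c end.
have hv i : h (v i) = w i.
  rewrite /h; case: pselect => [e|ne]; last by case: ne; exists i.
  by apply: vwE; rewrite (svalP (cid e)).
have hA a : A a -> h a = a.
  move=> Aa; rewrite /h; case: pselect => // e.
  by apply: vwA => //; rewrite (svalP (cid e)).
have [_ _ _ hom] := hC; have [|s sI sh] := hom _ h sm.
  move=> n phi a aA.
  have /choice[x xP] : forall i, exists x : V + C,
      [/\ par_in A x, aval v x = a i & aval w x = h (a i)].
    move=> i; case: (aA i) => [Aa|[j _ E]]; first by exists (inr (a i)); rewrite /= hA.
    by exists (inl j); rewrite -E /= hv.
  have dP : Dfn A (fun u : V -> C => sat phi (aval u \o x)).
    by exists n, phi, x; split=> // i; case: (xP i).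
  have -> : a = aval v \o x by apply/funext => i; case: (xP i).
  have -> : h \o (aval v \o x) = aval w \o x.
    by apply/funext => i /=; case: (xP i) => _ -> ->.
  exact: (vw _ dP).
exists s; split; first by split=> // a Aa; rewrite sh ?hA //; left.
by move=> i; rewrite sh ?hv //; right; exists i.
Qed.

End Autom.

(** * Saturation *)

Section Terms.
Variables (L : language) (C : structure L).
Implicit Types (A : set C).

Definition D1 A (P : C -> Prop) := Dfn A (fun v : unit -> C => P (v tt)).

Definition D2 A (R : C -> C -> Prop) :=
  Dfn A (fun v : bool -> C => R (v true) (v false)).

Definition Trm A V (t : (V -> C) -> C) :=
  exists s : V + C, par_in A s /\ forall v, t v = aval v s.

Lemma Trm_var A V (i : V) : Trm A (fun v => v i).
Proof. by exists (inl i). Qed.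

Lemma Trm_par A V (a : C) : A a -> Trm A (fun _ : V -> C => a).
Proof. by exists (inr a). Qed.

Lemma D1_at A V (P : C -> Prop) (t : (V -> C) -> C) :
  D1 A P -> Trm A t -> Dfn A (fun v => P (t v)).
Proof.
move=> dP [s [sA ts]].
by apply: Dfn_ext (Dfn_sub (f := fun=> s) _ dP) => //= v; rewrite ts.
Qed.

Lemma D2_at A V (R : C -> C -> Prop) (t u : (V -> C) -> C) :
  D2 A R -> Trm A t -> Trm A u -> Dfn A (fun v => R (t v) (u v)).
Proof.
move=> dR [s [sA ts]] [s' [s'A us]].
apply: Dfn_ext (Dfn_sub (f := fun b : bool => if b then s else s') _ dR).
  by move=> v /=; rewrite ts us.
by case.
Qed.

Lemma D2_eq A : D2 A (fun x y => x = y).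
Proof. exact: Dfn_eq. Qed.

Lemma D1_mono A A' P : A `<=` A' -> D1 A P -> D1 A' P.
Proof. exact: Dfn_mono. Qed.

Lemma D2_mono A A' R : A `<=` A' -> D2 A R -> D2 A' R.
Proof. exact: Dfn_mono. Qed.

Lemma Dfn_All A V T (P : T -> (V -> C) -> Prop) s :
  All (fun t => Dfn A (P t)) s -> Dfn A (fun v => All (fun t => P t v) s).
Proof.
elim: s => [|t s IH] /=; first by move=> _; exact: Dfn_True.
by move=> [dP /IH]; exact: Dfn_and.
Qed.

Definition sumv V W (v : V -> C) (w : W -> C) (s : V + W) : C :=
  match s with inl i => v i | inr j => w j end.

Lemma Dfn_ex_ord A W n (P : ('I_n + W -> C) -> Prop) : Dfn A P ->
  Dfn A (fun w => exists v : 'I_n -> C, P (sumv v w)).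
Proof.
elim: n W P => [|n IH] W P dP.
  have [c0] := carrier_inh C.
  pose f (s : 'I_0 + W) : W + C := match s with
    | inl i => False_rect _ (notF (ltn_ord i)) | inr w => inl w end.
  have fA s : par_in A (f s) by case: s => [[]|].
  apply: Dfn_ext (Dfn_sub fA dP) => w; split=> [Pw|[v Pv]].
    exists (fun=> c0); congr P: Pw; by apply/funext => -[[]|].
  by congr P: Pv; apply/funext => -[[]|].
pose f (s : 'I_n.+1 + W) : 'I_n + option W := match s with
  | inl i => oapp inl (inr None) (unlift ord0 i) | inr w => inr (Some w) end.
have := Dfn_ren f dP => /IH dQ.
apply: Dfn_ext (Dfn_ex (R := fun w a =>
  exists v : 'I_n -> C, P (sumv (tcons a v) w)) _).
  move=> w; split=> [[a [v Pv]]|[v Pv]]; first by exists (tcons a v).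
  exists (v ord0), (v \o lift ord0).
  congr P: Pv; apply/funext => -[i|//] /=; rewrite /tcons.
  by case: unliftP => [j ->|->].
apply: Dfn_ext dQ => u; split=> -[v Pv]; exists v.
  by congr P: Pv; apply/funext => -[i|//] /=; rewrite /tcons; case: unliftP.
by congr P: Pv; apply/funext => -[i|//] /=; rewrite /tcons; case: unliftP.
Qed.

(** [V] may be infinite, but only finitely many variables occur in the formula. [rep] chooses one
    position for each of them, so that repeated occurrences receive the same value. *)
Lemma Dfn_exV A V W (P : (V + W -> C) -> Prop) : Dfn A P ->
  Dfn A (fun w => exists v : V -> C, P (sumv v w)).
Proof.
move=> [k [f [x [xA H]]]]; have [c0] := carrier_inh C.
pose rep (w : V) : option 'I_k :=
  xget None [set o | exists j, o = Some j /\ x j = inl (inl w)].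
have repP i w : x i = inl (inl w) ->
    exists j, rep w = Some j /\ x j = inl (inl w).
  by move=> E; apply: (@xgetPex _ None
    [set o | exists j, o = Some j /\ x j = inl (inl w)]); exists (Some i), i.
pose y i : ('I_k + W) + C := match x i with
  | inl (inl w) => inl (inl (odflt i (rep w)))
  | inl (inr u) => inl (inr u) | inr a => inr a end.
have dQ : Dfn A (fun u : 'I_k + W -> C => sat f (aval u \o y)).
  exists k, f, y; split=> // i; rewrite /y; move: (xA i).
  by case: (x i) => [[|]|].
apply: Dfn_ext (Dfn_ex_ord dQ) => w; split=> -[v].
  move=> Sv; exists (fun z => oapp v c0 (rep z)); apply/H.
  congr (sat f): Sv; apply/funext => i; rewrite /= /y.
  case E : (x i) => [[z|]|] //=.
  by have [j [-> _]] := repP _ _ E.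
move=> /H Sv; exists (fun i => match x i with inl (inl z) => v z | _ => c0 end).
congr (sat f): Sv; apply/funext => i; rewrite /= /y.
case E : (x i) => [[z|]|] //=.
by have [j [-> /= ->]] := repP _ _ E.
Qed.

End Terms.

Section Saturation.
Variables (L : language) (C : structure L) (K : Type) (T : theory L).
Hypothesis hC : monster_model K T C.
Implicit Types (A : set C).

Let hK : uncountable_strong_limit K. Proof. by case: hC. Qed.

Definition fin_sat (X : Type) (F : set (set X)) :=
  forall s, All F s -> exists x, All (fun P : set X => P x) s.

Lemma fin_sat_ultra (X : Type) (F : set (set X)) : fin_sat F ->
  exists U : set_system X, UltraFilter U /\ F `<=` U.
Proof.
move=> hF.
pose G : set_system X := [set S | exists s, All F s /\
  forall x, All (fun P : set X => P x) s -> S x].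
have GF : ProperFilter G.
  apply: Build_ProperFilter_ex.
    by move=> P [s [/hF[x sx] H]]; exists x; exact: H.
  split; first by exists [::].
    move=> P Q [s [sF sP]] [t [tF tQ]]; exists (s ++ t); split; first exact/All_cat.
    by move=> x /All_cat[/sP ? /tQ].
  by move=> P Q PQ [s [sF sP]]; exists s; split=> // x /sP/PQ.
have [U [hU GU]] := ultraFilterLemma GF.
exists U; split=> // P FP; apply: GU; exists [:: P]; split=> //= x; by case.
Qed.

Lemma saturated1 A (F : set (set C)) : small K A -> (forall P, F P -> D1 A P) ->
  fin_sat F -> exists a, forall P, F P -> P a.
Proof.
move=> sA dF /fin_sat_ultra[U [hU FU]].
have [_ _ satC _] := hC.
pose p : set (pform C 1) := [set f | over A f /\ U [set a | psat f (tup1 a)]].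
have [|a ap] := satC A p sA.
  split=> [f []//|k f fp|f fA].
    apply: (@filter_ex _ U _ [set a | forall i, psat (f i) (tup1 a)]).
    by apply: filter_forall => i; case: (fp i).
  have [?|?] := in_ultra_setVsetC [set a | psat f (tup1 a)] hU; first by left.
  by right.
exists a => P FP.
have /Dfn_pform[f [fA fP]] : Dfn A (fun v : 'I_1 -> C => P (v ord0)).
  exact: D1_at (dF _ FP) (Trm_var _ _).
have : p f.
  split=> //; apply: filterS (FU _ FP) => c Pc /=; exact/fP.
by move=> /ap/fP.
Qed.

(** Saturation is only given for types in one variable. For an ultrafilter [U] extending the family,
    the coordinates are chosen by Zorn's lemma among partial assignments that are finitely
    consistent with every definable set in [U]. *)
Lemma compactness A V (F : set (set (V -> C))) : small K A -> small K [set: V] ->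
  (forall P, F P -> Dfn A P) -> fin_sat F -> exists v, forall P, F P -> P v.
Proof.
move=> sA sV dF /fin_sat_ultra[U [hU FU]]; have [c0] := carrier_inh C.
pose dom (g : V -> option C) w := g w <> None.
pose gv (g : V -> option C) w := odflt c0 (g w).
pose good g := forall P, Dfn A P -> U P -> forall s, All (dom g) s ->
  exists v, P v /\ All (fun w => v w = gv g w) s.
pose le (g h : {g | good g}) := `[< forall w c, sval g w = Some c -> sval h w = Some c >].
have good0 : good (fun=> None).
  by move=> P _ UP [_|w s [/=]//]; have [v Pv] := filter_ex UP; exists v.
have [||||[g gg] gmax] := @Zorn _ le.
- by move=> g; apply/asboolP.
- by move=> g h k /asboolP H1 /asboolP H2; apply/asboolP => w c /H1/H2.
- move=> [g gg] [h hh] /asboolP H1 /asboolP H2; apply: eq_exist.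
  apply/funext => w; case E : (g w) => [c|]; first by have /= -> := H1 _ _ E.
  by case E' : (h w) => [c|//]; have /= := H2 _ _ E'; rewrite E.
- move=> ch chT.
  pose val w c := exists2 g, ch g & sval g w = Some c.
  have val_eq w c c' : val w c -> val w c' -> c = c'.
    move=> [g chg E] [h chh E'].
    have [/asboolP H|/asboolP H] := chT _ _ chg chh.
      by move: (H _ _ E); rewrite E' => -[].
    by move: (H _ _ E'); rewrite E => -[].
  pose u w := match pselect (exists c, val w c) with
    | left e => Some (sval (cid e)) | right _ => None end.
  have uP g w c : ch g -> sval g w = Some c -> u w = Some c.
    move=> chg E; rewrite /u; case: pselect => [e|[]]; last by exists c, g.
    by congr Some; apply: (val_eq w); [exact: (svalP (cid e))|exists g].
  (* Finitely many variables in the domain of the union are already in the domain of one member of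
     the chain. *)
  have bnd s : All (dom u) s -> s = [::] \/
      exists2 g, ch g & All (fun w => sval g w = u w /\ dom (sval g) w) s.
    elim: s => [|w s IH] /=; first by left.
    move=> [dw ds]; right; move: dw; rewrite /dom /u.
    case: pselect => // e _; have [h chh E] := svalP (cid e).
    have [->|[g chg gs]] := IH ds.
      by exists h => //; split=> //; split; rewrite E.
    have [/asboolP H|/asboolP H] := chT _ _ chg chh.
      exists h => //; split; first by split; rewrite E.
      apply: All_impl gs => z [Ez dz].
      case Ez' : (sval g z) => [c|]; last by rewrite /dom Ez' in dz.
      by rewrite -/(u z) -Ez Ez' /dom (H _ _ Ez').
    exists g => //; split; first by rewrite (H _ _ E).
    by [].
  have gu : good u.
    move=> P dP UP s /bnd[->|[h chh hs]].
      by have [v Pv] := filter_ex UP; exists v.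
    have [|v [Pv vs]] := svalP h P dP UP s.
      by apply: All_impl hs => w [].
    exists v; split=> //; elim: s hs vs => //= w s IH [[E _] hs] [-> vs].
    by split; [rewrite /gv E|exact: IH].
  exists (exist _ u gu) => h chh; apply/asboolP => w c E; exact: uP E.
have tot w0 : dom g w0.
  move=> E0.
  (* Candidates for the missing coordinate: the values at [w0] compatible with a set of [U] and with
     finitely many coordinates fixed before. The fixed values become parameters, so [V] has to be
     small. *)
  pose Q P s : set C := fun c =>
    exists v, P v /\ (All (fun w => v w = gv g w) s /\ v w0 = c).
  pose F0 : set (set C) := [set X | exists P s,
    [/\ Dfn A P, U P, All (dom g) s & X = Q P s]].
  have [||| a aF] := @saturated1 (A `|` range (gv g)) F0.
  - apply: smallU => //; exact: small_image.
  - move=> X [P [s [dP UP _ ->]]].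
    have dQ : Dfn (A `|` range (gv g)) (fun v : V + unit -> C =>
        P (v \o inl) /\ (All (fun w => v (inl w) = gv g w) s /\ v (inl w0) = v (inr tt))).
      apply: Dfn_and; first by apply: Dfn_ren; apply: Dfn_mono dP; left.
      apply: Dfn_and; last exact: Dfn_eq.
      apply: (@Dfn_All _ _ _ _ _ (fun w v => v (inl w) = gv g w)).
      elim: s => //= w s IH; split=> //.
      apply: D2_at (D2_eq _) (Trm_var _ _) (Trm_par _ _); by right; exists w.
    by apply: Dfn_ext (Dfn_exV dQ).
  - move=> l lF0.
    have [P [s [dP UP ds H]]] : exists P s, [/\ Dfn A P, U P, All (dom g) s &
        forall c, Q P s c -> All (fun X : set C => X c) l].
      elim: l lF0 => [_|X l IH [[P [s [dP UP ds ->]]] /IH[P' [s' [dP' UP' ds' H]]]]].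
        by exists (fun=> True), [::]; split=> //; [exact: Dfn_True|exact: filterT].
      exists (fun v => P v /\ P' v), (s ++ s'); split.
      - exact: Dfn_and.
      - exact: filterI.
      - exact/All_cat.
      - move=> c [v [[Pv P'v] [/All_cat[vs vs'] vc]]]; split.
          by exists v.
        by apply: H; exists v.
    have [v [Pv vs]] := gg P dP UP s ds.
    by exists (v w0); apply: H; exists v.
  pose h w := if pselect (w = w0) then Some a else g w.
  have gh : good h.
    move=> P dP UP s ds.
    pose s' := [seq w <- s | `[< w <> w0 >]].
    have ds' : All (dom g) s'.
      elim: s ds @s' => //= w s IH [dw /IH ds].
      by case: asboolP => //= ne; split=> //; move: dw; rewrite /dom /h; case: pselect.
    have [|v [Pv [vs va]]] := aF (Q P s'); first by exists P, s'.
    have key w : (w <> w0 -> v w = gv g w) -> v w = gv h w.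
      by rewrite /gv /h; case: pselect => [e _ /=|ne /(_ ne) //]; rewrite {1}e.
    exists v; split=> //; elim: s @s' vs {ds ds'} => //= w s IH.
    case: asboolP => /= [ne [E /IH vs]|ne /IH vs]; split=> //; apply: key => // ne'.
  have gleh : le (exist _ g gg) (exist _ h gh).
    by apply/asboolP => w c /= E; rewrite /h; case: pselect => // wE; rewrite wE E0 in E.
  have /(congr1 sval)/(congr1 (fun f => f w0)) /= := gmax _ gleh.
  by rewrite E0 /h; case: pselect.
exists (gv g) => P FP; have [k [f [x [xA H]]]] := dF _ FP.
pose s := pmap (fun i => match x i with inl w => Some w | inr _ => None end) (enum 'I_k).
have [|v [/H Sv vs]] := gg P (dF _ FP) (FU _ FP) s.
  by elim: s => //= w s IH; split.
apply/H; congr (sat f): Sv; apply/funext => i /=.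
have : i \in enum 'I_k by rewrite mem_enum.
move: vs; rewrite /s; elim: (enum 'I_k) => //= j l IH.
rewrite in_cons; case E : (x j) => [w|a] /=.
  by move=> [vw vs] /orP[/eqP ->|/(IH vs)//]; rewrite E.
by move=> vs /orP[/eqP ->|/(IH vs)//]; rewrite E.
Qed.

End Saturation.

(** * Weakly quasi-o-minimal orders *)

Section Cuts.
Variables (L : language) (C : structure L) (lt : formula L 2).
Hypothesis hlt : weakly_quasi_o_minimal_wrt C lt.
Implicit Types (A : set C).

Local Notation "x <% y" := (@lt_of L C lt x y) (at level 70).

Lemma lt_irr x : ~ (x <% x).
Proof. by case: hlt => -[H _ _] _; exact: H. Qed.

Lemma lt_tr x y z : x <% y -> y <% z -> x <% z.
Proof. by case: hlt => -[_ H _] _; exact: H. Qed.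

Lemma lt_total x y : [\/ x <% y, x = y | y <% x].
Proof. by case: hlt => -[_ _ H] _; exact: H. Qed.

Lemma lt_asym x y : x <% y -> y <% x -> False.
Proof. by move=> xy /(lt_tr xy)/lt_irr. Qed.

Definition le_of x y := x = y \/ x <% y.
Local Notation "x <=% y" := (le_of x y) (at level 70).

Lemma le_refl x : x <=% x. Proof. by left. Qed.

Lemma lt_le x y : x <% y -> x <=% y. Proof. by right. Qed.

Lemma le_lt_trans x y z : x <=% y -> y <% z -> x <% z.
Proof. by move=> [->|/lt_tr H] //; exact: H. Qed.

Lemma lt_le_trans x y z : x <% y -> y <=% z -> x <% z.
Proof. by move=> xy [<-|/(lt_tr xy)]. Qed.

Lemma le_tr x y z : x <=% y -> y <=% z -> x <=% z.
Proof. by move=> [->|xy] // /(lt_le_trans xy); right. Qed.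

Lemma le_or_lt x y : x <=% y \/ y <% x.
Proof. by case: (lt_total x y); [left; right|left; left|right]. Qed.

Lemma not_lt x y : ~ (x <% y) -> y <=% x.
Proof. by case: (le_or_lt y x). Qed.

Lemma le_not_lt x y : x <=% y -> ~ (y <% x).
Proof. by move=> [->/lt_irr|/lt_asym H /H]. Qed.

Lemma D2_lt A : D2 A (@lt_of L C lt).
Proof.
apply: (@Dfn_mono _ _ set0); first by [].
apply: Dfn_ext (Dfn_ren (fun i : 'I_2 => i == ord0) (Dfn_sat C lt)) => v.
rewrite /lt_of; set u := _ \o _; set u' := tup2 _ _; have -> // : u = u'.
by apply/funext => i; rewrite /u /u' /= /tup2; case: ifP.
Qed.

Lemma D2_le A : D2 A le_of.
Proof. by apply: Dfn_or; [exact: D2_eq|exact: D2_lt]. Qed.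

Definition downset (J : C -> Prop) := forall x y, J x -> y <% x -> J y.

Lemma downset_le J x y : downset J -> J x -> y <=% x -> J y.
Proof. by move=> dJ Jx [->//|/(dJ _ _ Jx)]. Qed.

Lemma downset_nlt J x y : downset J -> J x -> ~ J y -> x <% y.
Proof.
by move=> dJ Jx nJy; case: (le_or_lt y x) => // /(downset_le dJ Jx).
Qed.

Fixpoint dec x (s : seq C) : Prop := if s is y :: s' then y <% x /\ dec y s' else True.

Fixpoint chg (Y : C -> Prop) x (s : seq C) : nat :=
  if s is y :: s' then (`[< Y x >] != `[< Y y >]) + chg Y y s' else 0.

Definition atom (Ds : seq (C -> Prop)) x y := All (fun D : C -> Prop => D x <-> D y) Ds.

Lemma atom_trans Ds x y z : atom Ds x y -> atom Ds x z -> atom Ds y z.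
Proof.
rewrite /atom; elim: Ds => //= D Ds IH [xy xyD] [xz xzD].
by split; [rewrite -xy|exact: IH].
Qed.

Lemma chg_const (Y : C -> Prop) x s : All (fun y => Y x <-> Y y) s -> chg Y x s = 0.
Proof.
elim: s x => //= y s IH x [xy xs]; rewrite (asbool_equiv_eq xy) eqxx /= IH //.
by apply: All_impl xs => z; rewrite xy.
Qed.

Lemma chg_inter (Y Z : C -> Prop) x s :
  chg (fun t => Y t /\ Z t) x s <= chg Y x s + chg Z x s.
Proof.
elim: s x => //= y s IH x; rewrite addnACA leq_add ?IH // !asbool_and.
by case: `[< Y x >]; case: `[< Y y >]; case: `[< Z x >]; case: `[< Z y >].
Qed.

Lemma chg_compl (Y : C -> Prop) x s : chg (fun t => ~ Y t) x s = chg Y x s.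
Proof.
elim: s x => //= y s IH x; rewrite IH !asbool_neg.
by case: `[< Y x >]; case: `[< Y y >].
Qed.

Lemma chg_convex (Y : set C) x s : convex (@lt_of L C lt) Y -> dec x s -> chg Y x s <= 2.
Proof.
move=> cY.
have H0 t : Y t -> forall s x, x <% t -> ~ Y x -> dec x s -> chg Y x s = 0.
  move=> Yt {}s {}x xt nYx ds; apply: chg_const.
  elim: s x xt nYx ds => //= y s IH x xt nYx [yx ys].
  have nYy : ~ Y y by move=> Yy; apply: nYx; exact: cY yx xt.
  split=> //; apply: All_impl (IH _ (lt_tr yx xt) nYy ys) => z; tauto.
have H1 : forall s x, Y x -> dec x s -> chg Y x s <= 1.
  move=> {}s {}x; elim: s x => //= y s IH x Yx [yx ys].
  case: (pselect (Y y)) => Yy; first by rewrite (asboolT Yx) (asboolT Yy) /= IH.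
  by rewrite (H0 x Yx _ _ yx Yy ys) addn0; case: (_ != _).
elim: s x => //= y s IH x [yx ys].
case: (pselect (Y y)) => Yy.
  by rewrite (leq_trans (n := 1 + 1)) // leq_add ?H1 //; case: (_ != _).
case: (pselect (Y x)) => Yx; first by rewrite (H0 x Yx _ _ yx Yy ys); case: (_ != _).
by rewrite (asboolF Yx) (asboolF Yy) /= IH.
Qed.

(** A 0-definable generator does not change among points that agree on [Ds], a convex one is entered
    and left at most once along a monotone sequence, and Boolean operations at most add the numbers
    of changes. *)
Lemma chg_bounded (Y : set C) :
  boolean_combination [set D | definable1 set0 D \/ convex (@lt_of L C lt) D] Y ->
  exists (Ds : seq (C -> Prop)) N, All (D1 set0) Ds /\
    forall x s, dec x s -> All (atom Ds x) s -> chg Y x s <= N.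
Proof.
elim=> {Y} [Y [[f f0 E]|cY]|Y _ [Ds [N [dDs H]]]|Y Z _ [Ds [N [dDs H]]] _ [Es [M [dEs H']]]].
- exists [:: Y], 0; split.
    split=> //; apply: Dfn_ext (Dfn_ren (fun=> tt) (psat_Dfn f0)) => v.
    have /= := congr1 (fun S => S (v \o fun=> tt)) E.
    by move=> <-.
  move=> x s _ xs; rewrite chg_const //; apply: All_impl xs => y; by case.
- by exists [::], 2; split=> // x s /(chg_convex cY).
- by exists Ds, N; split=> // x s ds xs; rewrite chg_compl; exact: H.
- exists (Ds ++ Es), (N + M); split; first exact/All_cat.
  move=> x s ds xs; apply: leq_trans (chg_inter _ _ _ _) _; apply: leq_add.
    by apply: H => //; apply: All_impl xs => y /All_cat[].
  by apply: H' => //; apply: All_impl xs => y /All_cat[].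
Qed.

Definition same A (x y : C) := forall P, D1 A P -> (P x <-> P y).

Lemma same_refl A x : same A x x. Proof. by []. Qed.

Lemma same_sym A x y : same A x y -> same A y x.
Proof. by move=> H P dP; rewrite (H P dP). Qed.

Lemma same_trans A x y z : same A x y -> same A y z -> same A x z.
Proof. by move=> H H' P dP; rewrite (H P dP); exact: H'. Qed.

Lemma same_mono A A' x y : A `<=` A' -> same A' x y -> same A x y.
Proof. by move=> sA H P dP; apply: H; exact: D1_mono dP. Qed.

Lemma same_eqt A x y : same A x y <-> eqt A (fun _ : unit => x) (fun _ => y).
Proof.
split=> H P dP; last exact: (H _ dP).
have E : (fun v : unit -> C => P v) = (fun v => P (fun=> v tt)).
  by apply/funext => v; congr P; apply/funext => -[].
by apply: (H (fun c => P (fun=> c))); rewrite /D1 -E.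
Qed.

Section Alternation.
Variables (Y : C -> Prop) (Ds : seq (C -> Prop)) (x0 : C).

(** An alternating descent of length [k] from [t], starting with the value [e], through points that
    agree with [x0] on [Ds]. As a condition on [t] it is definable and upward closed, so its
    negation is a definable cut. *)
Fixpoint alt k (e : bool) t : Prop :=
  if k is k'.+1 then exists u, [/\ u <=% t, atom Ds x0 u, `[< Y u >] = e & alt k' (~~ e) u]
  else True.

Lemma alt_D1 A k e : D1 A Y -> All (D1 set0) Ds -> D1 A (alt k e).
Proof.
move=> dY dDs; elim: k e => [|k IH] e; first exact: Dfn_True.
apply: Dfn_ext (Dfn_ex (R := fun v u => u <=% v tt /\
  (atom Ds x0 u /\ ((if e then Y u else ~ Y u) /\ alt k (~~ e) u))) _).
  move=> v; split=> -[u].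
    move=> [ut [au [Yu lu]]]; exists u; split=> //; case: e Yu {lu} => Yu.
      exact/asboolT.
    exact/asboolF.
  move=> [ut au Yu lu]; exists u; split=> //; split=> //; split=> //.
  by case: e Yu {lu} => [/asboolP|/negbT/asboolPn].
apply: Dfn_and; first exact: D2_at (D2_le _) (Trm_var _ _) (Trm_var _ _).
apply: Dfn_and.
  apply: (@Dfn_All _ _ _ _ _ (fun D u => D x0 <-> D (u None))).
  apply: All_impl dDs => D dD; apply: Dfn_iff; first exact: Dfn_const.
  by apply: D1_at (Trm_var _ _); exact: D1_mono dD.
apply: Dfn_and; last exact: D1_at (IH _) (Trm_var _ _).
by case: e; [|apply: Dfn_not]; exact: D1_at dY (Trm_var _ _).
Qed.

Lemma alt_up k e x y : alt k e x -> x <% y -> alt k e y.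
Proof.
case: k => //= k [u [ux au Yu lu]] xy; exists u; split=> //.
by right; exact: le_lt_trans ux xy.
Qed.

Lemma alt_chg k e t : alt k.+1 e t -> exists x s, [/\ x <=% t, dec x s,
  All (atom Ds x0) (x :: s), `[< Y x >] = e & chg Y x s = k].
Proof.
elim: k e t => [|k IH] e t [u [ut au Yu lu]]; first by exists u, [::].
have [x [s [xu ds xs Yx cx]]] := IH _ _ lu.
exists u, (x :: s); split=> //=; last by rewrite Yu Yx cx; case: e {Yu lu Yx IH}.
split=> //; case: xu => // E; move: Yx; rewrite E Yu; by case: e {Yu lu}.
Qed.

End Alternation.

(** On the locus of a complete type, a definable set has finitely many convex components, and the
    cuts between them are definable from the same parameters. *)
Lemma cut_family A (Y : C -> Prop) x0 : D1 A Y -> exists Js : seq (C -> Prop),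
  All (fun J => D1 A J /\ downset J) Js /\
  forall x y, same set0 x0 x -> same set0 x0 y -> atom Js x y -> (Y x <-> Y y).
Proof.
move=> dY.
have /Dfn_pform[f [fA fP]] : Dfn A (fun v : 'I_1 -> C => Y (v ord0)).
  exact: D1_at dY (Trm_var _ _).
have [|Ds [N [dDs HN]]] := @chg_bounded Y.
  case: hlt => _; apply; exists f => //; apply/seteqP; by split=> a /= /fP.
have bnd k e t : alt Y Ds x0 k.+1 e t -> k <= N.
  move=> /alt_chg[x [s [_ ds [ax xs] _ <-]]]; apply: HN => //.
  by apply: All_impl xs => y; exact: atom_trans.
pose J k e t := ~ alt Y Ds x0 k e t.
have JP k e : D1 A (J k e) /\ downset (J k e).
  split; first exact: Dfn_not (alt_D1 _ _ _ dY dDs).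
  by move=> x y nx yx /alt_up/(_ yx).
(* By [bnd] no alternation is longer than [N.+1], so the lengths below [N + 4] include all that
   occur. *)
exists ([seq J k true | k <- iota 0 (N + 4)] ++ [seq J k false | k <- iota 0 (N + 4)]).
split.
  by apply/All_cat; split; elim: (iota _ _) => //= k s IH; split.
move=> x y x0x x0y /All_cat[a1 a2].
have E k e : alt Y Ds x0 k e x <-> alt Y Ds x0 k e y.
  case: (ltnP k (N + 4)) => kN; last first.
    have no t : ~ alt Y Ds x0 k e t.
      case: k kN => [|k]; rewrite addn4 // => kN /bnd; lia.
    by split=> /no.
  have kI : k \in iota 0 (N + 4) by rewrite mem_iota.
  have AllI (F : nat -> C -> Prop) s : k \in s ->
      atom [seq F k | k <- s] x y -> (F k x <-> F k y).
    elim: s => //= i s IH; rewrite in_cons => /orP[/eqP <-|/IH H]; by case.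
  have : J k e x <-> J k e y.
    by case: e; [exact: AllI a1|exact: AllI a2].
  rewrite /J; case: (pselect (alt Y Ds x0 k e x)); case: (pselect (alt Y Ds x0 k e y)); tauto.
have th z : same set0 x0 z -> atom Ds x0 z.
  move=> sz; rewrite /atom; elim: {HN bnd J JP a1 a2 E} Ds dDs => //= D Es IH [dD dEs].
  by split; [exact: sz|exact: IH].
have alt1 z k : same set0 x0 z -> alt Y Ds x0 k (~~ `[< Y z >]) z -> alt Y Ds x0 k.+1 `[< Y z >] z.
  by move=> /th sz lz; exists z; split=> //; left.
have [] := pselect (`[< Y x >] = `[< Y y >]).
  by move=> Exy; split=> /asboolT H; apply/asboolP; [rewrite -Exy|rewrite Exy].
move=> nE; exfalso.
have Ey : `[< Y y >] = ~~ `[< Y x >].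
  by move: nE; case: `[< Y x >]; case: `[< Y y >].
(* If [x] and [y] agree on all cuts but [Y] separates them, an alternation below one of them is also
   below the other and can be extended by that point. Going back and forth makes it arbitrarily
   long. *)
have step k : alt Y Ds x0 k `[< Y x >] x -> alt Y Ds x0 k.+2 `[< Y x >] x.
  move=> /E lx; apply: (alt1 _ _ x0x); apply/E; rewrite -Ey; apply: (alt1 _ _ x0y).
  by rewrite Ey negbK.
have many n : alt Y Ds x0 (n.*2) `[< Y x >] x.
  by elim: n => // n IH; rewrite doubleS; exact: step.
by have := many N.+1; rewrite doubleS => /bnd; lia.
Qed.

End Cuts.

(** * Convex equivalence relations *)

Section Families.
Variables (L : language) (C : structure L) (lt : formula L 2).
Implicit Types (A : set C).

Local Notation "x <% y" := (@lt_of L C lt x y) (at level 70).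
Local Notation "x <=% y" := (@le_of L C lt x y) (at level 70).

Lemma Dfn_at A V W (P : (W -> C) -> Prop) (t : W -> (V -> C) -> C) :
  Dfn A P -> (forall i, Trm A (t i)) -> Dfn A (fun v => P (fun i => t i v)).
Proof.
move=> dP /choice[s sP].
apply: Dfn_ext (Dfn_sub (f := s) _ dP) => [v|i]; last by case: (sP i).
by have -> : (fun i => t i v) = aval v \o s by apply/funext => i; case: (sP i) => _ ->.
Qed.

Lemma Dfn_unpar2 A V W (P : (V -> C) -> Prop) (P' : (W -> C) -> Prop) :
  Dfn A P -> Dfn A P' ->
  exists d (z : 'I_d -> C) (Q : (V + 'I_d -> C) -> Prop) (Q' : (W + 'I_d -> C) -> Prop),
    [/\ forall i, A (z i), Dfn set0 Q, Dfn set0 Q' & (forall v, P v <-> Q (sumv v z)) /\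
      (forall v, P' v <-> Q' (sumv v z))].
Proof.
move=> /Dfn_finpar[d [z [zA dP]]] /Dfn_finpar[d' [z' [z'A dP']]].
have [|Q [dQ PQ]] := @Dfn_absorb _ _ set0 _ _ _ (tcat z z') _ _ dP.
  by move=> _ [i _ <-]; right; exists (lshift d' i) => //;
    rewrite /tcat -[lshift d' i]/(unsplit (inl i)) unsplitK.
have [|Q' [dQ' PQ']] := @Dfn_absorb _ _ set0 _ _ _ (tcat z z') _ _ dP'.
  by move=> _ [i _ <-]; right; exists (rshift d i) => //;
    rewrite /tcat -[rshift d i]/(unsplit (inr i)) unsplitK.
exists (d + d'), (tcat z z'), Q, Q'; split=> // i.
by rewrite /tcat; case: (fintype.split i).
Qed.

(** The conditions hold for every [z], so that arbitrary tuples may be substituted: conjugates in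
    the homogeneity arguments, unrelated tuples in the rank. *)
Definition eqfam d (E : ('I_d -> C) -> C -> C -> Prop) : Prop :=
  [/\ Dfn set0 (fun v : 'I_d + bool -> C => E (v \o inl) (v (inr true)) (v (inr false))),
      forall z, equivalence_on [set: C] (E z)
    & forall z x y t, E z x t -> x <% y -> y <% t -> E z x y].

Lemma eqfam_Dfn A V d (E : ('I_d -> C) -> C -> C -> Prop) z (t u : (V -> C) -> C) :
  eqfam E -> (forall i, Trm A (z i)) -> Trm A t -> Trm A u ->
  Dfn A (fun v => E (fun i => z i v) (t v) (u v)).
Proof.
move=> [dE _ _] tz tt tu.
have := Dfn_at (t := fun s => match s with inl i => z i | inr b => if b then t else u end)
  (Dfn_mono (@sub0set _ A) dE).
by apply; case=> [//|[]].
Qed.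

Section Eqfam.
Variables (d : nat) (E : ('I_d -> C) -> C -> C -> Prop).
Hypothesis hE : eqfam E.

Lemma eqfam_refl z x : E z x x.
Proof. by case: hE => _ /(_ z)[H _ _] _; exact: H. Qed.

Lemma eqfam_sym z x y : E z x y -> E z y x.
Proof. by case: hE => _ /(_ z)[_ H _] _; exact: H. Qed.

Lemma eqfam_trans z x y t : E z x y -> E z y t -> E z x t.
Proof. by case: hE => _ /(_ z)[_ _ H] _; exact: H. Qed.

Lemma eqfam_convex z x y t : E z x t -> x <=% y -> y <=% t -> E z x y.
Proof.
case: hE => _ _ H Ext; move=> [<- _|xy [->//|yt]]; first exact: eqfam_refl.
exact: H Ext xy yt.
Qed.

Lemma eqfam_autom A s z x y : autom A s -> E z x y <-> E (s \o z) (s x) (s y).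
Proof.
case: hE => /(Dfn_mono (@sub0set _ A)) dE _ _ As.
exact: (autom_Dfn As dE (sumv z (fun b => if b then x else y))).
Qed.

End Eqfam.

Variables (K : Type) (T : theory L).
Hypothesis hC : monster_model K T C.
Hypothesis hlt : weakly_quasi_o_minimal_wrt C lt.

Let hK : uncountable_strong_limit K. Proof. by case: hC. Qed.

Lemma same_half A x y : (forall P, D1 A P -> P x -> P y) -> same A x y.
Proof.
move=> H P dP; split=> [/H|Py]; first exact.
apply: contrapT => nPx; exact: (H (fun z => ~ P z) (Dfn_not dP) nPx).
Qed.

(** By compactness finitely many formulas of the type of [x0], imposed on all coordinates, already
    imply [Q]. Their conjunction [rho] is over [A0] although [Q] may use parameters from [A]. *)
Lemma type_compact A0 A V x0 (Q : (V -> C) -> Prop) :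
  small K A -> A0 `<=` A -> small K [set: V] -> Dfn A Q ->
  (forall v, (forall i, same A0 x0 (v i)) -> Q v) ->
  exists rho, [/\ D1 A0 rho, rho x0 & forall v, (forall i, rho (v i)) -> Q v].
Proof.
move=> sA sA0 sV dQ H; apply: contrapT => nex.
pose F : set (set (V -> C)) := [set P | P = [set v | ~ Q v] \/
  exists r i, [/\ D1 A0 r, r x0 & P = [set v | r (v i)]]].
have [|s sF|v vF] := @compactness _ _ _ _ hC A V F sA sV.
- move=> _ [->|[r [i [dr _ ->]]]]; first exact: Dfn_not.
  exact: D1_at (D1_mono sA0 dr) (Trm_var _ _).
- have [r [dr rx0 rs]] : exists r, [/\ D1 A0 r, r x0 &
      forall v, (forall i, r (v i)) -> ~ Q v -> All (fun P : set (V -> C) => P v) s].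
    elim: s sF => [_|P s IH [FP /IH[r [dr rx0 rs]]]].
      by exists (fun=> True); split=> //; exact: Dfn_True.
    case: FP => [->|[r' [i [dr' r'x0 ->]]]].
      by exists r; split=> // v vr nQ; split=> //; exact: rs.
    exists (fun x => r x /\ r' x); split=> //; first exact: Dfn_and.
    move=> v vr nQ; split; first by case: (vr i).
    by apply: rs => // j; case: (vr j).
  apply: contrapT => nv; apply: nex; exists r; split=> // v vr; apply: contrapT => nQ.
  by apply: nv; exists v; exact: rs.
- have : ~ Q v by apply: (vF [set v | ~ Q v]); left.
  apply; apply: H => i; apply: same_half => r dr rx0.
  by apply: (vF [set v | r (v i)]); right; exists r, i.
Qed.

Lemma same_autom A x y : small K A -> same A x y -> exists s, autom A s /\ s x = y.
Proof.
move=> sA /same_eqt H; have [|s [As sv]] := homog hC _ H; last first.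
  by exists s; split=> //; exact: (sv tt).
apply: (smallU hK) => //; apply: (@small_sub K _ _ [set x]); last exact: small1.
by move=> _ [[] _ <-].
Qed.

Lemma autom_same A s x : autom A s -> same A x (s x).
Proof. by move=> As P dP; exact: (autom_Dfn As dP (fun=> x)). Qed.

Lemma autom_D1 A s P x : autom A s -> D1 A P -> (P x <-> P (s x)).
Proof. by move=> As; exact: autom_same. Qed.

Lemma autom_D2 A s R x y : autom A s -> D2 A R -> (R x y <-> R (s x) (s y)).
Proof.
by move=> As dR; exact: (autom_Dfn As dR (fun b : bool => if b then x else y)).
Qed.

Lemma autom_lt A s x y : autom A s -> (x <% y <-> s x <% s y).
Proof. by move=> As; exact: (autom_D2 x y As (D2_lt lt A)). Qed.

(** By [cut_family] the truth of [Y] depends on finitely many downsets. Going up with a change of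
    truth value means leaving one of them for good, which happens only finitely often. *)
Lemma no_alternation A (Y : C -> Prop) x0 (W : C -> Prop) x1 : D1 A Y -> W x1 ->
  (forall w, W w -> same set0 x0 w /\
    exists w', [/\ W w', w <% w' & ~ (Y w <-> Y w')]) -> False.
Proof.
move=> dY W1 HW; have [Js [hJs HJs]] := cut_family hlt x0 dY.
pose cnt x := count (fun J : C -> Prop => `[< J x >]) Js.
have cnt_lt x y : x <% y -> ~ atom Js x y -> cnt y < cnt x.
  rewrite /cnt => xy; elim: Js hJs {HJs cnt} => [|J Js IH] /= [].
    by move=> /(_ I).
  move=> [_ dJ] /IH{}IH; case: (pselect (atom Js x y)) => [a|/IH lt1 _].
    move=> na; have nJ : ~ (J x <-> J y) by move=> H; apply: na.
    have Jx : J x by apply: contrapT => nJx; apply: nJ; split=> // /dJ/(_ xy).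
    have nJy : ~ J y by move=> Jy; apply: nJ.
    rewrite (asboolT Jx) (asboolF nJy) /= add0n add1n ltnS.
    rewrite (@eq_in_count _ _ (fun J0 : C -> Prop => `[< J0 x >])) //.
    move=> J0; elim: Js a {IH dJ na} => //= J1 Js IH [E a].
    by rewrite in_cons => /orP[/eqP ->|/(IH a)//]; apply: asbool_equiv_eq; tauto.
  case: (pselect (J y)) => Jy; last by rewrite (asboolF Jy); lia.
  by rewrite (asboolT Jy) (asboolT (dJ _ _ Jy xy)); lia.
have big n : forall w, W w -> n <= cnt w.
  elim: n => // n IH w Ww; have [sw [w' [Ww' ww' nY]]] := HW _ Ww.
  apply: leq_ltn_trans (IH _ Ww') (cnt_lt _ _ ww' _) => a; apply: nY.
  by apply: HJs => //; case: (HW _ Ww').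
by have := big (cnt x1).+1 _ W1; rewrite ltnn.
Qed.

Section Convexify.
Variables (D : set C) (x0 : C) (F : C -> C -> Prop).
Hypotheses (sD : small K D) (dF : D2 D F) (eF : equivalence_on [set x | same D x0 x] F).

Local Notation r := (same D x0).

(** If a class had a gap at [u], automorphisms over [D] taking [x] to further elements of its class
    would repeat the gap above each of them, and [F x] would alternate without end. *)
Lemma type_classes_convex x u x' : r x -> r u -> r x' ->
  x <% u -> u <% x' -> F x x' -> F x u.
Proof.
case: eF => rF sF tF rx ru rx' xu ux' Fxx'; apply: contrapT => nF.
have dY : D1 (D `|` [set x]) (F x).
  have sDx : D `<=` D `|` [set x] by left.
  have xin : (D `|` [set x]) x by right.
  exact: D2_at (D2_mono sDx dF) (Trm_par _ xin) (Trm_var _ _).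
have next w : r w -> F x w -> exists u1 w1,
    [/\ r u1, r w1, w <% u1, u1 <% w1 & ~ F x u1 /\ F x w1].
  move=> rw Fw; have [|s [As sx]] := @same_autom D x w sD.
    by apply: same_trans rw; exact: same_sym.
  have rs t : r t -> r (s t) by move=> rt; exact: same_trans rt (autom_same _ As).
  exists (s u), (s x'); split; [exact: rs|exact: rs| | |split].
  - by rewrite -sx -(autom_lt _ _ As).
  - by rewrite -(autom_lt _ _ As).
  - move=> Fsu; apply: nF; rewrite (autom_D2 _ _ As dF) sx.
    by apply: (tF _ x) => //; [exact: rs|exact: sF].
  - apply: (tF _ w) => //; first exact: rs.
    by rewrite -sx -(autom_D2 _ _ As dF).
pose W w := r w /\ (F x w \/ exists w1, [/\ r w1, w <% w1 & ~ F x w /\ F x w1]).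
apply: (@no_alternation _ _ x0 W x dY); first by split=> //; left; exact: rF.
move=> w [rw [Fw|[w1 [rw1 ww1 [nFw Fw1]]]]].
  split; first exact: same_mono rw.
  have [u1 [w1 [ru1 rw1 wu1 uw1 [nFu Fw1]]]] := next _ rw Fw.
  by exists u1; split=> //; [split=> //; right; exists w1|tauto].
split; first exact: same_mono rw.
by exists w1; split=> //; [split=> //; left|tauto].
Qed.

Let good (rho : C -> Prop) (F' : C -> C -> Prop) :=
  forall x y t, rho x -> rho y -> rho t ->
  [/\ F' x x, F' x y -> F' y x, F' x y -> F' y t -> F' x t &
    x <% y -> y <% t -> F' x t -> F' x y].

(** By compactness, one formula [rho] of the type suffices to make [F] an equivalence relation with
    convex classes on [rho]. [E z] consists of the convex hulls of these classes and is equality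
    elsewhere; it is equality throughout when [good] fails for [z], so that the conditions hold for
    all parameters. *)
Lemma convexify : exists d (z0 : 'I_d -> C) (E : ('I_d -> C) -> C -> C -> Prop),
  [/\ forall i, D (z0 i), eqfam E &
    forall x y, same D x0 x -> same D x0 y -> (E z0 x y <-> F x y)].
Proof.
have [|||||rho [drho rx0 gF]] := @type_compact D D 'I_3 x0 (fun v =>
  let x := v (inord 0) in let y := v (inord 1) in let t := v (inord 2) in
  (F x x /\ (F x y -> F y x)) /\ ((F x y -> F y t -> F x t) /\
    (x <% y -> y <% t -> F x t -> F x y))).
- exact: sD.
- by [].
- exact: small_countable.
- have dF' i j : Dfn D (fun v : 'I_3 -> C => F (v i) (v j)).
    exact: D2_at dF (Trm_var _ _) (Trm_var _ _).
  have dl i j : Dfn D (fun v : 'I_3 -> C => v i <% v j).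
    exact: D2_at (D2_lt _ _) (Trm_var _ _) (Trm_var _ _).
  by do !(first [exact: dF'|exact: dl|apply: Dfn_and|apply: Dfn_imp]).
- case: eF => rF sF tF v vr; split; first by split; [exact: rF (vr _)|exact: sF (vr _) (vr _)].
  split; first exact: tF (vr _) (vr _) (vr _).
  exact: type_classes_convex (vr _) (vr _) (vr _).
have {}gF : good rho F.
  move=> x y t rx ry rt.
  have [|[H1 H2] [H3 H4]] := gF (fun i : 'I_3 => if i == inord 0 then x else
    if i == inord 1 then y else t).
    by move=> i; case: (_ == _) => //; case: (_ == _).
  move: H1 H2 H3 H4; rewrite !eqxx.
  have -> : (inord 1 == inord 0 :> 'I_3) = false by rewrite -val_eqE /= !inordK.
  have -> : (inord 2 == inord 0 :> 'I_3) = false by rewrite -val_eqE /= !inordK.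
  have -> : (inord 2 == inord 1 :> 'I_3) = false by rewrite -val_eqE /= !inordK.
  by [].
have [d [z0 [Q [Q' [zD dQ dQ' [HQ HQ']]]]]] := Dfn_unpar2 drho dF.
pose rh (z : 'I_d -> C) x := Q (sumv (fun=> x) z).
pose Fh (z : 'I_d -> C) x y := Q' (sumv (fun b : bool => if b then x else y) z).
pose E z x y := x = y \/ good (rh z) (Fh z) /\ exists u v,
  [/\ rh z u, rh z v, Fh z u v, u <=% x /\ x <=% v & u <=% y /\ y <=% v].
have Erh : rh z0 = rho by apply/funext => x; apply/propext; rewrite /rh -HQ.
have EFh : Fh z0 = F.
  by apply/funext => x; apply/funext => y; apply/propext; rewrite /Fh -HQ'.
have Esym z x y : E z x y -> E z y x.
  move=> [->|[g [u [v [? ? ? ? ?]]]]]; first by left.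
  by right; split=> //; exists u, v.
have Etr z x y t : E z x y -> E z y t -> E z x t.
  move=> [->//|[g [u [v [ru rv uv [ux xv] [uy yv]]]]]].
  move=> [<-|[_ [u' [v' [ru' rv' uv' [uy' yv'] [ut tv]]]]]].
    by right; split=> //; exists u, v.
  right; split=> //.
  have FS p q : rh z p -> rh z q -> Fh z p q -> Fh z q p by move=> rp rq; case: (g p q p).
  have FT p q s : rh z p -> rh z q -> rh z s -> Fh z p q -> Fh z q s -> Fh z p s.
    by move=> rp rq rs; case: (g p q s).
  have FC p q s : rh z p -> rh z q -> rh z s -> Fh z p s -> p <=% q -> q <=% s -> Fh z p q.
    move=> rp rq rs Fps [<- _|pq [->//|qs]]; first by case: (g p p p).
    by case: (g p q s) => // _ _ _ H; exact: H.
  (* Two hulls that share the point [y] have equivalent ends; the smaller left end and the larger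
     right end span a hull containing [x] and [t]. *)
  have uu' : Fh z u u'.
    case: (le_or_lt hlt u u') => [le|/(@lt_le _ _ _ _ _) le].
      by apply: (FC _ _ v) => //; exact: le_tr hlt _ _ _ uy' yv.
    by apply: FS => //; apply: (FC _ _ v') => //; exact: le_tr hlt _ _ _ uy yv'.
  have [m [rm um mu mu']] : exists m, [/\ rh z m, Fh z u m, m <=% u & m <=% u'].
    case: (le_or_lt hlt u u') => [le|/(@lt_le _ _ _ _ _) le].
      by exists u; split=> //; [case: (g u u u)|left].
    by exists u'; split=> //; left.
  have [M [rM uM Mv Mv']] : exists m, [/\ rh z m, Fh z u m, v <=% m & v' <=% m].
    case: (le_or_lt hlt v v') => [le|/(@lt_le _ _ _ _ _) le].
      by exists v'; split=> //; [exact: FT uv'|left].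
    by exists v; split=> //; left.
  exists m, M; split=> //.
  - by apply: FT uM => //; exact: FS.
  - by split; [exact: le_tr hlt _ _ _ mu ux|exact: le_tr hlt _ _ _ xv Mv].
  - by split; [exact: le_tr hlt _ _ _ mu' ut|exact: le_tr hlt _ _ _ tv Mv'].
exists d, z0, E; split=> //; last first.
  move=> x y rx ry; have rx' : rho x by exact/(rx _ drho).
  have ry' : rho y by exact/(ry _ drho).
  have Fxx : F x x by case: (gF x x x).
  split; last first.
    move=> Fxy; right; rewrite Erh EFh; split=> //.
    case: (le_or_lt hlt x y) => [le|/(@lt_le _ _ _ _ _) le].
      by exists x, y; split=> //; split=> //; left.
    by exists y, x; split=> //; [case: (gF x y x) => // _ H _ _; exact: H|split=> //; left|split=> //; left].
  move=> [<-//|]; rewrite Erh EFh => -[_ [u [v [ru rv uv [ux xv] [uy yv]]]]].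
  have FC s : rho s -> u <=% s -> s <=% v -> F u s.
    move=> rs [<- _|us [->//|sv]]; first by case: (gF u u u).
    by case: (gF u s v) => // _ _ _ H; exact: H.
  case: (gF x u y) => // _ _ H _; apply: H; last exact: FC.
  by case: (gF u x u) => // _ H _ _; apply: H; exact: FC.
split; last 1 first.
- move=> z x y t [->|[g [u [v [ru rv uv [ux xv] [ut tv]]]]]] xy yt.
    by case: (lt_asym hlt xy yt).
  right; split=> //; exists u, v; split=> //; split.
    exact: le_tr hlt _ _ _ ux (lt_le xy).
  exact: le_tr hlt _ _ _ (lt_le yt) tv.
- have drh V (i : V) (zz : 'I_d -> V) : Dfn set0 (fun v : V -> C => rh (fun i => v (zz i)) (v i)).
    apply: Dfn_ext (Dfn_at (t := fun s => match s with inl _ => fun v => v i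
       | inr j => fun v => v (zz j) end) dQ _).
      move=> v; rewrite /rh; set a := (fun _ : unit + _ => _); set b := sumv _ _.
      by have -> : a = b by apply/funext => -[].
    by move=> [_|j]; exact: Trm_var.
  have dFh V (i j : V) (zz : 'I_d -> V) :
      Dfn set0 (fun v : V -> C => Fh (fun i => v (zz i)) (v i) (v j)).
    apply: Dfn_ext (Dfn_at (t := fun s => match s with inl b => fun v => v (if b then i else j)
       | inr j => fun v => v (zz j) end) dQ' _).
      move=> v; rewrite /Fh; set a := (fun _ : bool + _ => _); set b := sumv _ _.
      by have -> : a = b by apply/funext => -[[]|].
    by move=> [b|l]; exact: Trm_var.
  have dl V (i j : V) : Dfn set0 (fun v : V -> C => v i <% v j).
    exact: D2_at (D2_lt _ _) (Trm_var _ _) (Trm_var _ _).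
  have dle V (i j : V) : Dfn set0 (fun v : V -> C => v i <=% v j).
    exact: D2_at (D2_le _ _) (Trm_var _ _) (Trm_var _ _).
  have dgood : Dfn set0 (fun v : 'I_d + bool -> C => good (rh (v \o inl)) (Fh (v \o inl))).
    rewrite /good; apply: Dfn_all; apply: Dfn_all; apply: Dfn_all.
    set e := (fun _ : option _ -> C => _).
    have : Dfn set0 (fun v : option (option (option ('I_d + bool))) -> C =>
       let z i := v (Some (Some (Some (inl i)))) in
       let x := v (Some (Some None)) in let y := v (Some None) in let t := v None in
       rh z x -> rh z y -> rh z t -> (Fh z x x /\ (Fh z x y -> Fh z y x)) /\
       ((Fh z x y -> Fh z y t -> Fh z x t) /\ (x <% y -> y <% t -> Fh z x t -> Fh z x y))).
      by do !(first [exact: drh|exact: dFh|exact: dl|apply: Dfn_and|apply: Dfn_imp]).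
    apply: Dfn_ext => v; rewrite /e /=.
    by split=> H rx ry rt; have := H rx ry rt; [move=> [[? ?] [? ?]]; split|
      move=> [? ? ? ?]; split; split].
  apply: Dfn_or; first exact: Dfn_eq.
  apply: Dfn_and => //.
  have : Dfn set0 (fun v : 'I_d + bool -> C => let z := v \o inl in
      exists a b, (rh z a /\ rh z b) /\ (Fh z a b /\ ((a <=% v (inr true) /\ v (inr true) <=% b)
        /\ (a <=% v (inr false) /\ v (inr false) <=% b)))).
    apply: Dfn_ex; apply: Dfn_ex.
    by do !(first [exact: drh|exact: dFh|exact: dle|apply: Dfn_and]).
  apply: Dfn_ext => v /=; split=> -[a [b]].
    by move=> [[? ?] [? [? ?]]]; exists a, b.
  by move=> [? ? ? ? ?]; exists a, b.
- by move=> z; split=> [x _|x y _ _|x y t _ _ _]; [left|exact: Esym|exact: Etr].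
Qed.

End Convexify.

End Families.

(** * A rank for families of convex equivalence relations *)

Lemma cantor (X : Type) : ~ ([set: set X] #<= [set: X]).
Proof.
move=> H; have /card_leP[g] := H.
have x0 := val (g (SigSub (mem_set (I : [set: set X] set0)))).
have [f [_ f_inj]] := card_le_fun x0 H.
pose D : set X := [set x | exists S, f S = x /\ ~ S x].
have [Df|nDf] := pselect (D (f D)).
  by have [S [E]] := Df; apply; rewrite (f_inj _ _ _ _ E).
by apply: (nDf); exists D.
Qed.

(** A map from a big set to [set nat], for instance to the types over a finite set, has a big
    fibre. *)
Definition big (X : Type) (A : set X) := ~ (A #<= [set: set nat]).

Lemma big_pigeonhole (X : Type) (A : set X) (f : X -> set nat) : big A ->
  exists c, big (A `&` [set x | f x = c]).
Proof.
move=> bA; apply: contrapT => /forallNP H; apply: bA.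
have /choice[g gP] : forall c, exists g : X -> set nat,
    forall x y, A x /\ f x = c -> A y /\ f y = c -> g x = g y -> x = y.
  by move=> c; have /contrapT/(card_le_fun set0)[g [_ g_inj]] := H c; exists g.
(* If no fibre were big, [x] would be determined by the pair of [f x] and [g (f x) x], coded on the
   even and the odd numbers. *)
apply: (@card_le_of _ _ _ _ (fun x => [set n | if odd n then g (f x) x n./2 else f x n./2])) => //.
move=> x y Ax Ay E.
have Ef : f x = f y.
  apply/seteqP; split=> n; have /(congr1 (fun S : set nat => S n.*2)) /= := E;
    by rewrite odd_double doubleK => ->.
apply: (gP (f x)) => //; rewrite {2}Ef.
apply/seteqP; split=> n; have /(congr1 (fun S : set nat => S n.*2.+1)) /= := E;
  by rewrite odd_double /= uphalf_double => ->.
Qed.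

Lemma big_sub (X : Type) (A B : set X) : A `<=` B -> big A -> big B.
Proof. by move=> AB bA BS; apply: bA; exact: card_le_trans (subset_card_le AB) BS. Qed.

Lemma big_split (X : Type) (A P : set X) : big A -> big (A `&` P) \/ big (A `&` ~` P).
Proof.
move=> bA; have [c bc] := big_pigeonhole (fun x => [set n : nat | P x]) bA.
have [c0|nc0] := pselect (c 0); [left|right]; apply: big_sub bc => x [Ax /= E];
  split=> //; first by move: c0; rewrite -E.
by move=> Px; apply: nc0; rewrite -E.
Qed.

Lemma big_neq0 (X : Type) (A : set X) : big A -> A !=set0.
Proof.
move=> bA; apply: contrapT => nA; apply: bA.
have -> : A = set0 by apply/seteqP; split=> // x Ax; apply: nA; exists x.
exact: card_ge0.
Qed.

Lemma not_big1 (X : Type) (a : X) : ~ big [set a].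
Proof. by apply; apply: (@card_le_of _ _ _ _ (fun=> set0)) => // x y /= -> ->. Qed.

Lemma big_D1 (X : Type) (A : set X) a : big A -> big (A `&` [set x | x <> a]).
Proof.
move=> /(@big_split _ _ [set a])[|//].
by move=> b; case: (@not_big1 _ a); apply: big_sub b => x [].
Qed.

Lemma big_nat (X : Type) (A : set X) : big A -> exists b : nat -> X,
  (forall i, A (b i)) /\ injective b.
Proof.
move=> bA; have [x0 _] := big_neq0 bA.
have [|le] := card_le_total [set: nat] A.
  by move=> /(card_le_fun x0)[b [bA' b_inj]]; exists b; split=> [i|i j]; [exact: bA'|exact: b_inj].
case: bA; apply: card_le_trans le _.
by apply: (@card_le_of _ _ _ _ (fun n : nat => [set n])) => // m n _ _ /seteqP[/(_ m erefl)].
Qed.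

Lemma big_range (X : Type) (f : set (set nat) -> X) : injective f -> big (range f).
Proof.
move=> f_inj le; apply: (@cantor (set nat)); apply: card_le_trans le.
by apply: (@card_le_of _ _ _ _ f) => // S T _ _; exact: f_inj.
Qed.

Section Rank.
Variables (L : language) (C : structure L) (lt : formula L 2).
Implicit Types (A : set C).

Local Notation "x <% y" := (@lt_of L C lt x y) (at level 70).
Local Notation "x <=% y" := (@le_of L C lt x y) (at level 70).

(** With [big] rather than infinite sets of classes, a level can be refined by any map to sets of
    integers, such as the type over a finite tuple, and stays a level. The tuple [z] may change from
    level to level, the family may not. *)
Fixpoint rank_ge d (E : ('I_d -> C) -> C -> C -> Prop) n (X : set C) : Prop :=
  if n is n'.+1 then exists z (A : set C), [/\ big A,
      forall a b, A a -> A b -> a <> b -> ~ E z a b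
    & forall a, A a -> rank_ge E n' (X `&` [set x | E z a x])]
  else X !=set0.

Definition finite_ranks := forall d (E : ('I_d -> C) -> C -> C -> Prop),
  eqfam lt E -> exists n, ~ rank_ge E n [set: C].

Lemma rank_mono d (E : ('I_d -> C) -> C -> C -> Prop) n (X Y : set C) :
  X `<=` Y -> rank_ge E n X -> rank_ge E n Y.
Proof.
elim: n X Y => [|n IH] X Y XY /= => [[x /XY Yx]|]; first by exists x.
move=> [z [A [bA EA H]]]; exists z, A; split=> // a /H; apply: IH => x [/XY].
by [].
Qed.

(** A self-reproducing situation [tau]: inside the class of each instance there are [big] many
    classes which are instances again. Iteration gives every finite rank. *)
Lemma rank_step d (E : ('I_d -> C) -> C -> C -> Prop) (tau : C -> ('I_d -> C) -> Prop) :
  eqfam lt E ->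
  (forall x z', tau x z' -> exists z (A : set C), [/\ big A,
      forall a b, A a -> A b -> a <> b -> ~ E z a b
    & forall a, A a -> tau a z /\ forall y, E z a y -> E z' x y]) ->
  forall n x z, tau x z -> rank_ge E n [set: C].
Proof.
move=> hE H n x z xz; apply: (@rank_mono _ _ _ [set y | E z x y]) => //.
elim: n x z xz => [|n IH] x z xz /=; first by exists x; exact: eqfam_refl hE _ _.
have [z' [A [bA EA HA]]] := H _ _ xz; exists z', A; split=> // a Aa.
have [ta sub] := HA a Aa; apply: rank_mono (IH _ _ ta) => y Ey; split=> //; exact: sub.
Qed.

(** A [big] set contains an infinite sequence, so each level of [rank_ge] is a level of the
    convexity rank. *)
Lemma finite_convexity_rank_ranks : finite_convexity_rank C lt -> finite_ranks.
Proof.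
move=> [N [_ HN]] d E hE; exists N.+1 => H.
suff : RC_ge lt N.+1 [set: C] by move/HN; rewrite ltnn.
elim: {HN} N.+1 [set: C] H => [//|n IH] X /= [z [A [bA EA HA]]].
exists (fun x y => E z x y); split.
- have [|f [fA fP]] := @Dfn_pform _ C setT 2 (fun v => E z (v ord0) (v ord_max)).
    apply: (eqfam_Dfn (z := fun i v => z i) hE _ (Trm_var _ _) (Trm_var _ _)) => i.
    exact: Trm_par.
  exists f => //; apply/seteqP; by split=> v /= /fP.
- by split=> [x _|x y _ _|x y t _ _ _]; [exact: eqfam_refl hE _ _|exact: (eqfam_sym hE)|
    exact: (eqfam_trans hE)].
- move=> c x y t /= Exc Etc xy yt.
  apply: (eqfam_trans hE _ Exc); apply: (eqfam_sym hE).
  apply: (eqfam_convex hE (t := t)); [|exact: lt_le xy|exact: lt_le yt].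
  exact: (eqfam_trans hE Exc (eqfam_sym hE Etc)).
have [b [bA' b_inj]] := big_nat bA.
exists b; split=> [i j ij|i].
  by apply: EA => // /b_inj.
apply: IH; apply: rank_mono (HA _ (bA' i)) => x [Xx Ex]; split=> //.
exact: (eqfam_sym hE).
Qed.

Variables (K : Type) (T : theory L).
Hypothesis hC : monster_model K T C.

Let hK : uncountable_strong_limit K. Proof. by case: hC. Qed.

Let W := set (set nat).

(** Compactness with variables indexed by [W], the sets of sets of integers: beyond the continuum,
    yet small because [K] is a strong limit. Reflexivity of [R] makes the realizing tuple
    injective. *)
Lemma many A A0 x0 (P : C -> Prop) (R : C -> C -> Prop) :
  small K A -> A0 `<=` A -> D1 A P -> D2 A R -> (forall x, R x x) ->
  (forall n, exists f : nat -> C, (forall i, i < n -> same A0 x0 (f i) /\ P (f i)) /\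
    forall i j, i < n -> j < n -> i <> j -> ~ R (f i) (f j)) ->
  exists B : set C, [/\ small K B, big B, forall b, B b -> same A0 x0 b /\ P b &
    forall a b, B a -> B b -> a <> b -> ~ R a b].
Proof.
move=> sA sA0 dP dR rR H.
have sW : small K [set: W] by apply: smallT_pow => //; apply: smallT_pow => //; exact: hK.1.
pose F : set (set (W -> C)) := [set Q | exists w, (exists th, [/\ D1 A0 th, th x0 &
      Q = [set v | th (v w)]]) \/ Q = [set v | P (v w)] \/
      exists w', w <> w' /\ Q = [set v | ~ R (v w) (v w')]].
have [|s sF|v vF] := @compactness _ _ _ _ hC A W F sA sW.
- move=> _ [w [[th [dth _ ->]]|[->|[w' [_ ->]]]]].
  + exact: D1_at (D1_mono sA0 dth) (Trm_var _ _).
  + exact: D1_at dP (Trm_var _ _).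
  + by apply: Dfn_not; exact: D2_at dR (Trm_var _ _) (Trm_var _ _).
- have [l lP] : exists l : seq {classic W}, forall v : W -> C,
      (forall w, w \in l -> same A0 x0 (v w) /\ P (v w)) ->
      (forall w w', w \in l -> w' \in l -> w <> w' -> ~ R (v w) (v w')) ->
      All (fun Q : set (W -> C) => Q v) s.
    elim: s sF => [_|Q s IH [FQ /IH[l lP]]]; first by exists [::].
    have [w [w' Hw]] : exists w w' : {classic W}, forall v : W -> C,
        same A0 x0 (v w) /\ P (v w) -> (w <> w' -> ~ R (v w) (v w')) -> Q v.
      case: FQ => w [[th [dth thx ->]]|[->|[w' [ww' ->]]]].
      - by exists w, w => v [sv _] _; exact/(sv _ dth).
      - by exists w, w => v [].
      - by exists w, w' => v _; apply.
    exists (w :: w' :: l) => v H1 H2; split.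
      apply: Hw; first by apply: H1; rewrite in_cons eqxx.
      by apply: H2; rewrite !in_cons eqxx ?orbT.
    by apply: lP => [u ul|u u' ul ul']; [apply: H1|apply: H2]; rewrite !in_cons ?ul ?ul' !orbT.
  have [f [Hf1 Hf2]] := H (size l).
  exists (fun w => f (index (w : {classic W}) l)); apply: lP => [w wl|w w' wl wl' ww'].
    by apply: Hf1; rewrite index_mem.
  apply: Hf2; rewrite ?index_mem // => /(congr1 (nth w l)).
  by rewrite !nth_index.
exists (range v); split.
- exact: small_image.
- apply: big_range => w w' E; apply: contrapT => ww'.
  have : ~ R (v w) (v w').
    by apply: (vF [set v | ~ R (v w) (v w')]); exists w; right; right; exists w'.
  by rewrite E; apply.
- move=> _ [w _ <-]; split.
    apply: same_half => th dth thx; apply: (vF [set v | th (v w)]).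
    by exists w; left; exists th.
  by apply: (vF [set v | P (v w)]); exists w; right; left.
- move=> _ _ [w _ <-] [w' _ <-] ne; apply: (vF [set v | ~ R (v w) (v w')]).
  by exists w; right; right; exists w'; split=> // E; apply: ne; rewrite E.
Qed.

End Rank.

(** * Discrete quotients from a failure of condition (R) *)

Section Discrete.
Variables (L : language) (C : structure L) (lt : formula L 2) (K : Type) (T : theory L).
Hypothesis hC : monster_model K T C.
Hypothesis hlt : weakly_quasi_o_minimal_wrt C lt.
Implicit Types (A : set C).

Local Notation "x <% y" := (@lt_of L C lt x y) (at level 70).
Local Notation "x <=% y" := (@le_of L C lt x y) (at level 70).

Let hK : uncountable_strong_limit K. Proof. by case: hC. Qed.

Lemma compact_closed A V (G : set (set (V -> C))) (Q : (V -> C) -> Prop) :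
  small K A -> small K [set: V] -> (forall P, G P -> Dfn A P) -> Dfn A Q ->
  (exists P, G P) -> (forall P P', G P -> G P' -> exists2 P'', G P'' & P'' `<=` P `&` P') ->
  (forall v, (forall P, G P -> P v) -> Q v) -> exists2 P, G P & forall v, P v -> Q v.
Proof.
move=> sA sV dG dQ [P0 G0] GI H; apply: contrapT => nex.
pose F : set (set (V -> C)) := [set P | P = [set v | ~ Q v] \/ G P].
have [|s sF|v vF] := @compactness _ _ _ _ hC A V F sA sV.
- by move=> _ [->|/dG//]; exact: Dfn_not.
- have [P GP Ps] : exists2 P, G P &
      forall v, P v -> ~ Q v -> All (fun P : set (V -> C) => P v) s.
    elim: s sF => [_|P s IH [FP /IH[P' GP' P's]]]; first by exists P0.
    case: FP => [->|GP]; first by exists P' => // v P'v nQ; split=> //; exact: P's.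
    have [P'' GP'' sub] := GI _ _ GP GP'.
    exists P'' => // v /sub[Pv P'v] nQ; split=> //; exact: P's.
  apply: contrapT => nv; apply: nex; exists P => // v Pv; apply: contrapT => nQ.
  by apply: nv; exists v; exact: Ps.
- have : ~ Q v by apply: (vF [set v | ~ Q v]); left.
  by apply; apply: H => P GP; apply: vF; right.
Qed.

(** The [R]-classes of [x] and [y] are consecutive among those meeting [q]. Stating this for
    elements avoids forming the quotient. *)
Definition adjacent (q : C -> Prop) (R : C -> C -> Prop) x y :=
  [/\ q x, q y, x <% y, ~ R x y & forall t, q t -> x <% t -> t <% y -> R x t \/ R t y].

(** Induction on a bound for the classes strictly between [u] and [w]: if some [t] of [q] lies
    there, the segment up to [t] has a smaller bound, as [t] no longer counts. *)
Lemma adjacent_exists q (R : C -> C -> Prop) n u w : (forall x, R x x) ->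
  q u -> q w -> u <% w -> ~ R u w ->
  ~ (exists f : nat -> C, (forall i, i < n -> q (f i) /\
      [/\ u <% f i, f i <% w, ~ R u (f i) & ~ R (f i) w]) /\
    forall i j, i < n -> j < n -> i <> j -> ~ R (f i) (f j)) ->
  (forall x y z, q x -> q y -> q z -> x <=% y -> y <=% z -> R x z -> R x y /\ R y z) ->
  (forall x y, R x y -> R y x) ->
  exists x y, adjacent q R x y.
Proof.
move=> rR qu + + + + cR sR; elim: n w => [|n IH] w qw uw nR nex.
  by case: nex; exists (fun=> u); split.
apply: contrapT => nadj.
have [t [qt ut tw [nut ntw]]] : exists t, [/\ q t, u <% t, t <% w & ~ R u t /\ ~ R t w].
  apply: contrapT => nt; apply: nadj; exists u, w; split=> // t qt ut tw.
  apply: contrapT => /not_orP[nut ntw]; apply: nt; by exists t.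
apply: (nadj); apply: (IH t) => // -[f [Hf1 Hf2]]; apply: nex.
exists (fun i => if i == n then t else f i); split=> [i|i j].
  rewrite ltnS leq_eqVlt; case: eqP => [_ _|_ /= /Hf1[qf [uf ft nuf nft]]]; first by [].
  split=> //; split=> //; first exact: lt_tr hlt _ _ _ ft tw.
  by move=> /(cR _ t _ qf qt qw (lt_le ft) (lt_le tw))[].
rewrite !ltnS (leq_eqVlt i) (leq_eqVlt j); case: eqP => [->|_]; case: eqP => [->|_] //= ni nj ij.
- by move=> /sR; have [_ [_ _ _]] := Hf1 _ nj.
- by have [_ [_ _ _]] := Hf1 _ ni.
- exact: Hf2.
Qed.

Lemma eqt_small A V (v w : V -> C) : small K A -> small K [set: V] ->
  eqt A v w -> exists s, autom A s /\ forall i, s (v i) = w i.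
Proof.
move=> sA sV vw; have [|s [As sv]] := homog hC _ vw; last by exists s.
exact: (@smallU K hK _ A (range v) sA (@small_image K _ _ _ v sV)).
Qed.

Definition discrete d (E : ('I_d -> C) -> C -> C -> Prop) (c : 'I_d -> C) b :=
  (forall x, same (range c) b x -> exists y, adjacent (same (range c) b) (E c) x y) /\
  (forall x, same (range c) b x -> exists y, adjacent (same (range c) b) (E c) y x).

Lemma eqfam_autom_range d (E : ('I_d -> C) -> C -> C -> Prop) c s x y : eqfam lt E ->
  autom (range c) s -> E c x y <-> E c (s x) (s y).
Proof.
move=> hE As; rewrite {2}(_ : c = s \o c); first exact: (eqfam_autom hE _ _ _ As).
by apply/funext => i; case: As => _ /= ->; last exists i.
Qed.

Lemma adjacent_autom d (E : ('I_d -> C) -> C -> C -> Prop) c b s x y : eqfam lt E ->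
  autom (range c) s -> adjacent (same (range c) b) (E c) x y ->
  adjacent (same (range c) b) (E c) (s x) (s y).
Proof.
move=> hE As [qx qy xy nR H].
have qs a : same (range c) b a -> same (range c) b (s a).
  by move=> qa; exact: same_trans qa (autom_same _ As).
have Es := eqfam_autom_range _ _ hE As.
split; [exact: qs|exact: qs|by rewrite -(autom_lt _ _ _ As)|by rewrite -Es|].
have [s' [As' sK s'K]] := autom_inv As.
move=> t qt; rewrite -(s'K t) -!(autom_lt _ _ _ As) -!Es; apply: H.
exact: same_trans qt (autom_same _ As').
Qed.

Lemma range_small n (c : 'I_n -> C) : small K (range c).
Proof. by apply: small_image; exact: small_countable. Qed.

Lemma ocons_same A d (c : 'I_d -> C) x y : same (A `|` range c) x y ->
  eqt A (ocons x c) (ocons y c).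
Proof.
move=> H P dP; pose t (o : option 'I_d) : (unit -> C) -> C :=
  match o with Some i => fun=> c i | None => fun v => v tt end.
have dP' : Dfn (A `|` range c) (fun v => P (fun o => t o v)).
  apply: Dfn_at; first by apply: Dfn_mono dP; left.
  by move=> [i|]; [apply: Trm_par; right; exists i|exact: Trm_var].
have E z : (fun o => t o (fun=> z)) = ocons z c by apply/funext => -[].
by move/same_eqt: H => /(_ _ dP'); rewrite !E.
Qed.

(** The situation for [rank_step] is conjugacy with [(x0, z0)]: automorphisms carry the single given
    [big] set to every other instance. *)
Lemma rank_step_homog d (E : ('I_d -> C) -> C -> C -> Prop) z1 B x0 z0 : eqfam lt E ->
  big B -> (forall a b, B a -> B b -> a <> b -> ~ E z1 a b) ->
  (forall a, B a -> eqt set0 (ocons x0 z0) (ocons a z1) /\ forall y, E z1 a y -> E z0 x0 y) ->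
  forall n, rank_ge E n [set: C].
Proof.
move=> hE bB BE HB n.
apply: (@rank_step _ _ _ _ _ (fun t z' => eqt set0 (ocons x0 z0) (ocons t z')) hE _ n x0 z0) => //.
move=> t z' xtz.
have [|||s [As sv]] := @eqt_small set0 (option 'I_d) (ocons x0 z0) (ocons t z').
- exact: small_set0.
- by apply: (small_countable hK); exact: countableP.
- exact: xtz.
have sz : s \o z0 = z' by apply/funext => i; exact: (sv (Some i)).
have st : s x0 = t by exact: (sv None).
exists (s \o z1), (s @` B); split.
- move=> le; apply: bB; apply: card_le_trans le.
  apply: (@card_le_of _ _ _ _ s) => [b Bb|b b' _ _ ss]; first by exists b.
  by have [s' [_ sK _]] := autom_inv As; rewrite -(sK b) ss sK.
- move=> _ _ [b Bb <-] [b' Bb' <-] ne; rewrite -(eqfam_autom hE _ _ _ As).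
  by apply: BE => // bb; apply: ne; rewrite bb.
move=> _ [b Bb <-]; have [bt Hb] := HB _ Bb; split.
  apply: (eqt_trans bt).
  have -> : ocons (s b) (s \o z1) = s \o ocons b z1 by apply/funext => -[].
  exact: autom_eqt As.
have [s' [As' sK s'K]] := autom_inv As.
move=> y'; rewrite -(s'K y') -(eqfam_autom hE _ _ _ As) -sz -st -(eqfam_autom hE _ _ _ As).
exact: Hb.
Qed.

Hypothesis hr : finite_ranks C lt.

(** The question is whether some [z], conjugate to [c] over the same element [x] of the locus, can
    relate [x] to more of the locus than [c] does. If not, existentially quantified conjugates of
    [c] define [F] without parameters. If so, the larger class contains only boundedly many
    [E c]-classes between two points, hence two consecutive ones, and homogeneity gives neighbours
    to every class. *)
Lemma discrete_or_definable A a0 (F : C -> C -> Prop) : small K A -> D2 A F ->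
  equivalence_on [set x | same A a0 x] F ->
  (exists G, D2 set0 G /\ forall x y, same A a0 x -> same A a0 y -> (G x y <-> F x y)) \/
  exists d (E : ('I_d -> C) -> C -> C -> Prop) c b, eqfam lt E /\ discrete E c b.
Proof.
move=> sA dF eF; have [d [c [E [cA hE EF]]]] := convexify hC hlt sA dF eF.
have [[x [y [z [rx ry xz Ez nEc]]]]|H] := pselect (exists x y z, [/\ same A a0 x,
    same A a0 y, eqt set0 (ocons a0 c) (ocons x z), E z x y & ~ E c x y]); last first.
  left; pose V := (bool + 'I_d)%type.
  pose G : set (set (V -> C)) := [set P | exists th ch, [/\ D1 A th, th a0, Dfn set0 ch,
    ch (ocons a0 c) & P = [set v | (th (v (inl true)) /\ th (v (inl false))) /\
      ch (ocons (v (inl true)) (v \o inr))]]].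
  have dch (ch : (option 'I_d -> C) -> Prop) : Dfn set0 ch ->
      Dfn A (fun v : V -> C => ch (ocons (v (inl true)) (v \o inr))).
    move=> dch; apply: Dfn_ext (Dfn_ren (fun o : option 'I_d => if o is Some i then
      inr i else inl true) (Dfn_mono (@sub0set _ A) dch)) => v.
    by set u := _ \o _; set w := ocons _ _; have -> : u = w by apply/funext => -[].
  have [|||||||P [th [ch [dth tha dc cha ->]]] HP] := @compact_closed A V G (fun v =>
      E (v \o inr) (v (inl true)) (v (inl false)) -> E c (v (inl true)) (v (inl false))).
  - exact: sA.
  - by apply: (small_countable hK); exact: countableP.
  - move=> _ [th [ch [dth tha dc cha ->]]]; apply: Dfn_and; last exact: dch.
    by apply: Dfn_and; exact: D1_at dth (Trm_var _ _).
  - apply: Dfn_imp.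
      apply: (eqfam_Dfn (z := fun i v => v (inr i)) hE _ (Trm_var _ _) (Trm_var _ _)) => i.
      exact: Trm_var.
    apply: (eqfam_Dfn (z := fun i v => c i) hE _ (Trm_var _ _) (Trm_var _ _)) => i.
    exact: Trm_par.
  - exists [set v | (True /\ True) /\ True], (fun=> True), (fun=> True).
    by split=> //; exact: Dfn_True.
  - move=> _ _ [th [ch [dth tha dc cha ->]]] [th' [ch' [dth' tha' dc' cha' ->]]].
    exists [set v | (((th (v (inl true)) /\ th' (v (inl true))) /\
      (th (v (inl false)) /\ th' (v (inl false)))) /\ (ch (ocons (v (inl true)) (v \o inr)) /\
      ch' (ocons (v (inl true)) (v \o inr))))].
      exists (fun x => th x /\ th' x), (fun x => ch x /\ ch' x).
      by split=> //; exact: Dfn_and.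
    by move=> v [[[? ?] [? ?]] [? ?]].
  - move=> v Gv Ev; apply: contrapT => nE; apply: H.
    exists (v (inl true)), (v (inl false)), (v \o inr); split=> //.
    + apply: same_half => th dth tha.
      by have [[]] := Gv _ (ex_intro _ th (ex_intro _ (fun=> True)
        (And5 dth tha (Dfn_True _ _) I erefl))).
    + apply: same_half => th dth tha.
      by have [[]] := Gv _ (ex_intro _ th (ex_intro _ (fun=> True)
        (And5 dth tha (Dfn_True _ _) I erefl))).
    + suff h ch : Dfn set0 ch -> ch (ocons a0 c) -> ch (ocons (v (inl true)) (v \o inr)).
        move=> ch dc; split; first exact: h.
        by move=> chv; apply: contrapT => nch; exact: (h (fun w => ~ ch w) (Dfn_not dc) nch).
      move=> dc cha.
      by have [] := Gv _ (ex_intro _ (fun=> True) (ex_intro _ ch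
        (And5 (Dfn_True _ _) I dc cha erefl))).
  (* The formula [ch] of the type of [(a0, c)] stands in for conjugacy; in the converse direction
     [c] itself is the witness. *)
  exists (fun x y => exists z : 'I_d -> C, ch (ocons x z) /\ E z x y); split.
    pose f (o : option 'I_d) : 'I_d + bool := if o is Some i then inl i else inr true.
    have := @Dfn_exV _ C set0 'I_d bool (fun v => ch (v \o f) /\
      E (v \o inl) (v (inr true)) (v (inr false))).
    case: hE => dE _ _; move=> /(_ (Dfn_and (Dfn_ren f dc) dE)).
    apply: Dfn_ext => v; split=> -[z [Hz Ez]]; exists z; split=> //.
      by congr ch: Hz; apply/funext => -[].
    by congr ch: Hz; apply/funext => -[].
  move=> x y rx ry; split=> [[z [chz Ez]]|Fxy].
    apply/(EF _ _ rx ry).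
    apply: (HP (sumv (fun b : bool => if b then x else y) z)) => //.
    split=> //; split; first exact/(rx _ dth).
    exact/(ry _ dth).
  exists c; split; last exact/(EF _ _ rx ry).
  have ax : eqt set0 (ocons a0 c) (ocons x c).
    apply: ocons_same; apply: same_mono rx => t [//|[i _ <-]]; exact: cA.
  exact/(ax _ dc).
right; exists d, E, c, x; split=> //.
pose q := same (range c) x.
have cA' : range c `<=` A by move=> t [i _ <-]; exact: cA.
have sc : small K (range c) by exact: range_small.
have qy : q y by apply: same_mono cA' _; exact: same_trans (same_sym rx) ry.
have rE := eqfam_refl hE c.
have sE : forall x y, E c x y -> E c y x by move=> ? ?; exact: (eqfam_sym hE).
have cE : forall x y z, q x -> q y -> q z -> x <=% y -> y <=% z -> E c x z -> E c x y /\ E c y z.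
  move=> u v w _ _ _ uv vw Euw; have Euv := eqfam_convex hE Euw uv vw.
  by split=> //; exact: (eqfam_trans hE (sE _ _ Euv)).
have [u [w [qu qw uw nR Hu]]] : exists u w, [/\ q u, q w, u <% w, ~ E c u w &
    forall t, u <=% t -> t <=% w -> E z x t].
  have [xy|xy|xy] := lt_total hlt x y.
  - exists x, y; split=> //.
    by move=> t xt ty; exact: (eqfam_convex hE Ez).
  - by rewrite -xy in nEc.
  - exists y, x; split=> //; first by move=> /sE.
    move=> t yt tx; apply: (eqfam_trans hE Ez).
    apply: (eqfam_convex hE _ yt tx); exact: (eqfam_sym hE).
have [[n nn]|nn] := pselect (exists n, ~ (exists f : nat -> C, (forall i, i < n -> q (f i) /\
      [/\ u <% f i, f i <% w, ~ E c u (f i) & ~ E c (f i) w]) /\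
    forall i j, i < n -> j < n -> i <> j -> ~ E c (f i) (f j))); last first.
  (* Unboundedly many classes between [u] and [w] yield [big] many, all inside one class of [E z].
     Since [(x, z)] and each [(b, c)] are conjugate, the situation reproduces itself. *)
  exfalso.
  have dEc B (sB : range c `<=` B) (t t' : (unit -> C) -> C) : Trm B t -> Trm B t' ->
      Dfn B (fun v => E c (t v) (t' v)).
    move=> tt tt'; apply: (eqfam_Dfn (z := fun i v => c i) hE _ tt tt') => i.
    by apply: Trm_par; apply: sB; exists i.
  pose A' := range c `|` ([set u] `|` [set w]).
  have su : A' u by right; left.
  have sw : A' w by right; right.
  have scA : range c `<=` A' by left.
  have [||||||B [_ bB Bq BE]] := @many L C K T hC A' (range c) x (fun t =>
      (u <% t /\ t <% w) /\ (~ E c u t /\ ~ E c t w)) (E c).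
  - by apply: (smallU hK) => //; apply: (smallU hK); exact: small1.
  - exact: scA.
  - apply: Dfn_and; first by apply: Dfn_and; apply: D2_at (D2_lt _ _) _ _;
      (exact: Trm_var || exact: Trm_par).
    by apply: Dfn_and; apply: Dfn_not; apply: dEc => //; (exact: Trm_var || exact: Trm_par).
  - apply: (eqfam_Dfn (z := fun i v => c i) hE _ (Trm_var _ _) (Trm_var _ _)) => i.
    by apply: Trm_par; apply: scA; exists i.
  - exact: rE.
  - move=> n; have [f [Hf1 Hf2]] : exists f : nat -> C, (forall i, i < n -> q (f i) /\
        [/\ u <% f i, f i <% w, ~ E c u (f i) & ~ E c (f i) w]) /\
        forall i j, i < n -> j < n -> i <> j -> ~ E c (f i) (f j).
      by apply: contrapT => H; apply: nn; exists n.
    by exists f; split=> // i /Hf1[? [? ? ? ?]].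
  have [N] := hr hE; apply.
  have xc : eqt set0 (ocons a0 c) (ocons x c).
    apply: ocons_same; apply: same_mono rx => t [//|[i _ <-]]; exact: cA.
  apply: (rank_step_homog hE bB BE (x0 := x) (z0 := z)).
  move=> b Bb; have [qb [[ub bw] [nub nbw]]] := Bq _ Bb; split.
    apply: (eqt_trans (eqt_sym xz)); apply: (eqt_trans xc).
    by apply: ocons_same; apply: same_mono qb => e [].
  move=> e Ebe; apply: Hu.
    case: (le_or_lt hlt u e) => // eu; exfalso; apply: nub; apply: (sE _ _).
    apply: (eqfam_trans hE Ebe).
    apply: (eqfam_convex hE (t := b)); [exact: sE|exact: lt_le|exact: lt_le].
  case: (le_or_lt hlt e w) => // we; exfalso; apply: nbw.
  by apply: (eqfam_convex hE Ebe); exact: lt_le.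
have [e [f [qe qf ef nef Hef]]] := @adjacent_exists q (E c) n u w rE qu qw uw nR nn cE sE.
have move_adj s : autom (range c) s -> adjacent q (E c) (s e) (s f).
  by move=> As; exact: (adjacent_autom hE As).
split=> t qt.
  have [|s [As <-]] := same_autom hC sc (y := t) (x := e).
    by apply: same_trans qt; exact: same_sym.
  by exists (s f); exact: move_adj.
have [|s [As <-]] := same_autom hC sc (y := t) (x := f).
  by apply: same_trans qt; exact: same_sym.
by exists (s e); exact: move_adj.
Qed.

End Discrete.

(** * Countable elementary substructures omitting a set *)

Section Coding.
Variables (L : language) (cf : func L -> nat) (cr : rel_symb L -> nat).
Hypotheses (cf_inj : injective cf) (cr_inj : injective cr).

Fixpoint tcode n (t : term L n) : GenTree.tree nat :=
  match t with
  | Var i => GenTree.Leaf (i : nat)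
  | App f ts => GenTree.Node (cf f) [seq tcode (ts i) | i <- enum 'I_(func_arity f)]
  end.

Lemma tcode_inj n : injective (@tcode n).
Proof.
elim=> [i|f ts IH] [j|g us] //= []; first by move=> /ord_inj ->.
move=> /cf_inj E; case: g / E us => us /eq_in_map H.
by congr App; apply/funext => i; apply: IH; apply: H; rewrite mem_enum.
Qed.

Fixpoint fcode n (phi : formula L n) : GenTree.tree nat :=
  match phi with
  | FFalse _ => GenTree.Node 0 [::]
  | FEq _ t u => GenTree.Node 1 [:: tcode t; tcode u]
  | FRel _ R ts => GenTree.Node 2 (GenTree.Leaf (cr R) ::
      [seq tcode (ts i) | i <- enum 'I_(rel_arity R)])
  | FImp _ f g => GenTree.Node 3 [:: fcode f; fcode g]
  | FAll _ f => GenTree.Node 4 [:: fcode f]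
  end.

Lemma fcode_inj n : injective (@fcode n).
Proof.
elim=> {n} [n|n t u|n R ts|n f IHf g IHg|n f IHf] phi.
- by case: n / phi.
- case: n / phi t u => //= n t' u' t u [] /tcode_inj -> /tcode_inj -> //.
- case: n / phi ts => //= n R' ts' ts [] /cr_inj E.
  case: R' / E ts' => ts' /eq_in_map H.
  by congr FRel; apply/funext => i; apply: tcode_inj; apply: H; rewrite mem_enum.
- by case: n / phi f g IHf IHg => //= n f' g' f g IHf IHg [] /IHf -> /IHg ->.
- by case: n / phi f IHf => //= n f' f IHf [] /IHf ->.
Qed.

End Coding.

Section Substructure.
Variables (L : language) (C : structure L).

(** The Tarski-Vaught criterion: such an [N] is an elementary substructure by [sat_substructure]. *)
Definition tv_closed (N : set C) := forall k (f : formula L k.+1) (w : 'I_k -> C),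
  (forall i, N (w i)) -> (exists x, sat f (tcons x w)) -> exists x, N x /\ sat f (tcons x w).

Variables (N : set C) (hN : tv_closed N).

Lemma tcons0 (X : Type) k (x : X) (w : 'I_k -> X) : tcons x w ord0 = x.
Proof. by rewrite /tcons unlift_none. Qed.

Lemma tconsS (X : Type) k (x : X) (w : 'I_k -> X) i : tcons x w (lift ord0 i) = w i.
Proof. by rewrite /tcons liftK. Qed.

Lemma tv_inh : inhabited {x : C | N x}.
Proof.
have [c0] := carrier_inh C.
have [||x [Nx _]] := @hN 0 (FEq (Var L ord0) (Var L ord0)) (fun i => c0) => //.
- by case.
- by exists c0.
- exact: inhabits (exist _ x Nx).
Qed.

Lemma tv_func (f : func L) (a : 'I_(func_arity f) -> {x : C | N x}) :
  N (@func_interp L C f (fun i => sval (a i))).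
Proof.
have [||x [Nx /= E]] := @hN _ (FEq (Var L ord0) (App (fun i => Var L (lift ord0 i))))
  (fun i => sval (a i)).
- by move=> i; exact: svalP.
- exists (@func_interp L C f (fun i => sval (a i))); rewrite /= tcons0.
  by congr func_interp; apply/funext => i; rewrite tconsS.
rewrite tcons0 in E; rewrite E in Nx; congr N: Nx.
by congr func_interp; apply/funext => i; rewrite tconsS.
Qed.

Definition substructure : structure L := @Structure L {x : C | N x} tv_inh
  (fun f a => exist N _ (tv_func a)) (fun r a => @rel_interp L C r (fun i => sval (a i))).

Lemma eval_substructure n (t : term L n) (v : 'I_n -> substructure) :
  sval (eval v t) = eval (fun i => sval (v i)) t.
Proof. by elim: t => //= f ts IH; congr func_interp; apply/funext => i. Qed.

Lemma sat_substructure n (phi : formula L n) (v : 'I_n -> substructure) :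
  sat phi v <-> sat phi (fun i => sval (v i)).
Proof.
elim: phi v => {n} [n|n t u|n R ts|n f IHf g IHg|n f IHf] v /=.
- by [].
- rewrite -!eval_substructure; split=> [-> //|E].
  by case: (eval v t) (eval v u) E => [x Nx] [y Ny] /= E; exact: eq_exist.
- set a := (fun i => _); set a' := (fun i => _); have -> // : a = a'.
  by apply/funext => i; exact: eval_substructure.
- by rewrite IHf IHg.
have E (x : substructure) : (fun i => sval (tcons x v i)) = tcons (sval x) (fun i => sval (v i)).
  by apply/funext => i; rewrite /tcons; case: (unlift _ _).
split=> H x; last by apply/IHf; rewrite E; exact: H.
apply: contrapT => nH.
have [||y [Ny /= ny]] := @hN _ (FNot f) (fun i => sval (v i)).
- by move=> i; exact: svalP.
- by exists x.
by apply: ny; have /IHf := H (exist _ y Ny); rewrite E.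
Qed.

Lemma substructure_model (T : theory L) : model T C -> model T substructure.
Proof. by move=> mC phi Tphi v; apply/sat_substructure; exact: mC. Qed.

End Substructure.

Lemma unbounded_inj (h : nat -> nat) M : injective h -> exists r, M < h r.
Proof.
move=> h_inj; apply: contrapT => no.
have hM r : h r < M.+1 by rewrite ltnS leqNgt; apply/negP => lt; apply: no; exists r.
have := @leq_card _ _ (fun i : 'I_M.+2 => Ordinal (hM i)).
rewrite !card_ord ltnn => H; suff : false by []; apply: H => i j /(congr1 val) /= /h_inj.
exact: ord_inj.
Qed.

Section Omitting.
Variables (L : language) (C : structure L) (K : Type) (T : theory L).
Hypothesis hC : monster_model K T C.

Let hK : uncountable_strong_limit K. Proof. by case: hC. Qed.

Variables (p : nat -> C) (D : set C).
Hypothesis D_closed : forall x, ~ D x -> exists Y, [/\ D1 (range p) Y, Y x & forall z, Y z -> ~ D z].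
Hypothesis D_thin : forall Y y, D1 (range p) Y -> Y y -> exists z, Y z /\ ~ D z.

(** An entry [inl n] stands for the Henkin constant [v n], an entry [inr n] for the parameter
    [p n]. *)
Let args k (l : seq (nat + nat)) (v : nat -> C) : 'I_k -> C := fun i =>
  match nth (inr 0) l i with inl n => v n | inr n => p n end.

Let good t (X : (nat -> C) -> Prop) := [/\ Dfn (range p) X, exists v, X v &
  forall v w, (forall n, n < t -> v n = w n) -> X v -> X w].

Let bounded t (l : seq (nat + nat)) := all (fun s : nat + nat => if s is inl n then n < t else true) l.

Variables (cf : func L -> nat) (cr : rel_symb L -> nat).
Hypotheses (cf_inj : injective cf) (cr_inj : injective cr).

Let step t (X X' : (nat -> C) -> Prop) := [/\ good t.+1 X', forall v, X' v -> X v,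
  forall v, X' v -> ~ D (v t) &
  forall k (f : formula L k.+1) l (r : nat), t = pickle (k, fcode cf cr f, l, r) -> bounded t l ->
    forall v, X' v -> (exists x, sat f (tcons x (args l v))) -> sat f (tcons (v t) (args l v))].

(** The constant [t] is treated in two moves. It is made a witness for the formula coded by [t], if
    there is one; then its possible values, a nonempty definable set over [p], are narrowed to a
    definable set outside [D] by [D_thin] and [D_closed]. *)
Lemma henkin_step t X : good t X -> exists X', step t X X'.
Proof.
move=> [dX [v0 Xv0] tX].
have [X1 [[dX1 [v1 Xv1] tX1] X1X X1w]] : exists X1, [/\ good t.+1 X1, forall v, X1 v -> X v &
  forall k (f : formula L k.+1) l (r : nat), t = pickle (k, fcode cf cr f, l, r) -> bounded t l ->
    forall v, X1 v -> (exists x, sat f (tcons x (args l v))) -> sat f (tcons (v t) (args l v))].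
  have [[k [f [l [r [Et bl]]]]]|no] := pselect (exists k (f : formula L k.+1) l (r : nat),
      t = pickle (k, fcode cf cr f, l, r) /\ bounded t l); last first.
    exists X; split=> //.
      by split=> //; [exists v0|move=> v w vw; apply: tX => n nt; apply: vw; exact: ltnW].
    by move=> k f l r Et bl; case: no; exists k, f, l, r.
  have argsE (v w : nat -> C) : (forall n, n < t -> v n = w n) -> @args k l v = args l w.
    move=> vw; apply/funext => i; rewrite /args.
    have [il|il] := ltnP i (size l); last by rewrite nth_default.
    by have := all_nthP (inr 0) bl _ il; case: (nth _ _ _) => // n; exact: vw.
  exists (fun v => X v /\ ((exists x, sat f (tcons x (args l v))) -> sat f (tcons (v t) (args l v)))).
  split; last 2 first.
  - by move=> v [].
  - move=> k' f' l' r' Et' bl' v [_]; move: Et'; rewrite Et.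
    move=> /(pcan_inj pickleK)[Ek Ef <- _]; case: k' / Ek f' Ef => f' /(fcode_inj cf_inj cr_inj) <-.
    by [].
  split; last 2 first.
  - have [x Hx] : exists x, (exists x, sat f (tcons x (args l v0))) -> sat f (tcons x (args l v0)).
      have [[x fx]|no] := pselect (exists x, sat f (tcons x (args l v0))); first by exists x.
      by exists (v0 0).
    exists (fun n => if n == t then x else v0 n).
    have agree n : n < t -> (if n == t then x else v0 n) = v0 n.
      by case: eqP => // ->; rewrite ltnn.
    split; first by apply: tX Xv0 => n nt; rewrite agree.
    by rewrite (argsE _ _ agree) eqxx.
  - move=> v w vw [Xv Hv]; have vw' n : n < t -> v n = w n by move=> nt; apply: vw; exact: ltnW.
    by rewrite -(argsE _ _ vw') -(vw t (leqnn _)); split=> //; exact: tX Xv.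
  have Targs V (u : nat -> V) i : Trm (range p) (fun v : V -> C => @args k l (fun n => v (u n)) i).
    rewrite /args; case: (nth _ _ _) => n; [exact: Trm_var|apply: Trm_par; by exists n].
  have ds V (u : nat -> V) (y : V) :
      Dfn (range p) (fun v : V -> C => sat f (tcons (v y) (args l (fun n => v (u n))))).
    apply: (@Dfn_at _ C (range p) V _ (sat f) (fun i v => tcons (v y) (args l (fun n => v (u n))) i)).
      exact: Dfn_mono (Dfn_sat C f).
    by move=> i; rewrite /tcons; case: (unlift _ _) => [j|] /=; [exact: Targs|exact: Trm_var].
  apply: Dfn_and => //; apply: Dfn_imp; last exact: ds.
  by apply: Dfn_ex; exact: (ds _ Some None).
have [||z [[v [Xv vz]] nDz]] := @D_thin (fun x => exists v, X1 v /\ v t = x) (v1 t).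
- have dQ : Dfn (range p) (fun u : nat + unit -> C => X1 (u \o inl) /\ u (inl t) = u (inr tt)).
    by apply: Dfn_and; [exact: Dfn_ren|exact: Dfn_eq].
  exact: Dfn_ext (Dfn_exV dQ).
- by exists v1.
have [Y [dY Yz HY]] := D_closed nDz.
exists (fun v => X1 v /\ Y (v t)); split.
- split; first by apply: Dfn_and => //; exact: D1_at dY (Trm_var _ _).
    by exists v; rewrite vz.
  by move=> u w uw [Xu Yu]; rewrite -uw //; split=> //; exact: tX1 Xu.
- by move=> u [/X1X].
- by move=> u [_ /HY].
- by move=> k f l r Et bl u [Xu _]; exact: X1w Et bl _ Xu.
Qed.

(** The omitting types theorem for a set [D] that is closed and has empty interior with respect to
    definability over a countable set. The conditions are realized simultaneously in [C] by
    compactness, and the constants form [N]. *)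
Lemma omitting : exists N : set C, [/\ countable N, range p `<=` N, tv_closed N &
  forall x, N x -> ~ D x].
Proof.
have [c0] := carrier_inh C.
have /choice[g gP] : forall tX : nat * ((nat -> C) -> Prop), exists X',
    good tX.1 tX.2 -> step tX.1 tX.2 X'.
  move=> [t X]; have [gX|ngX] := pselect (good t X); last by exists X.
  by have [X' sX'] := henkin_step gX; exists X'.
pose X := fix X t := if t is t'.+1 then g (t', X t') else fun=> True.
have gX t : good t (X t).
  elim: t => [|t IH] /=; last by case: (gP (t, X t) IH).
  split; [exact: Dfn_True|by exists (fun=> c0)|by []].
have sX t : step t (X t) (X t.+1) := gP (t, X t) (gX t).
have decX s t : s <= t -> forall v, X t v -> X s v.
  elim: t => [|t IH]; first by rewrite leqn0 => /eqP ->.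
  rewrite leq_eqVlt => /orP[/eqP -> //|/IH h] v Xv; apply: h.
  by case: (sX t) => _ h _ _; exact: h.
have [||||v vX] := @compactness _ _ _ _ hC (range p) nat (range X).
- by apply: small_image; exact: hK.1.
- exact: hK.1.
- by move=> _ [t _ <-]; case: (gX t).
- move=> s sF; have [t Ht] : exists t, forall v, X t v -> All (fun P : set (nat -> C) => P v) s.
    elim: s sF => [_|P s IH [[t _ <-] /IH[t' Ht']]]; first by exists 0.
    exists (maxn t t') => v Xv; split; first exact: decX (leq_maxl _ _) _ Xv.
    by apply: Ht'; exact: decX (leq_maxr _ _) _ Xv.
  by have [_ [v Xv] _] := gX t; exists v; exact: Ht.
have {}vX t : X t v by apply: vX; exists t.
have wit k (f : formula L k.+1) l (r : nat) : let t := pickle (k, fcode cf cr f, l, r) in bounded t l ->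
    (exists x, sat f (tcons x (args l v))) -> sat f (tcons (v t) (args l v)).
  by move=> t bl ex; have [_ _ _ h] := sX t; exact: h (erefl t) bl _ (vX _) ex.
exists (range v); split.
- exact: card_image_le.
(* The formula [x = p n] has only one witness, which puts the parameter into [N]. *)
- move=> _ [n _ <-]; pose f := FEq (Var L (ord0 : 'I_2)) (Var L (lift ord0 ord0)).
  have := @wit 1 f [:: inr n] 0 isT; set t := pickle _; rewrite /= tcons0 tconsS /=.
  by move=> H; exists t => //; apply: H; exists (p n); rewrite tcons0 tconsS.
- move=> k f w Nw ex.
  have /choice[nn nnP] : forall i, exists n, v n = w i by move=> i; have [n _ <-] := Nw i; exists n.
  pose l : seq (nat + nat) := [seq inl (nn i) | i <- enum 'I_k].
  have El : args l v = w.
    apply/funext => i; rewrite /args (nth_map i) ?size_enum_ord // nth_ord_enum; exact: nnP.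
  (* The last component of the code is padding: it makes the stage later than all constants
     occurring in [l]. *)
  have [|r Hr] := @unbounded_inj (fun r : nat => pickle (k, fcode cf cr f, l, r)) (\max_i nn i).
    by move=> r r' /(pcan_inj pickleK)[].
  exists (v (pickle (k, fcode cf cr f, l, r))); split; first by exists (pickle (k, fcode cf cr f, l, r)).
  rewrite -El; apply: wit; last by rewrite El.
  apply/allP => _ /mapP[i _ ->]; apply: leq_ltn_trans Hr; exact: leq_bigmax.
- by move=> _ [t _ <-]; have [_ _ h _] := sX t; exact: h (vX t.+1).
Qed.

End Omitting.

(** * Linear orders coding sets of integers *)

Lemma enumerate (X : Type) (A : set X) x0 : countable A -> A x0 -> exists p : nat -> X, range p = A.
Proof.
move=> cA Ax0; have [f [_ f_inj]] := card_le_fun 0 (cA : A #<= [set: nat]).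
have /choice[p pP] : forall n, exists x, A x /\ forall y, A y -> f y = n -> x = y.
  move=> n; have [[y [Ay fy]]|no] := pselect (exists y, A y /\ f y = n).
    by exists y; split=> // z Az fz; apply: f_inj => //; rewrite fy fz.
  by exists x0; split=> // y Ay fy; case: no; exists y.
exists p; apply/seteqP; split=> [_ [n _ <-]|x Ax]; first by case: (pP n).
by exists (f x) => //; have [_ h] := pP (f x); exact: h.
Qed.

(** A sequence of sets of integers can be coded by one set of integers. If for every [n] some value
    [w n] in place [n] excluded level [n], the code of [w] could be on no level at all. So one level
    carries a continuum. *)
Lemma koenig (X : Type) (Q : set X) :
  [set: set nat] #<= [set x : X * nat | Q x.1] -> [set: set nat] #<= Q.
Proof.
move=> le; have [q0 _] : exists q : X, True.
  apply: contrapT => no.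
  have E : [set x : X * nat | Q x.1] = set0.
    by apply/seteqP; split=> // -[x n] _; apply: no; exists x.
  move: le; rewrite E => /card_leP[f]; have := f (SigSub (mem_set (I : [set: set nat] set0))).
  by move=> [x /set_mem].
have [f [fQ f_inj]] := card_le_fun (q0, 0) le.
pose code (z : nat -> set nat) : set nat := [set n | exists i j, n = pickle (i, j) /\ z i j].
have code_inj z z' : code z = code z' -> z = z'.
  have H (w : nat -> set nat) i j : w i j <-> code w (pickle (i, j)).
    split=> [h|[i' [j' [/(pcan_inj pickleK)[-> ->] //]]]]; by exists i, j.
  by move=> E; apply/funext => i; apply/funext => j; apply/propext; rewrite !H E.
have [n Hn] : exists n, forall s, exists z, z n = s /\ (f (code z)).2 = n.
  apply: contrapT => no.
  have /choice[w wP] : forall n, exists s, forall z, z n = s -> (f (code z)).2 <> n.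
    move=> n; apply: contrapT => h; apply: no; exists n => s; apply: contrapT => h'.
    by apply: h; exists s => z zs E; apply: h'; exists z.
  exact: wP _ w erefl erefl.
have /choice[z zP] := Hn.
apply: (@card_le_of _ _ _ _ (fun s => (f (code (z s))).1)) => [s _|s s' _ _ E]; first exact: fQ.
have [zs f2] := zP s; have [zs' f2'] := zP s'.
have /code_inj Ez : code (z s) = code (z s').
  apply: f_inj => //; rewrite [f (code (z s))]surjective_pairing f2.
  by rewrite [f (code (z s'))]surjective_pairing f2' E.
by rewrite -zs -zs' Ez.
Qed.

Section Blocks.
Import Order.TTheory GRing.Theory Num.Theory.

Definition lexi_lt : rel (nat * int) := fun i j =>
  (i.1 < j.1)%N || ((i.1 == j.1) && (i.2 < j.2)%R).

Lemma lexi_irr : irreflexive lexi_lt.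
Proof. by move=> [m k]; rewrite /lexi_lt /=; lia. Qed.

Lemma lexi_trans : transitive lexi_lt.
Proof. by move=> [m k] [m' k'] [m2 k2]; rewrite /lexi_lt /=; lia. Qed.

Lemma lexi_total i j : i <> j -> lexi_lt i j \/ lexi_lt j i.
Proof.
case: i j => [m k] [m' k'] ne; rewrite /lexi_lt /=.
have : (m != m') || (k != k') by apply/negP => /negP; rewrite negb_or !negbK => /andP[/eqP E /eqP E']; apply: ne; rewrite E E'.
by move=> h; apply/orP; lia.
Qed.

Definition covers (X : set (nat * int)) i j :=
  [/\ X i, X j, lexi_lt i j & forall k, X k -> ~ (lexi_lt i k /\ lexi_lt k j)].

(** A maximal run of [n.+1] consecutive elements; the shift by one lets [n = 0] be coded too. *)
Definition has_block (X : set (nat * int)) n := exists x : nat -> nat * int,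
  [/\ forall k, k <= n -> X (x k), forall k, k < n -> covers X (x k) (x k.+1),
    forall y, ~ covers X y (x 0) & forall y, ~ covers X (x n) y].

(** The odd columns are copies of the integers: they keep the blocks of the even columns apart and
    contain no block themselves. *)
Definition blocks (S : set nat) : set (nat * int) :=
  [set i | if odd i.1 then True else S i.1./2 /\ (0 <= i.2)%R /\ (i.2 <= (i.1./2)%:Z)%R].

(** No covering joins different columns: of two neighbouring columns one is a copy of the integers,
    which has neither a first nor a last element. *)
Lemma covers_blocks S i j : covers (blocks S) i j <->
  [/\ blocks S i, blocks S j, i.1 = j.1 & j.2 = (i.2 + 1)%R].
Proof.
case: i j => [m k] [m' k']; split=> [[Xi Xj lt H]|/= [Xi Xj E E']]; last first.
  split=> //; first by rewrite /lexi_lt /=; lia.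
  by move=> [u v] _; rewrite /lexi_lt /=; lia.
split=> //.
- apply: contrapT => /= ne; have mm' : (m < m')%N by move: lt; rewrite /lexi_lt /=; lia.
  have [om|em] := boolP (odd m).
    apply: (H (m, k + 1)%R); first by rewrite /blocks /= om.
    by rewrite /lexi_lt /=; lia.
  have om1 : odd m.+1 by rewrite /= em.
  have [E|ne'] := eqVneq m' m.+1.
    apply: (H (m.+1, k' - 1)%R); first by rewrite /blocks /= em.
    by rewrite /lexi_lt /=; lia.
  apply: (H (m.+1, 0%R)); first by rewrite /blocks /= em.
  by rewrite /lexi_lt /=; lia.
- apply: contrapT => /= ne.
  have mm' : m = m'.
    apply: contrapT => ne2; have mm' : (m < m')%N by move: lt; rewrite /lexi_lt /=; lia.
    have [om|em] := boolP (odd m).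
      apply: (H (m, k + 1)%R); first by rewrite /blocks /= om.
      by rewrite /lexi_lt /=; lia.
    have [E|ne'] := eqVneq m' m.+1.
      apply: (H (m.+1, k' - 1)%R); first by rewrite /blocks /= em.
      by rewrite /lexi_lt /=; lia.
    apply: (H (m.+1, 0%R)); first by rewrite /blocks /= em.
    by rewrite /lexi_lt /=; lia.
  subst m'; have kk' : (k < k')%R by move: lt; rewrite /lexi_lt /=; lia.
  apply: (H (m, k + 1)%R); last by rewrite /lexi_lt /=; lia.
  move: Xi Xj; rewrite /blocks /=; case: (odd m) => // -[Sm [k0 km]] [_ [k0' km']].
  by split=> //; lia.
Qed.

(** A maximal finite run cannot lie in an odd column, which has no ends, so it is a whole even
    column; column [n.*2] has the elements [0, ..., n]. *)
Lemma has_block_blocks S n : has_block (blocks S) n <-> S n.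
Proof.
split=> [[x [Xx cx np ns]]|Sn]; last first.
  exists (fun k => (n.*2, Posz k)).
  have Xk k : (k <= n)%N -> blocks S (n.*2, Posz k).
    by move=> kn; rewrite /blocks /= odd_double doubleK; split=> //; lia.
  split=> //.
  - by move=> k kn; apply/covers_blocks; split=> //=; [apply: Xk; lia|exact: Xk|lia].
  - move=> [m k] /covers_blocks[Xi _ /= E E']; move: Xi; rewrite /blocks /= E odd_double.
    by move=> [_ [k0 _]]; lia.
  - move=> [m k] /covers_blocks[_ Xj /= E E']; move: Xj; rewrite /blocks /= -E odd_double doubleK.
    by move=> [_ [_ kn]]; lia.
have Ex k : (k <= n)%N -> x k = ((x 0).1, ((x 0).2 + k%:Z)%R).
  elim: k => [_|k IH kn]; first by rewrite addr0 -surjective_pairing.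
  have /covers_blocks[_ _ E1 E2] := cx _ kn.
  rewrite [x k.+1]surjective_pairing -E1 E2 IH /=; last exact: ltnW.
  by congr pair; lia.
have := Ex n (leqnn n); have := Xx 0 (leq0n _); have := Xx n (leqnn _).
move: np ns; case: (x 0) => [m k] /= np ns Xn X0 En; rewrite En in Xn ns.
have [om|em] := boolP (odd m).
  case: (np (m, k - 1)%R); apply/covers_blocks; split=> //=; last by lia.
  by rewrite /blocks /= om.
have [Sm [k0 km]] : S m./2 /\ (0 <= k)%R /\ (k <= (m./2)%:Z)%R.
  by move: X0; rewrite /blocks /= (negbTE em).
have [_ [_ kn]] : S m./2 /\ (0 <= k + n%:Z)%R /\ (k + n%:Z <= (m./2)%:Z)%R.
  by move: Xn; rewrite /blocks /= (negbTE em).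
have E0 : k = 0%R.
  apply: contrapT => ne; case: (np (m, k - 1)%R); apply/covers_blocks; split=> //=; last by lia.
  by rewrite /blocks /= (negbTE em); split=> //; lia.
suff -> : n = m./2 by [].
apply: contrapT => ne; case: (ns (m, k + n%:Z + 1)%R); apply/covers_blocks; split=> //=.
by rewrite /blocks /= (negbTE em); split=> //; lia.
Qed.

Lemma blocks_iso S S' (g : nat * int -> nat * int) :
  (forall i, blocks S i -> blocks S' (g i)) ->
  (forall i j, blocks S i -> blocks S j -> lexi_lt i j -> lexi_lt (g i) (g j)) ->
  (forall j, blocks S' j -> exists i, blocks S i /\ g i = j) -> S `<=` S'.
Proof.
move=> gB gl gs n /has_block_blocks[x [Xx cx np ns]]; apply/has_block_blocks.
have gl' i j : blocks S i -> blocks S j -> lexi_lt (g i) (g j) -> lexi_lt i j.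
  move=> Xi Xj gij; have [E|ne] := pselect (i = j); first by rewrite E lexi_irr in gij.
  have [//|ji] := lexi_total ne; have := lexi_trans gij (gl _ _ Xj Xi ji).
  by rewrite lexi_irr.
have gc i j : covers (blocks S) i j -> covers (blocks S') (g i) (g j).
  move=> [Xi Xj ij H]; split; [exact: gB|exact: gB|exact: gl|].
  move=> _ /gs[k [Xk <-]] [ik kj]; apply: (H k Xk); split; exact: gl'.
have gc' i j : blocks S i -> blocks S j -> covers (blocks S') (g i) (g j) -> covers (blocks S) i j.
  move=> Xi Xj [_ _ ij H]; split=> //; first exact: gl'.
  by move=> k Xk [ik kj]; apply: (H _ (gB _ Xk)); split; exact: gl.
exists (g \o x); split=> [k kn|k kn|y cy|y cy] /=.
- exact/gB/Xx.
- exact/gc/cx.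
- have [/gs[i [Xi E]] _ _ _] := cy; apply: (np i); apply: gc' => //; first exact: Xx.
  by rewrite E.
- have [_ /gs[i [Xi E]] _ _] := cy; apply: (ns i); apply: gc' => //; first exact: Xx.
  by rewrite E.
Qed.

End Blocks.

(** * The limit type of a discrete quotient *)

Lemma iso_Dfn L (C : structure L) (s : C -> C) A V (P : (V -> C) -> Prop) :
  isomorphism s -> Dfn (s @` A) P -> Dfn A (fun v => P (s \o v)).
Proof.
move=> sI [k [f [x [xA H]]]].
have /choice[y yP] : forall i, exists y : V + C, par_in A y /\
    forall v, s (aval v y) = aval (s \o v) (x i).
  move=> i; move: (xA i); case: (x i) => [w _|_ [a Aa <-]]; first by exists (inl w).
  by exists (inr a).
exists k, f, y; split=> [i|v]; first by case: (yP i).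
rewrite H (iso_sat sI f (aval v \o y)).
by have -> : s \o (aval v \o y) = aval (s \o v) \o x by apply/funext => i; case: (yP i) => _ /= ->.
Qed.

Section Limit.
Variables (L : language) (C : structure L) (lt : formula L 2) (K : Type) (T : theory L).
Hypothesis hC : monster_model K T C.
Hypothesis hlt : weakly_quasi_o_minimal_wrt C lt.
Implicit Types (A B : set C).

Local Notation "x <% y" := (@lt_of L C lt x y) (at level 70).
Local Notation "x <=% y" := (@le_of L C lt x y) (at level 70).

Let hK : uncountable_strong_limit K. Proof. by case: hC. Qed.

Lemma D1_par A a (J : C -> Prop) : D1 (A `|` [set a]) J ->
  exists H, D2 A H /\ forall x, J x <-> H a x.
Proof.
move=> /(@Dfn_absorb _ _ A _ _ _ (fun _ : unit => a))[|Q [dQ HQ]].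
  by move=> x [Ax|->]; [left|right; exists tt].
exists (fun a x => Q (sumv (fun=> x) (fun=> a))); split=> [|x].
  apply: Dfn_ext (Dfn_ren (fun s => if s is inl _ then false else true) dQ) => v.
  by split=> Qv; congr Q: Qv; apply/funext => -[].
by rewrite (HQ (fun=> x)); split=> Qv; congr Q: Qv; apply/funext => -[].
Qed.

Lemma D1_of_D2 A a (H : C -> C -> Prop) : D2 A H -> D1 (A `|` [set a]) (H a).
Proof.
move=> dH; apply: D2_at (Trm_par _ _) (Trm_var _ _); last by right.
by apply: D2_mono dH; left.
Qed.

(** Downward closure turns all fibres into cuts and leaves the fibre at [a] unchanged. *)
Lemma D1_par_downset A a (J : C -> Prop) : D1 (A `|` [set a]) J -> downset lt J ->
  exists H, [/\ D2 A H, forall a', downset lt (H a') & forall x, J x <-> H a x].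
Proof.
move=> /D1_par[H [dH HJ]] dJ.
exists (fun a x => exists y, x <=% y /\ H a y); split.
- apply: Dfn_ex; apply: Dfn_and; first exact: D2_at (D2_le _ _) (Trm_var _ _) (Trm_var _ _).
  exact: D2_at dH (Trm_var _ _) (Trm_var _ _).
- move=> a' x y [z [xz Hz]] yx; exists z; split=> //; right; exact: lt_le_trans yx xz.
- move=> x; rewrite HJ; split=> [Hx|[y [xy /HJ Jy]]]; first by exists x; split=> //; left.
  by apply/HJ; exact: downset_le dJ Jy xy.
Qed.

Variables (d : nat) (E : ('I_d -> C) -> C -> C -> Prop) (c : 'I_d -> C) (b : C).
Hypothesis hE : eqfam lt E.
Hypothesis hd : discrete lt E c b.

Definition dq := same (range c) b.
Local Notation q := dq.
Local Notation R := (E c).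

Lemma D2_R A : range c `<=` A -> D2 A R.
Proof.
move=> cA; apply: (eqfam_Dfn (z := fun i v => c i) hE _ (Trm_var _ _) (Trm_var _ _)) => i.
by apply: Trm_par; apply: cA; exists i.
Qed.

Lemma Rrefl x : R x x. Proof. exact: eqfam_refl hE _ _. Qed.
Lemma Rsym x y : R x y -> R y x. Proof. exact: (eqfam_sym hE). Qed.
Lemma Rtrans x y z : R x y -> R y z -> R x z. Proof. exact: (eqfam_trans hE). Qed.
Lemma Rconvex x y z : R x z -> x <=% y -> y <=% z -> R x y. Proof. exact: (eqfam_convex hE). Qed.

Lemma Rsep x x' y y' : R x x' -> R y y' -> ~ R x y -> x <% y -> x' <% y'.
Proof.
have step u v w : R u w -> ~ R u v -> u <% v -> w <% v.
  move=> Ruw nR uv; case: (le_or_lt hlt v w) => // vw; case: nR.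
  by apply: Rconvex Ruw _ vw; right.
move=> Rx Ry nR xy; have x'y := step _ _ _ Rx nR xy.
have nR' : ~ R x' y by move=> h; apply: nR; exact: Rtrans Rx h.
case: (le_or_lt hlt y' x') => // y'x'; exfalso; apply: nR'.
apply: Rsym; apply: (Rtrans Ry).
by apply: Rconvex (Rsym Ry) y'x' _; right.
Qed.

Lemma adjacent_unique x y x' y' : adjacent lt q R x y -> adjacent lt q R x' y' ->
  R x x' -> R y y'.
Proof.
have step x0 y0 x1 y1 : adjacent lt q R x0 y0 -> adjacent lt q R x1 y1 ->
    R x0 x1 -> y1 <% y0 -> R y0 y1.
  move=> [qx qy xy nR H] [qx' qy' xy' nR' H'] Rx yy.
  have nR1 : ~ R x0 y1 by move=> h; apply: nR'; exact: Rtrans (Rsym Rx) h.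
  have xy1 : x0 <% y1 by apply: (Rsep (Rsym Rx) (Rrefl _)) xy' .
  by have [|/Rsym] := H _ qy' xy1 yy.
move=> a a' Rx; have [yy|->|yy] := lt_total hlt y y'; last exact: step a a' Rx yy.
  by apply: Rsym; exact: step a' a (Rsym Rx) yy.
exact: Rrefl.
Qed.

Definition dsucc x : C := match pselect (exists y, adjacent lt q R x y) with
  | left e => sval (cid e) | right _ => x end.

Lemma dsuccP x : q x -> adjacent lt q R x (dsucc x).
Proof.
case: hd => hs _ qx; rewrite /dsucc; case: pselect => [e|[]]; first exact: svalP (cid e).
exact: hs.
Qed.

(** The representatives depend on the choices in [dsucc], their classes do not ([adjacent_unique]).
    So the cut [low] is invariant over [c] and [b]. *)
Definition bs m := iter m dsucc b.

Lemma bs_q m : q (bs m).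
Proof. by elim: m => [|m /dsuccP[_ H _ _ _]]; [exact: same_refl|exact: H]. Qed.

Lemma bs_adj m : adjacent lt q R (bs m) (bs m.+1).
Proof. exact: (dsuccP (bs_q m)). Qed.

Lemma bs_lt m n : m < n -> bs m <% bs n.
Proof.
elim: n => // n IH; have [_ _ ltn _ _] := bs_adj n.
by rewrite ltnS leq_eqVlt => /orP[/eqP -> //|/IH h]; exact: (lt_tr hlt h ltn).
Qed.

Lemma bs_le m n : m <= n -> bs m <=% bs n.
Proof. by rewrite leq_eqVlt => /orP[/eqP ->|/bs_lt]; [left|right]. Qed.

Definition low x := exists m, x <% bs m.

Lemma low_bs m : low (bs m).
Proof. by exists m.+1; exact: bs_lt. Qed.

Lemma not_low x : ~ low x <-> forall m, bs m <% x.
Proof.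
split=> [nl m|H [m xm]]; last exact: (lt_asym hlt xm (H m)).
have : bs m.+1 <=% x by apply: (not_lt hlt) => xm; apply: nl; exists m.+1.
exact: (lt_le_trans hlt (bs_lt _)).
Qed.

Definition ok B := [/\ small K B, range c `<=` B & B b].

Lemma okU1 B a : ok B -> ok (B `|` [set a]).
Proof.
move=> [sB cB bB]; split; [|by move=> x /cB; left|by left].
by apply: (smallU hK) => //; exact: small1.
Qed.

Lemma okU B A : ok B -> small K A -> ok (B `|` A).
Proof.
move=> [sB cB bB] sA; split; [|by move=> x /cB; left|by left].
exact: (smallU hK).
Qed.

(** * The type above all successors of [b] *)

Definition evt (P : C -> Prop) := exists m0, forall m, m0 <= m -> P (bs m).

Lemma evt_and P Q : evt P -> evt Q -> evt (fun x => P x /\ Q x).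
Proof.
move=> [m H] [n H']; exists (maxn m n) => k; rewrite geq_max => /andP[mk nk].
by split; [exact: H|exact: H'].
Qed.

Lemma limit A : small K A -> exists x, forall P, D1 A P -> evt P -> P x.
Proof.
move=> sA; have [||x xP] := @saturated1 _ _ _ _ hC A [set P | D1 A P /\ evt P] sA.
- by move=> P [].
- move=> s sF; have [m Hm] : evt (fun x => All (fun P : set C => P x) s).
    elim: s sF => [_|P s IH [[_ eP] /IH]]; first by exists 0.
    exact: evt_and.
  by exists (bs m); exact: Hm.
- by exists x => P dP eP; apply: xP.
Qed.

(** [lim B] is the set of realizations of the type over [B] just above [low]. *)
Definition lim B x := [/\ q x, ~ low x &
  forall J, D1 B J -> downset lt J -> (forall m, J (bs m)) -> J x].

Lemma evt_q th : D1 (range c) th -> th b -> evt th.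
Proof. by move=> dth thb; exists 0 => m _; by apply/(bs_q m dth). Qed.

Lemma lim_of_limit A B x : range c `<=` A -> range bs `<=` A -> B `<=` A ->
  (forall P, D1 A P -> evt P -> P x) -> lim B x.
Proof.
move=> cA bA BA H; split.
- apply: same_half => th dth thb; apply: H; first exact: D1_mono dth.
  exact: evt_q.
- apply/not_low => m; apply: H.
    apply: D2_at (D2_lt _ _) (Trm_par _ _) (Trm_var _ _); apply: bA; by exists m.
  by exists m.+1 => n; exact: bs_lt.
- by move=> J dJ _ Jb; apply: H; [exact: D1_mono dJ|exists 0].
Qed.

Lemma small_bs : small K (range bs).
Proof. by apply: small_image; exact: hK.1. Qed.

Lemma lim_neq0 B : ok B -> exists x, lim B x.
Proof.
move=> [sB cB bB]; have [|x xP] := @limit (B `|` range bs).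
  by apply: (smallU hK) => //; exact: small_bs.
exists x; apply: (lim_of_limit _ _ _ xP) => y; [by move=> /cB; left|by right|by left].
Qed.

Lemma lim_mono B B' x : B `<=` B' -> lim B' x -> lim B x.
Proof. by move=> sB [qx nx H]; split=> // J dJ; apply: H; exact: D1_mono dJ. Qed.

Lemma lim_initial B x y : lim B x -> q y -> ~ low y -> y <=% x -> lim B y.
Proof.
move=> [qx nx H] qy ny yx; split=> // J dJ dnJ Jb; exact: downset_le dnJ (H _ dJ dnJ Jb) yx.
Qed.

Lemma q_same0 x : q x -> same set0 b x.
Proof. by apply: same_mono. Qed.

(** Completeness of the limit type: by [cut_family] a set over [B] is determined on the locus by
    cuts over [B], and such a cut either contains all [bs m], hence [lim B], or stays within
    [low]. *)
Lemma lim_same B x y : lim B x -> lim B y -> same B x y.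
Proof.
move=> [qx nx Hx] [qy ny Hy] Y dY; have [Js [hJs HJs]] := cut_family hlt b dY.
apply: HJs; [exact: q_same0|exact: q_same0|].
elim: Js hJs => //= J Js IH [[dJ dnJ] /IH]; split=> //.
have [Jb|/existsNP[m nJ]] := pselect (forall m, J (bs m)).
  by split=> _; [exact: Hy|exact: Hx].
have no z : ~ low z -> ~ J z by move=> /not_low/(_ m) h Jz; apply: nJ; exact: dnJ Jz h.
by split=> Jz; exfalso; exact: no Jz.
Qed.

(** The finitely many cuts are treated one at a time. A cut containing all [bs m] reaches beyond
    [low], and [e] is lowered into it; a cut missing some [bs m] is left behind by raising [m0]. *)
Lemma eventually_const A Y : D1 A Y -> small K A -> exists m0 e,
  [/\ q e, ~ low e & forall x, q x -> bs m0 <=% x -> x <=% e -> (Y x <-> Y (bs m0))].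
Proof.
move=> dY sA; have [Js [hJs HJs]] := cut_family hlt b dY.
suff [m0 [e [qe ne He]]] : exists m0 e, [/\ q e, ~ low e &
    forall x, q x -> bs m0 <=% x -> x <=% e -> atom Js x (bs m0)].
  exists m0, e; split=> // x qx mx xe; apply: HJs; [exact: q_same0| |exact: He].
  by apply: q_same0; exact: bs_q.
elim: Js hJs {HJs} => [_|J Js IH /= [[dJ dnJ] /IH[m0 [e [qe ne He]]]]].
  have [|x xP] := @limit (range c `|` range bs).
    by apply: (smallU hK); [exact: (range_small hC)|exact: small_bs].
  have [qx nx _] := @lim_of_limit _ set0 x (@subsetUl _ _ _) (@subsetUr _ _ _) (@sub0set _ _) xP.
  by exists 0, x.
have trans m x : m0 <= m -> q x -> bs m <=% x -> x <=% e -> atom Js x (bs m).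
  move=> mm qx mx xe; apply: (@atom_trans _ _ _ (bs m0)).
    rewrite -[bs m0 in X in atom _ X _]/(bs m0).
    have := He (bs m0) (bs_q _) (le_refl _ _) _.
    have h : bs m0 <=% e by right; exact: (proj1 (not_low e) ne).
    move=> /(_ h) _; have := He x qx (le_tr hlt (bs_le mm) mx) xe.
    rewrite /atom; elim: (Js) => //= D Ds IH2 [Dx Dxs]; split; [by rewrite Dx|exact: IH2].
  have h : bs m <=% e by right; exact: (proj1 (not_low e) ne).
  have := He (bs m) (bs_q _) (bs_le mm) h.
  rewrite /atom; elim: (Js) => //= D Ds IH2 [Dx Dxs]; split; [by rewrite Dx|exact: IH2].
have [Jb|/existsNP[m nJ]] := pselect (forall m, J (bs m)).
  pose A' := A `|` (range c `|` range bs).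
  have [|x xP] := @limit A'.
    by apply: (smallU hK) => //; apply: (smallU hK); [exact: range_small hC _ _|exact: small_bs].
  have [qx nx Jx] : lim A x.
    by apply: (lim_of_limit _ _ _ xP) => y; [right; left|right; right|left].
  have {}Jx := Jx _ dJ dnJ Jb.
  have [e' [qe' ne' e'e e'x]] : exists e', [/\ q e', ~ low e', e' <=% e & e' <=% x].
    case: (le_or_lt hlt e x) => h; first by exists e; split=> //; left.
    by exists x; split=> //; [right|left].
  exists m0, e'; split=> // y qy my ye; split; last exact: trans (le_tr hlt ye e'e).
  by split=> _; [exact: Jb|apply: downset_le dnJ Jx _; exact: (le_tr hlt ye e'x)].
exists (maxn m0 m), e; split=> // y qy my ye; split; last by apply: trans => //; exact: leq_maxl.
have no z : bs m <=% z -> ~ J z by move=> h Jz; apply: nJ; exact: downset_le dnJ Jz h.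
have h := bs_le (leq_maxr m0 m).
split=> Jz; exfalso; [apply: no Jz; exact: (le_tr hlt h my)|exact: no Jz].
Qed.

Lemma evt_dec A Y : D1 A Y -> small K A -> evt Y \/ evt (fun x => ~ Y x).
Proof.
move=> dY sA; have [m0 [e [qe ne H]]] := eventually_const dY sA.
have H' m : m0 <= m -> Y (bs m) <-> Y (bs m0).
  by move=> mm; apply: H; [exact: bs_q|exact: bs_le|right; exact: (proj1 (not_low e) ne)].
by case: (pselect (Y (bs m0))) => Y0; [left|right]; exists m0 => m /H' ->.
Qed.

(** Truth in the limit type is truth at almost all [bs m]. This moves statements to the discrete
    sequence, where one can argue by the index. *)
Lemma lim_evt B x Y : ok B -> lim B x -> D1 B Y -> (Y x <-> evt Y).
Proof.
move=> [sB cB bB] Bx dY; have [|y yP] := @limit (B `|` range bs).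
  by apply: (smallU hK) => //; exact: small_bs.
have By : lim B y.
  by apply: (lim_of_limit _ _ _ yP) => z; [move=> /cB; left|right|left].
have lft Z : D1 B Z -> evt Z -> Z y by move=> dZ; apply: yP; apply: D1_mono dZ; left.
rewrite (lim_same Bx By dY); split=> [Yy|]; last exact: lft.
by have [//|nY] := evt_dec dY sB; case: (lft _ (Dfn_not dY) nY).
Qed.

(** An automorphism fixing [c] and [b] may move the other [bs m], but it respects adjacency and
    therefore keeps their classes. *)
Lemma low_autom s x : autom (range c) s -> s b = b -> low x -> low (s x).
Proof.
move=> As sb.
have Rb m : R (bs m) (s (bs m)).
  elim: m => [|m IH]; first by rewrite /bs /= sb; exact: Rrefl.
  exact: adjacent_unique (bs_adj m) (adjacent_autom hE As (bs_adj m)) IH.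
move=> [m xm]; exists m.+1; have [_ _ ltm nR _] := bs_adj m.
apply: (lt_tr hlt _ (Rsep (Rb m) (Rrefl _) nR ltm)).
by rewrite -(autom_lt _ _ _ As).
Qed.

Lemma ok_autom B s : ok B -> autom B s -> autom (range c) s /\ s b = b.
Proof. by move=> [_ cB bB] As; split; [exact: autom_sub As|case: As => _; exact]. Qed.

Lemma lim_iso B x s : autom (range c) s -> s b = b -> lim B x -> lim (s @` B) (s x).
Proof.
move=> As sb [qx nx H]; have [s' [As' sK s'K]] := autom_inv As.
have s'b : s' b = b by rewrite -{1}sb sK.
split; first exact: same_trans qx (autom_same _ As).
  by move=> /(low_autom As' s'b); rewrite sK.
move=> J dJ dnJ Jb; apply: (H (fun x => J (s x))); first exact: iso_Dfn As.1 dJ.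
  by move=> y z Jy zy; apply: dnJ Jy _; rewrite -(autom_lt _ _ _ As).
move=> m; have [n h] := low_autom As sb (low_bs m); exact: dnJ (Jb n) h.
Qed.

Lemma lim_autom B x s : ok B -> autom B s -> lim B x -> lim B (s x).
Proof.
move=> oB As; have [Ac sb] := ok_autom oB As.
move=> /(lim_iso Ac sb); apply: lim_mono => a Ba; exists a => //.
by case: As => _; apply.
Qed.

Lemma lim_autom1 B a x s : ok B -> autom B s -> lim (B `|` [set a]) x ->
  lim (B `|` [set s a]) (s x).
Proof.
move=> oB As; have [Ac sb] := ok_autom oB As.
move=> /(lim_iso Ac sb); apply: lim_mono => t [Bt|->]; last by exists a => //; right.
by exists t; [left|case: As => _; exact].
Qed.

(** If [y] were at most [bs m], later successors of [b] would fall into the gap between the adjacent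
    [y] and [x]. *)
Lemma lim_pred B x : ok B -> lim B x -> exists y, lim B y /\ adjacent lt q R y x.
Proof.
move=> oB Bx; have [qx nx _] := Bx; have [_ hp] := hd; have [y ay] := hp _ qx.
have [qy _ yx nR Hyx] := ay.
exists y; split=> //; apply: (lim_initial Bx qy) => [|]; last by right.
apply/not_low => m; have [_ qm mm nRm Hm] := bs_adj m.
have mx : bs m.+1 <% x by exact: (proj1 (not_low x) nx).
have mx' : bs m.+2 <% x by exact: (proj1 (not_low x) nx).
case: (le_or_lt hlt y (bs m)) => // ym.
have [_ _ lt1 nR1 _] := bs_adj m.+1.
exfalso; have [ymm|eq] : y <% bs m \/ y = bs m by case: ym; [right|left].
  have [h|h] := Hyx _ (bs_q m) ymm (lt_tr hlt mm mx).
    have [h'|h'] := Hyx _ (bs_q m.+1) (lt_tr hlt ymm mm) mx.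
      by apply: nRm; exact: Rtrans (Rsym h) h'.
    apply: nR1; apply: Rconvex h' _ _; exact: lt_le.
  apply: nRm; apply: Rconvex h _ _; exact: lt_le.
have ym1 : y <% bs m.+1 by rewrite eq.
have [h|h] := Hyx _ (bs_q m.+1) ym1 mx.
  by apply: nRm; rewrite -eq.
apply: nR1; apply: Rconvex h _ _; exact: lt_le.
Qed.

Lemma lim_succ B x : ok B -> lim B x -> exists y, lim B y /\ adjacent lt q R x y.
Proof.
move=> oB Bx; have [sB cB bB] := oB; have [y [By ay]] := lim_pred oB Bx.
have [s [As sy]] := same_autom hC sB (lim_same By Bx).
exists (s x); split; first exact: lim_autom.
have [Ac _] := ok_autom oB As.
by rewrite -{1}sy; exact: (adjacent_autom hE Ac).
Qed.

Lemma autom_comp A s s' : autom A s -> autom A s' -> autom A (s' \o s).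
Proof.
move=> [[sb sf sr] sA] [[s'b s'f s'r] s'A]; split; last by move=> a Aa /=; rewrite sA // s'A.
split; first exact: bij_comp.
  by move=> f a /=; rewrite sf s'f.
by move=> r a; rewrite sr s'r.
Qed.

(** A uniform family of cuts that reach beyond [low] at each [a] of the limit type. If [x] is not
    generic over [B] and [a], such a family witnesses it ([not_lim_par]). *)
Definition cofinal_cut B (H : C -> C -> Prop) :=
  [/\ D2 B H, forall a, downset lt (H a) & forall a, lim B a -> forall m, H a (bs m)].

Lemma cofinal_transfer B H a a' : ok B -> D2 B H -> (forall a, downset lt (H a)) ->
  lim B a -> lim B a' -> (forall m, H a (bs m)) -> forall m, H a' (bs m).
Proof.
move=> oB dH dnH Ba Ba' Hb m; have [sB _ _] := oB.
have [s [As <-]] := same_autom hC sB (lim_same Ba Ba').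
have [s' [As' sK s'K]] := autom_inv As; have [Ac' s'b] := ok_autom oB As'.
have [n h] := low_autom Ac' s'b (low_bs m).
by rewrite -(s'K (bs m)) -(autom_D2 _ _ As dH); apply: dnH (Hb n) h.
Qed.

Lemma lim_par B a J : ok B -> lim B a -> D1 (B `|` [set a]) J -> downset lt J ->
  (forall m, J (bs m)) -> exists H, cofinal_cut B H /\ forall x, J x <-> H a x.
Proof.
move=> oB Ba dJ dnJ Jb; have [H [dH dnH HJ]] := D1_par_downset dJ dnJ.
exists H; split=> //; split=> // a' Ba'; apply: (cofinal_transfer oB dH dnH Ba Ba') => m.
exact/HJ.
Qed.

Lemma not_lim_par B a x : ok B -> lim B a -> lim B x -> ~ lim (B `|` [set a]) x ->
  exists H, cofinal_cut B H /\ ~ H a x.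
Proof.
move=> oB Ba [qx nx _] nl; apply: contrapT => no; apply: nl; split=> // J dJ dnJ Jb.
have [H [cH HJ]] := lim_par oB Ba dJ dnJ Jb.
by apply/HJ; apply: contrapT => nH; apply: no; exists H.
Qed.

Lemma lim_lt B a x : ok B -> lim B a -> lim (B `|` [set a]) x -> x <% a.
Proof.
move=> oB [_ na _] [_ _ H]; apply: (H (fun x => x <% a)).
- by apply: D2_at (D2_lt _ _) (Trm_var _ _) (Trm_par _ _); right.
- by move=> x' y xa yx; exact: (lt_tr hlt yx xa).
- exact/not_low.
Qed.

Lemma lim_sub1 B a x : lim (B `|` [set a]) x -> lim B x.
Proof. by apply: lim_mono => y; left. Qed.

(** As [a] moves up through the limit type, its cut finally passes any given [y]. Otherwise
    [no_alternation] makes [H a y] fail for all [a] beyond some [e0]. But an element [y1] generic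
    over [y] satisfies [H y y1], and an automorphism moving [y1] above [y] and [e0] produces a
    larger [a] with [H a y]. *)
Lemma cofinal_cut_tail B H y : ok B -> cofinal_cut B H -> lim B y ->
  exists e, lim B e /\ forall a, lim B a -> e <% a -> H a y.
Proof.
move=> oB [dH dnH Hb] By; have [sB cB bB] := oB; apply: contrapT => no.
have unb e : lim B e -> exists a, [/\ lim B a, e <% a & ~ H a y].
  move=> Be; apply: contrapT => na; apply: no; exists e; split=> // a Ba ea.
  by apply: contrapT => nH; apply: na; exists a.
have [e0 [Be0 He0]] : exists e0, lim B e0 /\ forall a, lim B a -> e0 <% a -> ~ H a y.
  apply: contrapT => no'; apply: (@no_alternation _ _ _ hlt (B `|` [set y])
      (fun a => H a y) b (lim B) y _ By).
    apply: D2_at (Trm_var _ _) (Trm_par _ _); last by right.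
    by apply: D2_mono dH; left.
  move=> w Bw; split; first by case: Bw => qw _ _; exact: (q_same0 qw).
  case: (pselect (H w y)) => Hw.
    by have [a [Ba wa na]] := unb _ Bw; exists a; split=> //; tauto.
  apply: contrapT => na; apply: no'; exists w; split=> // a Ba wa Ha; apply: na.
  by exists a; split=> //; tauto.
have [y' [By' yy' ey']] : exists y', [/\ lim B y', y <=% y' & e0 <=% y'].
  case: (le_or_lt hlt y e0) => h; first by exists e0; split=> //; left.
  by exists y; split=> //; [left|right].
have [y1 By1] := lim_neq0 (okU1 y oB).
have Hy : H y y1.
  have [_ _ h] := By1; apply: h; [exact: D1_of_D2|exact: dnH|exact: Hb].
have y1y := lim_lt oB By By1.
have [s [As sy1]] := same_autom hC sB (lim_same (lim_sub1 By1) By').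
have Bsy : lim B (s y) by exact: lim_autom.
apply: (He0 (s y) Bsy).
  by apply: (le_lt_trans hlt ey'); rewrite -sy1 -(autom_lt _ _ _ As).
apply: (downset_le (dnH (s y)) _ yy'); rewrite -sy1.
by rewrite -(autom_D2 _ _ As dH).
Qed.

Lemma top_limit B A : ok B -> small K A -> exists a, forall P, D1 A P ->
  (exists e, lim B e /\ forall a, lim B a -> e <% a -> P a) -> P a.
Proof.
move=> oB sA; have [||x xP] := @saturated1 _ _ _ _ hC A
    [set P | D1 A P /\ exists e, lim B e /\ forall a, lim B a -> e <% a -> P a] sA.
- by move=> P [].
- move=> s sF; have [e [Be He]] : exists e, lim B e /\
      forall a, lim B a -> e <% a -> All (fun P : set C => P a) s.
    elim: s sF => [_|P s IH [[_ [e [Be He]]] /IH[e' [Be' He']]]].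
      by have [e Be] := lim_neq0 oB; exists e.
    have [ee'|e'e] := le_or_lt hlt e e'.
      exists e'; split=> // a Ba e'a; split; last exact: He'.
      by apply: He => //; exact: (le_lt_trans hlt ee' e'a).
    exists e; split=> // a Ba ea; split; first exact: He.
    by apply: He' => //; exact: (lt_tr hlt e'e ea).
  have [a [Ba [_ _ ea _ _]]] := lim_succ oB Be; exists a; exact: He.
- by exists x => P dP eP; apply: xP.
Qed.

(** Saturation provides [a] near the upper end of the limit type, where by [cofinal_cut_tail] each
    of the cuts in question has passed [y]. *)
Lemma lim_far B y e : ok B -> lim B y -> lim B e ->
  exists a, [/\ lim B a, e <% a & lim (B `|` [set a]) y].
Proof.
move=> oB By Be; have [sB cB bB] := oB.
pose A := (B `|` range bs) `|` ([set y] `|` [set e]).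
have [|a aP] := @top_limit B A oB.
  by apply: (smallU hK); apply: (smallU hK) => //; first [exact: small_bs|exact: small1].
have BA : B `<=` A by move=> z; left; left.
have ea : e <% a.
  apply: aP; last by exists e.
  by apply: D2_at (D2_lt _ _) (Trm_par _ _) (Trm_var _ _); right; right.
have Ba : lim B a.
  split.
  - apply: same_half => th dth thb; apply: aP.
      by apply: D1_mono dth => z /cB/BA.
    by exists e; split=> // a' [qa _ _] _; exact/(qa _ dth).
  - apply/not_low => m; apply: aP.
      by apply: D2_at (D2_lt _ _) (Trm_par _ _) (Trm_var _ _); left; right; exists m.
    by exists e; split=> // a' [_ /not_low na _] _; exact: na.
  - move=> J dJ dnJ Jb; apply: aP; first exact: D1_mono dJ.
    by exists e; split=> // a' [_ _ h] _; exact: h.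
exists a; split=> //; have [qy ny _] := By; split=> // J dJ dnJ Jb.
have [H [cH HJ]] := lim_par oB Ba dJ dnJ Jb; apply/HJ.
apply: (aP (fun a => H a y)); last exact: cofinal_cut_tail.
apply: D2_at (Trm_var _ _) (Trm_par _ _); last by right; left.
by case: cH => dH _ _; exact: D2_mono BA dH.
Qed.

Lemma lim_pair B d1 d2 x1 x2 : ok B -> lim B d1 -> lim B d2 ->
  lim (B `|` [set d1]) x1 -> lim (B `|` [set d2]) x2 ->
  exists s, [/\ autom B s, s d1 = d2 & s x1 = x2].
Proof.
move=> oB B1 B2 Bx1 Bx2; have [sB cB bB] := oB.
have [s [As sd]] := same_autom hC sB (lim_same B1 B2).
have Bsx : lim (B `|` [set d2]) (s x1) by rewrite -sd; exact: lim_autom1.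
have [sB2 _ _] := okU1 d2 oB.
have [s' [As' s'x]] := same_autom hC sB2 (lim_same Bsx Bx2).
exists (s' \o s); split=> //; last by rewrite /= sd; case: As' => _; apply; right.
by apply: autom_comp As _; apply: autom_sub As' => z; left.
Qed.

(** The pairs [(e, x)] and [(a, x)] with [a] far up are conjugate. The conjugation fixes [x] and
    takes [t] at least as high as [a], where the cut that should exclude [x] has already passed
    it. *)
Lemma lim_up B x e t : ok B -> lim B e -> lim B t -> e <=% t ->
  lim (B `|` [set e]) x -> lim (B `|` [set t]) x.
Proof.
move=> oB Be Bt et Bx; apply: contrapT => nl.
have [H [cH nH]] := not_lim_par oB Bt (lim_sub1 Bx) nl.
have [e1 [Be1 He1]] := cofinal_cut_tail oB cH (lim_sub1 Bx).
have [a [Ba e1a ax]] := lim_far oB (lim_sub1 Bx) Be1.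
have [s [As se sx]] := lim_pair oB Be Ba Bx ax.
apply: nH; have [dH _ _] := cH; rewrite (autom_D2 _ _ As dH) sx.
apply: He1; first exact: lim_autom.
apply: (lt_le_trans hlt e1a); rewrite -se; case: et => [->|et]; first by left.
by right; rewrite -(autom_lt _ _ _ As).
Qed.

(** Move [(e, x)] far up as in [lim_up]. The image of [v] is either high enough for its cut to pass
    [x], or so low that the cut of the image of [e] passes it. *)
Lemma lim_split B x e v : ok B -> lim B e -> lim B v -> lim (B `|` [set e]) x ->
  lim (B `|` [set v]) x \/ lim (B `|` [set e]) v.
Proof.
move=> oB Be Bv ex; have Bx := lim_sub1 ex.
apply: contrapT => /not_orP[nx nv].
have [H' [cH' nH']] := not_lim_par oB Bv Bx nx.
have [H [cH nH]] := not_lim_par oB Be Bv nv.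
have [e1 [Be1 He1]] := cofinal_cut_tail oB cH' Bx.
have [e2 [Be2 He2]] := cofinal_cut_tail oB cH Be1.
have [e' [Be' e2e' ex']] := lim_far oB Bx Be2.
have [s [As se sx]] := lim_pair oB Be Be' ex ex'.
have [dH dnH _] := cH; have [dH' _ _] := cH'.
apply: nH'; rewrite (autom_D2 _ _ As dH') sx; apply: He1; first exact: lim_autom.
case: (le_or_lt hlt (s v) e1) => // h; exfalso; apply: nH.
rewrite (autom_D2 _ _ As dH) se; apply: (downset_le (dnH e')) h.
exact: He2.
Qed.

(** Adjacency refers to all of [q]. By compactness one formula of [q] already leaves nothing between
    the classes of [bs 0] and [bs 1], and homogeneity extends this to all adjacent pairs; so
    adjacency has the definable consequence [near]. *)
Lemma gap_formula : exists th, [/\ D1 (range c) th, th b &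
  forall x y t, adjacent lt q R x y -> th t -> x <% t -> t <% y -> R x t \/ R t y].
Proof.
have [_ q1 ltb nRb Hb] := bs_adj 0.
pose A := range c `|` ([set bs 0] `|` [set bs 1]).
have cA : range c `<=` A by move=> z; left.
have A0 : A (bs 0) by right; left.
have A1 : A (bs 1) by right; right.
have dR := D2_R cA; have dl := @D2_lt _ _ lt A.
have [|||||th [dth thb Hth]] := @type_compact _ _ _ _ hC (range c) A unit b
    (fun v => bs 0 <% v tt -> v tt <% bs 1 -> R (bs 0) (v tt) \/ R (v tt) (bs 1)).
- by apply: (smallU hK); [exact: (range_small hC)|apply: (smallU hK); exact: small1].
- exact: cA.
- by apply: (small_countable hK); exact: countableP.
- apply: Dfn_imp; first exact: D2_at dl (Trm_par _ A0) (Trm_var _ _).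
  apply: Dfn_imp; first exact: D2_at dl (Trm_var _ _) (Trm_par _ A1).
  by apply: Dfn_or; [exact: D2_at dR (Trm_par _ A0) (Trm_var _ _)|
    exact: D2_at dR (Trm_var _ _) (Trm_par _ A1)].
- by move=> v qv; exact: Hb (qv tt).
exists th; split=> // x y t axy tht xt ty.
have [qx qy xy nR H] := axy.
have sc : small K (range c) by exact: (range_small hC).
have [s [As sx]] := same_autom hC sc qx.
have Es := eqfam_autom_range _ _ hE As.
have [s' [As' sK s'K]] := autom_inv As.
have asy : adjacent lt q R x (s (bs 1)).
  by have -> : x = s (bs 0) by []; exact: (adjacent_autom hE As (bs_adj 0)).
have Ry := adjacent_unique axy asy (Rrefl x).
have [nxt|nxt] := pselect (R x t); first by left.
right; apply: contrapT => nRty.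
have nRt : ~ R t (s (bs 1)) by move=> h; apply: nRty; exact: Rtrans h (Rsym Ry).
have ty' : t <% s (bs 1) by exact: Rsep (Rrefl t) Ry nRty ty.
have [] := Hth (fun=> s' t).
- by move=> _; rewrite (autom_D1 _ As dth) s'K.
- by rewrite (autom_lt _ _ _ As) s'K; have -> : s (bs 0) = x by [].
- by rewrite (autom_lt _ _ _ As) s'K.
- by rewrite Es s'K; have -> : s (bs 0) = x by [].
- by rewrite Es s'K.
Qed.

Lemma nat_step (P : nat -> Prop) m : P 0 -> ~ P m -> exists k, P k /\ ~ P k.+1.
Proof.
move=> P0 nP; apply: contrapT => no; apply: nP; elim: m => // m Pm.
by apply: contrapT => nP; apply: no; exists m.
Qed.

Definition gth : C -> Prop := sval (cid gap_formula).

Lemma gth_D1 A : range c `<=` A -> D1 A gth.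
Proof. by move=> cA; have [dth _ _] := svalP (cid gap_formula); exact: D1_mono dth. Qed.

Lemma gth_q x : q x -> gth x.
Proof. by have [dth thb _] := svalP (cid gap_formula); move=> qx; exact/(qx _ dth). Qed.

Lemma gthP x y t : adjacent lt q R x y -> gth t -> x <% t -> t <% y -> R x t \/ R t y.
Proof. by have [_ _ H] := svalP (cid gap_formula); exact: H. Qed.

Definition near x y := x <% y /\ forall t, gth t -> x <% t -> t <% y -> R x t \/ R t y.

Lemma near_D2 A : range c `<=` A -> D2 A near.
Proof.
move=> cA; have dR := D2_R cA; have dg := gth_D1 cA.
apply: Dfn_and; first exact: D2_at (D2_lt _ _) (Trm_var _ _) (Trm_var _ _).
apply: Dfn_all; apply: Dfn_imp; first exact: D1_at dg (Trm_var _ _).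
apply: Dfn_imp; first exact: D2_at (D2_lt _ _) (Trm_var _ _) (Trm_var _ _).
apply: Dfn_imp; first exact: D2_at (D2_lt _ _) (Trm_var _ _) (Trm_var _ _).
by apply: Dfn_or; exact: D2_at dR (Trm_var _ _) (Trm_var _ _).
Qed.

Lemma adjacent_near x y : adjacent lt q R x y -> near x y.
Proof. by move=> a; have [_ _ xy _ _] := a; split=> // t; exact: gthP. Qed.

(** A definable upper end would be given by a cut [H e]. Along [bs] such a cut ends between two
    consecutive terms, so by [lim_evt] the cut at [e] also ends between two near elements, whereas
    the limit type has no last class. *)
Lemma no_definable_sup B e A J : ok B -> lim B e -> small K A -> D1 A J ->
  (forall x, q x -> (J x <-> low x \/ lim (B `|` [set e]) x)) -> False.
Proof.
move=> oB Be sA dJ HJ; have [sB cB bB] := oB; have oBe := okU1 e oB.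
have [sBe cBe bBe] := oBe; have [qe ne _] := Be.
(* Compactness replaces [J], whose parameters are arbitrary, by a cut over [B] and [e] with the same
   trace on the locus. *)
pose G : set (set (unit -> C)) := [set P | exists th J', [/\ D1 (range c) th, th b,
  D1 (B `|` [set e]) J', downset lt J' /\ (forall m, J' (bs m)) &
  P = [set v | th (v tt) /\ J' (v tt)]]].
have [|||||||P [th [J' [dth thb dJ' [dnJ' Jb'] ->]]] HP] := @compact_closed _ _ _ _ hC
    (A `|` (B `|` [set e])) unit G (fun v => J (v tt)).
- exact: (smallU hK).
- by apply: (small_countable hK); exact: countableP.
- move=> _ [th [J' [dth thb dJ' _ ->]]]; apply: Dfn_and; apply: D1_at (Trm_var _ _).
    by apply: D1_mono dth => x /cBe; right.
  by apply: D1_mono dJ'; right.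
- by apply: D1_at (Trm_var _ _); apply: D1_mono dJ; left.
- exists [set v | True /\ True], (fun=> True), (fun=> True).
  by split=> //; exact: Dfn_True.
- move=> _ _ [th [J' [dth thb dJ' [dnJ' Jb'] ->]]] [th1 [J1 [dth1 thb1 dJ1 [dnJ1 Jb1] ->]]].
  exists [set v | (th (v tt) /\ th1 (v tt)) /\ (J' (v tt) /\ J1 (v tt))].
    exists (fun x => th x /\ th1 x), (fun x => J' x /\ J1 x).
    split=> //; [exact: Dfn_and|exact: Dfn_and|split=> //].
    by move=> x y [? ?] yx; split; [exact: dnJ' yx|exact: dnJ1 yx].
  by move=> v [[? ?] [? ?]].
- move=> v Gv.
  have qv : q (v tt).
    apply: same_half => th dth thb.
    have [] // := Gv [set v | th (v tt) /\ True].
    by exists th, (fun=> True); split=> //; exact: Dfn_True.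
  apply/(HJ _ qv); have [lv|nlv] := pselect (low (v tt)); [by left|right].
  split=> // J' dJ' dnJ' Jb'.
  have [] // := Gv [set v | True /\ J' (v tt)].
  by exists (fun=> True), J'; split=> //; exact: Dfn_True.
have {}HJ x : q x -> (J' x <-> low x \/ lim (B `|` [set e]) x).
  move=> qx; split=> [J'x|[[m xm]|[_ _ h]]].
  - apply/(HJ _ qx); apply: (HP (fun=> x)); split=> //; exact/(qx _ dth).
  - exact: dnJ' (Jb' m) xm.
  - exact: h.
have [H [[dH dnH Hb] HH]] := lim_par oB Be dJ' dnJ' Jb'.
have {}HJ x : q x -> (H e x <-> low x \/ lim (B `|` [set e]) x).
  by move=> qx; rewrite -HH; exact: HJ.
have dHb : D1 B (fun a => H a b) by apply: D2_at dH (Trm_var _ _) (Trm_par _ _).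
have dHa : D1 B (fun a => ~ H a a) by apply: Dfn_not; exact: D2_at dH (Trm_var _ _) (Trm_var _ _).
have evb : evt (fun a => H a b).
  by apply/(lim_evt oB Be dHb)/(HJ _ (bs_q 0)); left; exact: (low_bs 0).
have eva : evt (fun a => ~ H a a).
  apply/(lim_evt oB Be dHa) => Hee; have [//|le] := proj1 (HJ _ qe) Hee.
  exact: (lt_irr hlt (lim_lt oB Be le)).
have [m0 Hm] := evt_and evb eva.
(* At a late term, [H (bs m)] contains [b] but not [bs m], so it ends between consecutive terms;
   [lim_evt] transfers the existence of such a pair to [e]. *)
have cut th1 : D1 (range c) th1 -> th1 b ->
    exists u w, (th1 u /\ th1 w) /\ ((H e u /\ ~ H e w) /\ near u w).
  move=> dth1 thb1.
  pose S a := exists u w, (th1 u /\ th1 w) /\ ((H a u /\ ~ H a w) /\ near u w).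
  suff : S e by [].
  have dS : D1 B S.
    apply: Dfn_ex; apply: Dfn_ex; apply: Dfn_and.
      by apply: Dfn_and; apply: D1_at (Trm_var _ _); apply: D1_mono dth1.
    apply: Dfn_and; last by apply: D2_at (near_D2 _) (Trm_var _ _) (Trm_var _ _).
    apply: Dfn_and; first exact: D2_at dH (Trm_var _ _) (Trm_var _ _).
    by apply: Dfn_not; exact: D2_at dH (Trm_var _ _) (Trm_var _ _).
  apply/(lim_evt oB Be dS); exists m0 => m /Hm[Hb0 Hm'].
  have [k [Hk nHk]] := @nat_step (fun k => H (bs m) (bs k)) m Hb0 Hm'.
  exists (bs k), (bs k.+1); split; first by split; exact/(bs_q _ dth1).
  by split=> //; apply: adjacent_near; exact: bs_adj.
have [u [w [qu qw Hu nHw nuw]]] : exists u w, [/\ q u, q w, H e u, ~ H e w & near u w].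
  apply: contrapT => no.
  have [|||||rho [drho rb Hrho]] := @type_compact _ _ _ _ hC (range c) (B `|` [set e]) bool b
    (fun v => ~ ((H e (v true) /\ ~ H e (v false)) /\ near (v true) (v false))).
  - exact: sBe.
  - exact: cBe.
  - by apply: (small_countable hK); exact: countableP.
  - have ein : (B `|` [set e]) e by right.
    have dH' : D2 (B `|` [set e]) H by apply: D2_mono dH; left.
    apply: Dfn_not; apply: Dfn_and; last exact: D2_at (near_D2 cBe) (Trm_var _ _) (Trm_var _ _).
    apply: Dfn_and; first exact: D2_at dH' (Trm_par _ ein) (Trm_var _ _).
    by apply: Dfn_not; exact: D2_at dH' (Trm_par _ ein) (Trm_var _ _).
  - move=> v qv [[h1 h2] h3]; apply: no; exists (v true), (v false).
    by split=> //; exact: qv.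
  have [u [w [[ru rw] h]]] := cut _ drho rb.
  by apply: (Hrho (fun t : bool => if t then u else w)) => // -[].
have nw : ~ low w by move=> lw; apply: nHw; apply/(HJ _ qw); left.
have [uw Huw] := nuw.
have [lu|lu] : low u \/ lim (B `|` [set e]) u by exact/(HJ _ qu).
  have [m um] := lu; have [_ qm mm nRm _] := bs_adj m.
  have [_ _ mm2 nRm2 _] := bs_adj m.+1.
  have wm := (proj1 (not_low w) nw).
  have [h|h] := Huw _ (gth_q qm) (lt_tr hlt um mm) (wm _).
    have h' : R u (bs m) by apply: Rconvex h _ _; exact: lt_le.
    by apply: nRm; exact: Rtrans (Rsym h') h.
  apply: nRm2; apply: Rconvex h _ _; exact: lt_le.
(* An automorphism over [B] and [e] takes [u] two classes down and keeps [w] above the cut, so that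
   the class of [u1] lies strictly between two near elements. *)
have [u1 [lu1 [qu1 _ u1u nR1 _]]] := lim_pred oBe lu.
have [u2 [lu2 [_ _ u2u1 nR2 _]]] := lim_pred oBe lu1.
have [s [As su]] := same_autom hC sBe (lim_same lu lu2).
have [_ Hsuw] : near (s u) (s w) by rewrite -(autom_D2 u w As (near_D2 cBe)).
have uw' : u <% s w.
  apply: (downset_nlt hlt (dnH e)) => //.
  have -> : e = s e by case: As => _ ->; last right.
  by rewrite -(autom_D2 _ _ As (D2_mono (@subsetUl _ B [set e]) dH)).
have su1 : s u <% u1 by rewrite su.
have [h|h] := Hsuw _ (gth_q qu1) su1 (lt_tr hlt u1u uw').
  by apply: nR2; rewrite -su.
apply: nR1; apply: Rconvex h _ _; exact: lt_le.
Qed.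

(** * Independence of three elements of the limit type *)

Definition D3 A (P : C -> C -> C -> Prop) :=
  Dfn A (fun v : option bool -> C => P (v None) (v (Some true)) (v (Some false))).

Lemma D3_at A V (P : C -> C -> C -> Prop) (t u w : (V -> C) -> C) :
  D3 A P -> Trm A t -> Trm A u -> Trm A w -> Dfn A (fun v => P (t v) (u v) (w v)).
Proof.
move=> dP [s [sA ts]] [s' [s'A us]] [s2 [s2A ws]].
apply: Dfn_ext (Dfn_sub (f := fun o : option bool =>
  match o with None => s | Some true => s' | Some false => s2 end) _ dP).
  by move=> v /=; rewrite ts us ws.
by move=> [[]|].
Qed.

Lemma D3_mono A A' P : A `<=` A' -> D3 A P -> D3 A' P.
Proof. exact: Dfn_mono. Qed.

Hypothesis hr : finite_ranks C lt.

(** The limit type does not see [a] any more once [y] is realized below it: otherwise the cuts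
    defined from [y] and the realizations of the type of [a] over [y] would be pairwise
    distinct for infinitely many realizations and equal after moving [y] down, which makes
    the ranks infinite. *)
Lemma lim_absorb B a y t : ok B -> lim B a -> lim (B `|` [set a]) y ->
  lim (B `|` [set y]) t -> lim (B `|` [set a] `|` [set y]) t.
Proof.
move=> oB Ba Bay Byt; have [sB cB bB] := oB; have By := lim_sub1 Bay.
have [qt nlt _] := Byt; split=> // J dJ dnJ Jb; apply: contrapT => nJt.
have [|Q [dQ JQ]] := @Dfn_absorb _ C B _ unit _ (fun i : bool => if i then a else y) _ _ dJ.
  by move=> x [[Bx|->]|->]; [left|right; exists true|right; exists false].
(* The cut [J] as a relation in its parameters, closed downward for all of them and truncated so
   that it never contains [y'] itself. *)
pose psi a' y' x := (exists x', x <=% x' /\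
  Q (sumv (fun=> x') (fun i : bool => if i then a' else y'))) /\ x <% y'.
have dpsi : D3 B psi.
  apply: Dfn_and; last exact: D2_at (D2_lt _ _) (Trm_var _ _) (Trm_var _ _).
  apply: Dfn_ex; apply: Dfn_and; first exact: D2_at (D2_le _ _) (Trm_var _ _) (Trm_var _ _).
  apply: Dfn_ext (Dfn_ren (fun s : unit + bool => match s with inl _ => None
    | inr true => Some None | inr false => Some (Some true) end) dQ) => v.
  by split=> Qv; congr Q: Qv; apply/funext => -[[]|[]].
have dnpsi a' y' : downset lt (psi a' y').
  move=> x z [[x' [xx' Qx']] xy'] zx; split; last exact: (lt_tr hlt zx xy').
  by exists x'; split=> //; right; exact: (lt_le_trans hlt zx xx').
have JQ' x : J x <-> Q (sumv (fun=> x) (fun i : bool => if i then a else y)).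
  by rewrite (JQ (fun=> x)); split=> Qv; congr Q: Qv; apply/funext => -[].
have [qy /not_low ny _] := By.
have psib m : psi a y (bs m).
  by split; [exists (bs m); split; [left|exact/JQ']|exact: ny].
have npsi : ~ psi a y t.
  by move=> [[x' [tx' /JQ' Jx']] _]; apply: nJt; exact: downset_le dnJ Jx' tx'.
(* Keeping whole [R]-classes only makes a cut that ends between consecutive terms of [bs] depend on
   the index alone ([F_index]). *)
pose psh a' y' u := exists w, gth w /\ (u <=% w /\ forall w', R w w' -> psi a' y' w').
have dpsh : D3 B psh.
  apply: Dfn_ex; apply: Dfn_and; first exact: D1_at (gth_D1 cB) (Trm_var _ _).
  apply: Dfn_and; first exact: D2_at (D2_le _ _) (Trm_var _ _) (Trm_var _ _).
  apply: Dfn_all; apply: Dfn_imp; first exact: D2_at (D2_R cB) (Trm_var _ _) (Trm_var _ _).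
  exact: D3_at dpsi (Trm_var _ _) (Trm_var _ _) (Trm_var _ _).
have dnpsh a' y' : downset lt (psh a' y').
  by move=> x z [w [gw [xw Hw]]] zx; exists w; split=> //; split=> //; right;
    exact: (lt_le_trans hlt zx xw).
have psh_psi a' y' u : psh a' y' u -> psi a' y' u.
  by move=> [w [_ [uw Hw]]]; apply: (downset_le (dnpsi a' y')) uw; apply: Hw; exact: Rrefl.
have pshb m : psh a y (bs m).
  exists (bs m); split; first exact: (gth_q (bs_q _)).
  split=> [|w' Rw]; first by left.
  apply: dnpsi (psib m.+1) _; have [_ _ mm nR _] := bs_adj m.
  exact: Rsep Rw (Rrefl _) nR mm.
have npsh : ~ psh a y t by move/psh_psi.
have npsh_refl a' y' : ~ psh a' y' y' by move=> /psh_psi[_ /(lt_irr hlt)].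
pose F y' a1 a2 := forall u, psh a1 y' u <-> psh a2 y' u.
have dF : D3 B F.
  by apply: Dfn_all; apply: Dfn_iff; exact: D3_at dpsh (Trm_var _ _) (Trm_var _ _) (Trm_var _ _).
have F_index a1 a2 y' j : psh a1 y' (bs j) -> ~ psh a1 y' (bs j.+1) ->
    psh a2 y' (bs j) -> ~ psh a2 y' (bs j.+1) -> F y' a1 a2.
  have aj := bs_adj j.
  have key a' w : ~ psh a' y' (bs j.+1) -> gth w -> (forall w', R w w' -> psi a' y' w') ->
      w <% bs j \/ R (bs j) w.
    move=> nj gw Hw; have [?|->|jw] := lt_total hlt w (bs j); [by left|right; exact: Rrefl|right].
    have wj : w <% bs j.+1.
      case: (le_or_lt hlt (bs j.+1) w) => // h; case: nj; by exists w.
    have [//|Rwj] := gthP aj gw jw wj; case: nj.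
    exists (bs j.+1); split; first exact: (gth_q (bs_q _)).
    by split=> [|w' Rw']; [left|apply: Hw; exact: Rtrans Rwj Rw'].
  have half a1' a2' : ~ psh a1' y' (bs j.+1) -> psh a2' y' (bs j) -> ~ psh a2' y' (bs j.+1) ->
      forall u, psh a1' y' u -> psh a2' y' u.
    move=> n1 p2 n2 u [w [gw [uw Hw]]].
    have [wj|Rjw] := key _ _ n1 gw Hw.
      by apply: dnpsh p2 _; exact: (le_lt_trans hlt uw wj).
    have [w2 [gw2 [jw2 Hw2]]] := p2.
    have [w2j|Rjw2] := key _ _ n2 gw2 Hw2; first by case: (le_not_lt hlt jw2).
    exists w; split=> //; split=> // w' Rww'; apply: Hw2.
    exact: Rtrans (Rsym Rjw2) (Rtrans Rjw Rww').
  by move=> p1 n1 p2 n2 u; split; exact: half.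
pose D := B `|` [set y].
have oD : ok D by exact: okU1.
have [sD cD bD] := oD.
have BD : B `<=` D by move=> x; left.
have Dy : D y by right.
have dFy : D2 D (F y).
  by apply: D3_at (Trm_par _ Dy) (Trm_var _ _) (Trm_var _ _); exact: D3_mono dF.
(* If all conjugates of [a] over [B] and [y] give the same cut, it is definable without [a] and must
   contain [t]. *)
have [triv|ntriv] := pselect (forall a1 a2, same D a a1 -> same D a a2 -> F y a1 a2).
  have [|||||rho [drho ra Hrho]] := @type_compact _ _ _ _ hC D D bool a
      (fun v => F y (v true) (v false)).
  - exact: sD.
  - by [].
  - by apply: (small_countable hK); exact: countableP.
  - exact: dFy.
  - by move=> v Dv; exact: triv.
  have [_ _ h] := Byt; have [|||x [rx xt]] := h (fun u => exists x, rho x /\ psh x y u).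
  - apply: Dfn_ex; apply: Dfn_and; first exact: D1_at drho (Trm_var _ _).
    by apply: D3_at (Trm_var _ _) (Trm_par _ Dy) (Trm_var _ _); exact: D3_mono dpsh.
  - by move=> u v [x [rx xu]] vu; exists x; split=> //; exact: dnpsh xu vu.
  - by move=> m; exists a.
  apply: npsh; apply/(Hrho (fun i : bool => if i then a else x)) => //.
  by case.
have eF y' : equivalence_on [set: C] (F y').
  split=> [x _ u//|x1 x2 _ _ H u|x1 x2 x3 _ _ _ H H' u]; first by rewrite H.
  by rewrite H; exact: H'.
have eFr : equivalence_on [set x | same D a x] (F y).
  have [h1 h2 h3] := eF y; split=> [x _|x1 x2 _ _|x1 x2 x3 _ _ _]; [exact: h1|exact: h2|exact: h3].
have [_ Fsym Ftrans] := eF y.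
have [a1 [a2 [r1 r2 a12 nF]]] : exists a1 a2, [/\ same D a a1, same D a a2, a1 <% a2 & ~ F y a1 a2].
  apply: contrapT => no; apply: ntriv => a1 a2 r1 r2; apply: contrapT => nF; apply: no.
  have [h|h|h] := lt_total hlt a1 a2; first by exists a1, a2.
    by case: nF; rewrite h => u.
  by exists a2, a1; split=> // H; apply: nF; exact: Fsym.
have [s [As sa]] := same_autom hC sD (same_trans (same_sym r1) r2).
have sy : s y = y by case: As => _; apply.
have Fs x1 x2 : F y x1 x2 <-> F y (s x1) (s x2) by exact: autom_D2 As dFy.
(* Iterating the automorphism gives an infinite increasing sequence; its members are pairwise
   inequivalent because the classes of [F y] are convex on the locus. *)
pose f n := iter n s a1.
have rf n : same D a (f n) by elim: n => //= n IH; exact: same_trans IH (autom_same _ As).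
have f1 n : f n <% f n.+1.
  by elim: n => [|n IH]; [rewrite /f /= sa|rewrite /f /= -(autom_lt _ _ _ As)].
have nf n : ~ F y (f n) (f n.+1).
  elim: n => [|n IH]; first by rewrite /f /= sa.
  by rewrite /f /= -Fs.
have flt i j : i < j -> f i <% f j.
  elim: j => // j IH; rewrite ltnS leq_eqVlt => /orP[/eqP ->|/IH h]; first exact: f1.
  exact: (lt_tr hlt h (f1 _)).
have nF' i j : i < j -> ~ F y (f i) (f j).
  rewrite leq_eqVlt => /orP[/eqP <-|ij Fij]; first exact: nf.
  apply: (nf i); apply: (type_classes_convex hC hlt sD dFy eFr (rf i) (rf _) (rf j)) => //.
  exact: flt.
have [|||||A1 [sA1 bA1 A1r A1F]] := @many L C K T hC D D a (fun=> True) (F y) sD.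
- by [].
- exact: Dfn_True.
- exact: dFy.
- by move=> x u.
- move=> n; exists f; split=> [i _|i j _ _ ij]; first by split.
  case: (ltngtP i j) => [h|h|//]; first exact: nF'.
  by move=> H; apply: (nF' _ _ h); exact: Fsym.
have A1y a' : A1 a' -> lim B a' /\ lim (B `|` [set a']) y.
  move=> /A1r[r' _]; have [s1 [As1 <-]] := same_autom hC sD r'.
  have As1' := autom_sub BD As1.
  split; first exact: lim_autom.
  have e : s1 y = y by case: As1 => _; apply.
  by rewrite -e; exact: lim_autom1.
(* The cuts of [a'] below the terms of [bs] are described by a set of integers, which is constant on
   the [big] subset [A2]. *)
pose code a' : set nat := [set n | exists m j, n = pickle (m, j) /\ psh a' (bs m) (bs j)].
have [cd bA2] := big_pigeonhole code bA1.
pose A2 := A1 `&` [set x | code x = cd].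
have A2e a' : A2 a' -> evt (fun y' => psh a' y' b /\ ~ psh a' y' y').
  move=> [/A1y[Ba' Ba'y] _].
  have oBa := okU1 a' oB; have [_ _ bBa] := oBa.
  have BBa : B `<=` B `|` [set a'] by move=> x; left.
  have a'in : (B `|` [set a']) a' by right.
  have dp := D3_mono BBa dpsh.
  have dp1 : D1 (B `|` [set a']) (fun y' => psh a' y' b).
    exact: D3_at dp (Trm_par _ a'in) (Trm_var _ _) (Trm_par _ bBa).
  have dp2 : D1 (B `|` [set a']) (fun y' => ~ psh a' y' y').
    by apply: Dfn_not; exact: D3_at dp (Trm_par _ a'in) (Trm_var _ _) (Trm_var _ _).
  apply: evt_and; last by apply/(lim_evt oBa Ba'y dp2).
  apply/(lim_evt oBa Ba'y dp1).
  have [s1 [As1 s1a s1y]] := lim_pair oB Ba Ba' Bay Ba'y.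
  have s1b : s1 b = b by case: As1 => _; apply.
  have /= := autom_Dfn As1 dpsh (fun o : option bool => match o with None => a
    | Some true => y | Some false => b end).
  by rewrite s1a s1y s1b => <-; exact: (pshb 0).
have A2F x1 x2 : A2 x1 -> A2 x2 -> evt (fun y' => F y' x1 x2).
  move=> A2x1 A2x2; have [m0 Hm] := evt_and (A2e _ A2x1) (A2e _ A2x2).
  exists m0 => m /Hm[[p1 n1] [p2 n2]].
  have [j [pj nj]] := @nat_step (fun j => psh x1 (bs m) (bs j)) m p1 n1.
  have Ec : code x1 = code x2 by case: A2x1 => _ /= ->; case: A2x2 => _ /= ->.
  have tr k : psh x1 (bs m) (bs k) <-> psh x2 (bs m) (bs k).
    have H x : psh x (bs m) (bs k) <-> code x (pickle (m, k)).
      split=> [h|[m' [k' [/(pcan_inj pickleK)[-> ->] //]]]]; by exists m, k.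
    by rewrite !H Ec.
  by apply: (F_index _ _ _ j) => //; rewrite -?tr.
have sA2 : small K A2 by apply: small_sub sA1 => x [].
have oB2 : ok (B `|` A2) by exact: okU.
(* Over [A2] a generic [y'] sees equal cuts for all elements of [A2], since they are equal at almost
   all terms of [bs]. *)
have [y' By'] := lim_neq0 oB2.
have Fy' x1 x2 : A2 x1 -> A2 x2 -> F y' x1 x2.
  move=> A2x1 A2x2; have [i1 i2] : (B `|` A2) x1 /\ (B `|` A2) x2 by split; right.
  have dF2 : D1 (B `|` A2) (fun y' => F y' x1 x2).
    apply: D3_at (Trm_var _ _) (Trm_par _ i1) (Trm_par _ i2).
    by apply: D3_mono dF => x; left.
  by apply/(lim_evt oB2 By' dF2); exact: A2F.
have lim1 x : A2 x -> lim B x /\ lim (B `|` [set x]) y'.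
  move=> A2x; split; first by case: A2x => /A1y[].
  by apply: lim_mono By' => z [Bz|->]; [left|right].
(* Without a first and a last element, each class of [E1 z0] is enclosed between two elements of
   [A2], hence contained in the class of [a0] for the conjugate parameters. *)
pose A3 := A2 `&` [set x | exists lo hi, [/\ A2 lo, A2 hi, lo <% x & x <% hi]].
have bA3 : big A3.
  have bA4 : big (A2 `&` [set x | exists2 lo, A2 lo & lo <% x]).
    have [[m [A2m Hm]]|nm] := pselect (exists m, A2 m /\ forall x, A2 x -> m <=% x).
      apply: big_sub (big_D1 (a := m) bA2) => x [A2x ne]; split=> //; exists m => //.
      by case: (Hm _ A2x) => // e; case: ne.
    apply: big_sub bA2 => x A2x; split=> //; apply: contrapT => nx; apply: nm.
    exists x; split=> // z A2z; apply: (not_lt hlt) => zx; apply: nx; by exists z.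
  have [[m [A2m Hm]]|nm] := pselect (exists m, A2 m /\ forall x, A2 x -> x <=% m).
    apply: big_sub (big_D1 (a := m) bA4) => x [[A2x [lo A2lo lox]] ne]; split=> //.
    exists lo, m; split=> //; by case: (Hm _ A2x) => // e; case: ne.
  apply: big_sub bA4 => x [A2x [lo A2lo lox]]; split=> //; apply: contrapT => nx; apply: nm.
  exists x; split=> // z A2z; apply: (not_lt hlt) => zx; apply: nx; by exists lo, z.
have [d1 [z0 [E1 [z0D hE1 E1F]]]] := convexify hC hlt sD dFy eFr.
have A2r x : A2 x -> same D a x by move=> [/A1r[]].
have A2E x1 x2 : A2 x1 -> A2 x2 -> x1 <> x2 -> ~ E1 z0 x1 x2.
  move=> h1 h2 ne; rewrite (E1F _ _ (A2r _ h1) (A2r _ h2)).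
  by case: h1 h2 => h1 _ [h2 _]; exact: A1F.
have [a0 A2a0] := big_neq0 bA2.
have [Ba0 Ba0y'] := lim1 _ A2a0.
have [s0 [As0 s0a s0y]] := lim_pair oB Ba Ba0 Bay Ba0y'.
have [s0' [As0' s0K s0'K]] := autom_inv As0.
(* Since [s0] takes [(a, y)] to [(a0, y')], the conjugate relation compares cuts below [y'], for
   which [A2] lies in one class. *)
have E1y' x : A2 x -> E1 (s0 \o z0) a0 x.
  move=> A2x; have [Bx Bxy'] := lim1 _ A2x.
  rewrite -(s0'K x) -s0a -(eqfam_autom hE1 _ _ _ As0).
  have [sg [Asg sga sgy]] := lim_pair oB Ba0 Bx Ba0y' Bxy'.
  have As1 : autom D (s0' \o (sg \o s0)).
    have [i1 i2] := autom_comp (autom_comp As0 Asg) As0'; split=> // z [Bz|->]; first exact: i2.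
    by rewrite /= s0y sgy -s0y s0K.
  have rx : same D a (s0' x).
    by have := autom_same a As1; rewrite /= s0a sga.
  have raa : same D a a by [].
  apply/(E1F _ _ raa rx).
  have h := autom_Dfn As0 dF (fun o : option bool => match o with None => y
      | Some true => a | Some false => s0' x end).
  by move: h => /= ->; rewrite s0y s0a s0'K; exact: Fy'.
have [N] := hr hE1; apply.
apply: (rank_step_homog hC hE1 bA3 (z1 := z0) (x0 := a0) (z0 := s0 \o z0)).
  by move=> x1 x2 [h1 _] [h2 _]; exact: A2E.
move=> x [A2x [lo [hi [A2lo A2hi lox xhi]]]]; split.
  have e0 : eqt set0 (ocons a z0) (ocons x z0).
    apply: ocons_same; apply: same_mono (A2r _ A2x) => z [//|[i _ <-]]; exact: z0D.
  apply: eqt_trans e0; apply: eqt_sym.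
  have -> : ocons a0 (s0 \o z0) = s0 \o ocons a z0 by apply/funext => -[i|] //=; rewrite s0a.
  exact: (autom_eqt _ (autom_sub (@sub0set _ B) As0)).
move=> u Exu.
have lou : lo <% u.
  case: (le_or_lt hlt u lo) => // ulo; case: (A2E lo x A2lo A2x).
    by move=> e; rewrite e in lox; exact: (lt_irr hlt lox).
  apply: (eqfam_trans hE1 (eqfam_sym hE1 _) (eqfam_sym hE1 Exu)).
  by apply: (eqfam_convex hE1 (eqfam_sym hE1 Exu)) ulo _; right.
have uhi : u <% hi.
  case: (le_or_lt hlt hi u) => // hiu; case: (A2E x hi A2x A2hi).
    by move=> e; rewrite e in xhi; exact: (lt_irr hlt xhi).
  by apply: (eqfam_convex hE1 Exu) _ hiu; right.
apply: (eqfam_trans hE1 (E1y' _ A2lo)).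
apply: (eqfam_convex hE1 (t := hi)); [|exact: lt_le|exact: lt_le].
exact: (eqfam_trans hE1 (eqfam_sym hE1 (E1y' _ A2lo)) (E1y' _ A2hi)).
Qed.

(** A descending list in which independence is only required pairwise. [lim_absorb] turns it into
    independence over the previous elements ([chain_par]), so the length determines the type
    ([chain_unique]). *)
Fixpoint chain B (s : seq C) : Prop := if s is x :: s' then
  [/\ lim B x, All (lim (B `|` [set x])) s' & chain B s'] else True.

Lemma All_mem (P : C -> Prop) (s : seq {classic C}) : All P s <-> forall x, x \in s -> P x.
Proof.
elim: s => //= y s IH; split=> [[Py /IH H] x|H].
  by rewrite in_cons => /orP[/eqP ->|/H].
by split; [apply: H; rewrite mem_head|apply/IH => x xs; apply: H; rewrite in_cons xs orbT].
Qed.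

Lemma chain_par B x s : ok B -> lim B x -> All (lim (B `|` [set x])) s -> chain B s ->
  chain (B `|` [set x]) s.
Proof.
move=> oB Bx; elim: s => //= y s IH [Bxy Hs] [By Hy cs]; split=> //; last exact: IH.
by apply: All_impl Hy => z; exact: lim_absorb.
Qed.

Lemma All_lim_autom B s x l : ok B -> autom B s -> All (lim (B `|` [set x])) l ->
  All (lim (B `|` [set s x])) (map s l).
Proof.
by move=> oB As; elim: l => //= y l IH [Bxy Hx]; split; [exact: lim_autom1|exact: IH].
Qed.

Lemma chain_autom B s l : ok B -> autom B s -> chain B l -> chain B (map s l).
Proof.
move=> oB As; elim: l => //= x l IH [Bx Hx cl]; split; [exact: lim_autom| |exact: IH].
exact: All_lim_autom.
Qed.

Lemma chain_unique B l l' : ok B -> chain B l -> chain B l' -> size l = size l' ->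
  exists s, autom B s /\ map s l = l'.
Proof.
elim: l' l B => [|x' l' IH] [|x l] B oB //=.
  by exists id; split=> //; split=> //; split=> //; exists id.
move=> [Bx Hx cl] [Bx' Hx' cl'] [ss]; have [sB _ _] := oB.
have [s [As sx]] := same_autom hC sB (lim_same Bx Bx').
have H1 : chain (B `|` [set x']) (map s l).
  by apply: chain_par => //; [rewrite -sx; exact: All_lim_autom|exact: chain_autom].
have H2 := chain_par oB Bx' Hx' cl'.
have [|s' [As' sl']] := IH _ _ (okU1 x' oB) H1 H2; first by rewrite size_map.
exists (s' \o s); split; last by rewrite map_comp /= sx sl'; congr cons; case: As' => _; apply; right.
by apply: autom_comp As _; apply: autom_sub As' => z; left.
Qed.

Lemma chain_map B l (g : C -> C) : All (fun z => lim B (g z)) l ->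
  (forall x y : {classic C}, x \in (l : seq {classic C}) -> y \in (l : seq {classic C}) ->
    lim (B `|` [set x]) y -> lim (B `|` [set g x]) (g y)) ->
  chain B l -> chain B (map g l).
Proof.
elim: l => //= x l IH [gx gl] H [Bx Hx cl]; split=> //; last first.
  by apply: IH => // u v ul vl; apply: H; rewrite in_cons ?ul ?vl orbT.
have {}H y : y \in (l : seq {classic C}) -> lim (B `|` [set x]) y -> lim (B `|` [set g x]) (g y).
  by move=> yl; apply: H; rewrite ?mem_head // in_cons yl orbT.
elim: l Hx {IH cl gl} H => //= y l IH [Bxy Hx] H; split; first by apply: H => //; rewrite mem_head.
by apply: IH => // z zl; apply: H; rewrite in_cons zl orbT.
Qed.

Definition comparable B x y := lim (B `|` [set x]) y \/ lim (B `|` [set y]) x.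

Lemma chain_sort B (s : seq {classic C}) : ok B ->
  (forall x, x \in s -> lim B x) ->
  (forall x y, x \in s -> y \in s -> x <> y -> comparable B x y) ->
  exists t : seq {classic C}, chain B t /\ t =i s.
Proof.
move=> oB; elim: {s}(size s) {-2}s (leqnn (size s)) => [|n IH] s.
  by rewrite leqn0 size_eq0 => /eqP -> _ _; exists [::].
case: (pselect (s = [::])) => [-> _ _ _|sn]; first by exists [::].
move=> ss Bs cs.
have [x [xs xmax]] : exists x, x \in s /\ forall y, y \in s -> y <=% x.
  elim: s sn {ss Bs cs} => // x s IHs _; case: (pselect (s = [::])) => [->|/IHs[y [ys Hy]]].
    by exists x; rewrite mem_head; split=> // y; rewrite inE => /eqP ->; left.
  case: (le_or_lt hlt x y) => xy.
    exists y; rewrite in_cons ys orbT; split=> // z; rewrite in_cons => /orP[/eqP -> //|]; exact: Hy.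
  exists x; rewrite mem_head; split=> // z; rewrite in_cons => /orP[/eqP ->|/Hy zy]; first by left.
  by right; exact: (le_lt_trans hlt zy xy).
pose s1 := [seq z <- s | z != x].
have s1s z : (z \in s1) = (z != x) && (z \in s) by rewrite mem_filter.
have ss1 : size s1 <= n.
  rewrite size_filter -ltnS; apply: leq_trans ss; rewrite -count_predT.
  by apply: (@count_lt _ _ _ _ x) => //=; rewrite eqxx.
have [||t [ct ts]] := IH _ ss1.
- by move=> z; rewrite s1s => /andP[_ /Bs].
- by move=> z w; rewrite !s1s => /andP[_ zs] /andP[_ ws]; exact: cs.
exists (x :: t); split; last first.
  move=> z; rewrite in_cons ts s1s; case: eqP => [->|_] /=; by rewrite ?xs.
split=> //; first exact: Bs.
apply/All_mem => z; rewrite ts s1s => /andP[/eqP zx zs].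
have [//|h] : comparable B x z by apply: cs => // e; apply: zx.
case: (le_not_lt hlt (xmax _ zs)); exact: (lim_lt oB (Bs _ zs) h).
Qed.

(** A definable set of elements that fit into the order uses finitely many parameters [s0]. Let [x]
    be the least of these over which its element [y0] is generic. All elements generic over [x] and
    above [y0] have the type of [y0] over the parameters, so the set reaches the upper end of the
    limit type over [x] and would define it, against [no_definable_sup]. *)
Lemma no_isolated B e P Y y0 : ok B -> lim B e -> P e ->
  (forall x, P x -> B x \/ x = e \/ lim (B `|` [set e]) x) ->
  (forall x y, P x -> P y -> lim B x -> lim B y -> x <> y -> comparable B x y) ->
  D1 P Y -> Y y0 ->
  exists y, Y y /\ ~ (lim (B `|` [set e]) y /\ forall x, P x -> lim B x -> comparable B x y).
Proof.
move=> oB Be Pe PB Pc dY Yy0; apply: contrapT => no.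
have HY y : Y y -> lim (B `|` [set e]) y /\ forall x, P x -> lim B x -> comparable B x y.
  by move=> Yy; apply: contrapT => n; apply: no; exists y.
have [sB cB bB] := oB.
have PB' x : P x -> B x \/ lim B x.
  by move=> /PB[Bx|[->|/lim_sub1 h]]; [left|right|right].
have Blow x : B x -> ~ lim B x.
  move=> Bx [_ nx H]; apply: (lt_irr hlt (x := x)).
  apply: (H (fun z => z <% x)); [|by move=> u v ux vu; exact: (lt_tr hlt vu ux)|exact/not_low].
  by apply: D2_at (D2_lt _ _) (Trm_var _ _) (Trm_par _ Bx).
have {dY}[k [z [zP dY]]] := Dfn_finpar dY.
(* Including [e] ensures that [y0] is generic over some member of the list. *)
pose s0 : seq {classic C} := e :: [seq z i | i <- enum 'I_k & `[< lim B (z i) >]].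
have s0P x : x \in s0 -> P x /\ lim B x.
  by rewrite in_cons => /orP[/eqP ->//|/mapP[i]]; rewrite mem_filter => /andP[/asboolP h _] ->.
have dY1 : D1 (B `|` [set x | x \in s0]) Y.
  apply: D1_mono dY => _ [i _ <-]; case: (PB' _ (zP i)) => h; [by left|right] => /=.
  rewrite in_cons; apply/orP; right; apply/mapP; exists i => //.
  by rewrite mem_filter mem_enum andbT; exact/asboolP.
have [Bey0 cy0] := HY _ Yy0; have By0 := lim_sub1 Bey0.
have [||t [ct ts]] := @chain_sort B ((y0 : {classic C}) :: s0) oB.
- by move=> x; rewrite in_cons => /orP[/eqP -> //|/s0P[]].
- move=> x y; rewrite !in_cons => /orP[/eqP ->|/s0P[Px Bx]] /orP[/eqP ->|/s0P[Py By]] ne //.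
  + by case: (cy0 _ Py By); [right|left].
  + exact: cy0.
  + exact: Pc.
have y0s0 : y0 \notin s0.
  apply/negP => /s0P[Py0 _]; have [h|h] := cy0 _ Py0 By0; exact: (lt_irr hlt (lim_lt oB By0 h)).
have [x [xs xy0 xmin]] : exists x, [/\ x \in s0, lim (B `|` [set x]) y0 &
    forall u, u \in s0 -> lim (B `|` [set u]) y0 -> x <=% u].
  have : exists u, u \in s0 /\ lim (B `|` [set u]) y0 by exists e; rewrite mem_head.
  elim: (s0) => [[? []]//|u s IH [w [ws wy0]]].
  have [[x [xs xy0 xmin]]|nx] := pselect (exists x, [/\ x \in s, lim (B `|` [set x]) y0 &
      forall u, u \in s -> lim (B `|` [set u]) y0 -> x <=% u]); last first.
    exists w; split=> // v; rewrite in_cons => /orP[/eqP ->|vs] vy0; last first.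
      by case: nx; apply: IH; exists v.
    move: ws; rewrite in_cons => /orP[/eqP ->|ws]; first by left.
    by case: nx; apply: IH; exists w.
  have [uy0|nuy0] := pselect (lim (B `|` [set u]) y0 /\ u <% x).
    case: uy0 => uy0 ux; exists u; rewrite mem_head; split=> // v.
    rewrite in_cons => /orP[/eqP -> _|vs vy0]; [by left|right].
    exact: (lt_le_trans hlt ux (xmin _ vs vy0)).
  exists x; rewrite in_cons xs orbT; split=> // v.
  rewrite in_cons => /orP[/eqP -> uy0|]; last exact: xmin.
  by apply: (not_lt hlt) => ux; apply: nuy0.
have [Px Bx] := s0P _ xs.
have up y : lim (B `|` [set x]) y -> y0 <=% y -> Y y.
  move=> Bxy y0y; have By := lim_sub1 Bxy.
  (* Exchanging [y0] for [y] leaves a chain: members over which [y0] is generic are at or above [x],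
     and [lim_up] handles these as well as the members generic over [y0]. *)
  pose g (u : {classic C}) : C := if u == y0 then y else u.
  have gs u : u \in s0 -> g u = u.
    by move=> us; rewrite /g; case: eqP => // e'; rewrite -e' us in y0s0.
  have ct' : chain B (map g t).
    apply: chain_map => //.
      apply/All_mem => u; rewrite ts in_cons => /orP[/eqP ->|us]; first by rewrite /g eqxx.
      by rewrite gs //; case: (s0P _ us).
    move=> u v; rewrite !ts !in_cons => /orP[/eqP ->|us] /orP[/eqP ->|vs].
    + by move=> /(lim_lt oB By0)/(lt_irr hlt).
    + rewrite (gs _ vs) {1}/g eqxx; exact: lim_up.
    + rewrite (gs _ us) {1}/g eqxx => uy0; have [Pu Bu] := s0P _ us.
      exact: lim_up oB Bx Bu (xmin _ us uy0) Bxy.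
    + by rewrite !gs.
  have [|s [As st]] := chain_unique oB ct ct'; first by rewrite size_map.
  have sg u : u \in (y0 : {classic C}) :: s0 -> s u = g u.
    rewrite -ts => ut; elim: (t) st ut => //= w l IH [sw sl]; rewrite in_cons.
    by move=> /orP[/eqP ->//|/(IH sl)].
  have sy0 : s y0 = y by rewrite sg ?mem_head // /g eqxx.
  have As' : autom (B `|` [set x | x \in s0]) s.
    case: As => sI sA; split=> // u [/sA//|us]; rewrite sg; first exact: gs.
    by rewrite in_cons (us : u \in s0) orbT.
  by rewrite -sy0 -(autom_D1 _ As' dY1).
pose J u := exists y, Y y /\ (y <% x /\ u <=% y).
have xA : (B `|` [set` s0]) x by right.
apply: (@no_definable_sup B x (B `|` [set` s0]) J oB Bx).
- apply: (smallU hK) => //; apply: (@small_sub K _ _ (range (nth (e : {classic C}) s0))).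
    by move=> u us; exists (index (u : {classic C}) s0) => //; rewrite nth_index.
  by apply: small_image; exact: hK.1.
- apply: Dfn_ex; apply: Dfn_and; first exact: D1_at dY1 (Trm_var _ _).
  apply: Dfn_and; first exact: D2_at (D2_lt _ _) (Trm_var _ _) (Trm_par _ xA).
  exact: D2_at (D2_le _ _) (Trm_var _ _) (Trm_var _ _).
move=> u qu; split=> [[y [Yy [yx uy]]]|].
  have [Bey Hy] := HY _ Yy; have By := lim_sub1 Bey.
  have xy : lim (B `|` [set x]) y.
    by case: (Hy _ Px Bx) => // /(lim_lt oB By)/(lt_asym hlt yx).
  have [lu|nlu] := pselect (low u); [by left|right].
  exact: lim_initial xy qu nlu uy.
have y0x := lim_lt oB Bx xy0.
case=> [[m um]|Bxu].
  exists y0; split=> //; split=> //; right; apply: (lt_tr hlt um).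
  by have [_ /not_low ny _] := By0; exact: ny.
have ux := lim_lt oB Bx Bxu.
case: (le_or_lt hlt y0 u) => h.
  by exists u; split; [exact: up|split=> //; left].
by exists y0; split=> //; split=> //; right.
Qed.

(** * The omitted set is closed *)

Definition next_class x y := gth y /\ (~ R x y /\ near x y).

(** These formulas define the complement of [low] over [c] and [b] only, although the elements
    [bs m] need not be definable. *)
Fixpoint above m x y : Prop :=
  if m is m'.+1 then forall x', next_class x x' -> above m' x' y else x <% y.

Lemma above_D2 m : D2 (range c) (above m).
Proof.
elim: m => [|m IH]; first exact: D2_lt.
have cc : range c `<=` range c by [].
apply: Dfn_all; apply: Dfn_imp; last exact: D2_at IH (Trm_var _ _) (Trm_var _ _).
apply: Dfn_and; first exact: D1_at (gth_D1 cc) (Trm_var _ _).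
apply: Dfn_and; last exact: D2_at (near_D2 cc) (Trm_var _ _) (Trm_var _ _).
by apply: Dfn_not; exact: D2_at (D2_R cc) (Trm_var _ _) (Trm_var _ _).
Qed.

Lemma above_bs m k x : above m (bs k) x -> bs (k + m) <% x.
Proof.
elim: m k => [|m IH] k /=; first by rewrite addn0.
rewrite addnS -addSn => H; apply: IH; apply: H; have [_ _ _ nR _] := bs_adj k.
by split; [exact: (gth_q (bs_q _))|split=> //; apply: adjacent_near; exact: bs_adj].
Qed.

Lemma not_low_above m k x y : ~ low y -> R x (bs k) -> above m x y.
Proof.
move=> /not_low ny; elim: m k x => [|m IH] k x Rx /=; have ak := bs_adj k;
    have [_ qk kk nRk _] := ak.
  exact: (lt_tr hlt (Rsep (Rsym Rx) (Rrefl _) nRk kk) (ny k.+1)).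
move=> x' [gx' [nRx [xx' Hx']]]; apply: (IH k.+1).
have kx' : bs k <% x' by exact: Rsep Rx (Rrefl x') nRx xx'.
have nRkx' : ~ R (bs k) x' by move=> h; apply: nRx; exact: Rtrans Rx h.
have [h|->|h] := lt_total hlt x' (bs k.+1); last 1 first.
- have xk : x <% bs k.+1 by exact: Rsep (Rsym Rx) (Rrefl _) nRk kk.
  have [h'|/Rsym//] := Hx' _ (gth_q (bs_q k.+1)) xk h.
  by case: nRk; exact: Rtrans (Rsym Rx) h'.
- by have [/nRkx'|] := gthP ak gx' kx' h.
- exact: Rrefl.
Qed.

Lemma low_open x : low x -> exists Y, [/\ D1 (range c `|` [set b]) Y, Y x &
  forall z, Y z -> low z].
Proof.
move=> [m xm]; exists (fun z => ~ above m b z); split.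
- apply: Dfn_not; apply: D2_at (Trm_par _ _) (Trm_var _ _); last by right.
  by apply: D2_mono (above_D2 m) => z; left.
- by move=> /(above_bs (k := 0)); rewrite add0n => /(lt_asym hlt xm).
- move=> z nab; apply: contrapT => nl; apply: nab; exact: (not_low_above (k := 0) _ nl (Rrefl _)).
Qed.

Lemma lim_closed B x : ok B -> ~ lim B x -> exists Y, [/\ D1 B Y, Y x & forall z, Y z -> ~ lim B z].
Proof.
move=> [sB cB bB] nl; have [qx|nqx] := pselect (q x); last first.
  have [th [dth thb nth]] : exists th, [/\ D1 (range c) th, th b & ~ th x].
    apply: contrapT => no; apply: nqx; apply: same_half => th dth thb.
    by apply: contrapT => nth; apply: no; exists th.
  exists (fun z => ~ th z); split=> //; first by apply: Dfn_not; exact: D1_mono dth.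
  by move=> z nz [qz _ _]; apply: nz; exact/(qz _ dth).
have [lx|nlx] := pselect (low x).
  have [Y [dY Yx HY]] := low_open lx; exists Y; split=> //.
    by apply: D1_mono dY => z [/cB|->].
  by move=> z /HY lz [_ /(_ lz)].
have [J [dJ dnJ Jb nJ]] : exists J, [/\ D1 B J, downset lt J, forall m, J (bs m) & ~ J x].
  apply: contrapT => no; apply: nl; split=> // J dJ dnJ Jb.
  by apply: contrapT => nJ; apply: no; exists J.
exists (fun z => ~ J z); split=> //; first exact: Dfn_not.
by move=> z nz [_ _ h]; apply: nz; exact: h.
Qed.

Lemma lim_closed_par B a x : ok B -> lim B x -> lim B a -> ~ lim (B `|` [set x]) a ->
  exists Y, [/\ D1 (B `|` [set a]) Y, Y x & forall z, lim B z -> Y z -> ~ lim (B `|` [set z]) a].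
Proof.
move=> oB Bx Ba nl; have [H [[dH dnH Hb] nH]] := not_lim_par oB Bx Ba nl.
exists (fun z => ~ H z a); split=> //.
  apply: Dfn_not; apply: D2_at (Trm_var _ _) (Trm_par _ _); last by right.
  by apply: D2_mono dH => z; left.
move=> z Bz nz [_ _ h]; apply: nz; apply: (h (H z)); [exact: D1_of_D2|exact: dnH|exact: Hb].
Qed.

(** The hypothesis [D_closed] of the omitting theorem for the elements that fit into the order of
    [P]: each way of not fitting is witnessed by a definable set. *)
Lemma incomparable_closed B e (P : set C) x : ok B -> B `<=` P -> P e -> lim B e ->
  (forall a, P a -> ~ lim B a \/ a = e \/ lim (B `|` [set e]) a) ->
  ~ (lim (B `|` [set e]) x /\ forall a, P a -> lim B a -> comparable B a x) ->
  exists Y, [/\ D1 P Y, Y x & forall z, Y z ->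
    ~ (lim (B `|` [set e]) z /\ forall a, P a -> lim B a -> comparable B a z)].
Proof.
move=> oB BP Pe Be Pa nD; have oBe := okU1 e oB.
have sub a : P a -> B `|` [set a] `<=` P by move=> Paa z [/BP//|->].
have [Bx|nBx] := pselect (lim (B `|` [set e]) x); last first.
  have [Y [dY Yx HY]] := lim_closed oBe nBx; exists Y; split=> //.
    exact: D1_mono (sub _ Pe) dY.
  by move=> z /HY nz [].
have [a [Paa Ba nc]] : exists a, [/\ P a, lim B a & ~ comparable B a x].
  apply: contrapT => no; apply: nD; split=> // a Paa Ba; apply: contrapT => nc.
  by apply: no; exists a.
have [n1 n2] : ~ lim (B `|` [set a]) x /\ ~ lim (B `|` [set x]) a.
  by split=> h; apply: nc; [left|right].
have [Y1 [dY1 Y1x H1]] := lim_closed (okU1 a oB) n1.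
have [Y2 [dY2 Y2x H2]] := lim_closed_par oB (lim_sub1 Bx) Ba n2.
exists (fun z => Y1 z /\ Y2 z); split=> //.
  by apply: Dfn_and; [exact: D1_mono (sub _ Paa) dY1|exact: D1_mono (sub _ Paa) dY2].
move=> z [Y1z Y2z] [/lim_sub1 Bz /(_ _ Paa Ba)[]]; first exact: H1.
exact: H2 Bz Y2z.
Qed.

(** Generic elements chosen one after the other descend, and [lim_up] makes each generic over every
    earlier one; compactness rearranges them along [r]. *)
Lemma lim_family (I : countType) (r : rel I) B e : irreflexive r -> transitive r ->
  ok B -> lim B e -> exists a : I -> C, (forall i, lim (B `|` [set e]) (a i)) /\
    forall i j, r i j -> lim (B `|` [set a j]) (a i).
Proof.
move=> rI rT oB Be; have oBe := okU1 e oB; have [sBe _ _] := oBe.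
have [x0 Bx0] := lim_neq0 oBe.
have /choice[g gP] : forall x, exists y, lim ((B `|` [set e]) `|` [set x]) y.
  by move=> x; exact: lim_neq0 (okU1 x oBe).
pose f n := iter n g x0.
have fe n : lim (B `|` [set e]) (f n) by case: n => // n; exact: lim_sub1 (gP _).
have ff j k : j < k -> lim ((B `|` [set e]) `|` [set f j]) (f k).
  elim: k => // k IH; rewrite ltnS leq_eqVlt => /orP[/eqP -> //|/IH h].
  by apply: (lim_up oBe (fe k) (fe j)); [right; exact: lim_lt oBe (fe j) h|exact: (gP (f k))].
have ff' j k : j < k -> lim (B `|` [set f j]) (f k).
  by move=> /ff; apply: lim_mono => z [Bz|->]; [left; left|right].
pose good (l : seq I) (v : I -> C) := (forall i, i \in l -> lim (B `|` [set e]) (v i)) /\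
  forall i j, i \in l -> j \in l -> r i j -> lim (B `|` [set v j]) (v i).
pose F : set (set (I -> C)) := [set P | Dfn (B `|` [set e]) P /\
  exists l, forall v, good l v -> P v].
have [|||a aF] := @compactness _ _ _ _ hC (B `|` [set e]) I F sBe.
- by apply: (small_countable hK); exact: countableP.
- by move=> P [].
- move=> s sF; have [l Hl] : exists l, forall v, good l v -> All (fun P : set (I -> C) => P v) s.
    elim: s sF => [_|P s IH [[_ [l Hl]] /IH[l' Hl']]]; first by exists [::].
    exists (l ++ l') => v [h1 h2]; split; [apply: Hl|apply: Hl']; split=> [i il|i j il jl].
    + by apply: h1; rewrite mem_cat il.
    + by apply: h2; rewrite mem_cat ?il ?jl.
    + by apply: h1; rewrite mem_cat il orbT.
    + by apply: h2; rewrite mem_cat ?il ?jl orbT.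
  (* An index with more [r]-successors in [l] goes to a later, hence lower, term. *)
  exists (fun i => f (count (r i) l)); apply: Hl; split=> [i _|i j il jl rij]; first exact: fe.
  apply: ff'; apply: (@count_lt _ _ _ _ j) => //; last by rewrite rI.
  by move=> z; exact: rT rij.
have ae i : lim (B `|` [set e]) (a i).
  apply: contrapT => nl; have [Y [dY Yi HY]] := lim_closed oBe nl.
  have : [set v : I -> C | ~ Y (v i)] a; last by [].
  apply: aF; split; first by apply: Dfn_not; exact: D1_at dY (Trm_var _ _).
  exists [:: i] => v [h _] Yv; exact: HY Yv (h i (mem_head _ _)).
exists a; split=> // i j rij; apply: contrapT => nl.
have [H [[dH dnH Hb] nH]] := not_lim_par oB (lim_sub1 (ae j)) (lim_sub1 (ae i)) nl.
apply: nH; apply: (aF [set v : I -> C | H (v j) (v i)]); split.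
  by apply: D2_at (D2_mono _ dH) (Trm_var _ _) (Trm_var _ _) => z; left.
exists [:: i; j] => v [h1 h2]; have jl : j \in [:: i; j] by rewrite !inE eqxx orbT.
have [_ _ h] := h2 i j (mem_head _ _) jl rij.
apply: (h (H (v j))); [exact: D1_of_D2|exact: dnH|].
by apply: Hb; exact: lim_sub1 (h1 j jl).
Qed.

Lemma lim_notin B x : ok B -> B x -> ~ lim B x.
Proof.
move=> oB Bx [_ nx H]; apply: (lt_irr hlt (x := x)).
apply: (H (fun z => z <% x)); [|by move=> u v ux vu; exact: (lt_tr hlt vu ux)|exact/not_low].
by apply: D2_at (D2_lt _ _) (Trm_var _ _) (Trm_par _ Bx).
Qed.

(** * Models that remember the order of a Morley sequence *)

Section Models.
Hypothesis hL : countable_language L.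

Let B0 := range c `|` [set b].

Let oB0 : ok B0.
Proof.
split; [|by left|by right].
by apply: (smallU hK); [exact: (range_small hC)|exact: small1].
Qed.

Variables (e : C) (a : nat * int -> C).
Hypothesis he : lim B0 e.
Hypothesis ha : forall i, lim (B0 `|` [set e]) (a i).
Hypothesis hlex : forall i j, lexi_lt i j -> lim (B0 `|` [set a j]) (a i).

Let B1 := B0 `|` [set e].
Let pts S : set C := B1 `|` a @` blocks S.

(** The elements that would fit into the order of the chosen points. Once they are omitted, every
    element of [lim B1] in the model is incomparable with some [a i] and so represents an index. *)
Definition thick S x := lim B1 x /\ forall y, pts S y -> lim B0 y -> comparable B0 y x.

Let base (i : 'I_d + bool) : C := match i with inl j => c j | inr true => b | inr false => e end.

Let base_range x : B1 x <-> exists i, base i = x.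
Proof.
split=> [[[[i _ <-]|->]|->]|[[i|[]] <-]].
- by exists (inl i).
- by exists (inr true).
- by exists (inr false).
- by left; left; exists i.
- by left; right.
- by right.
Qed.

Let pts_lim S x : pts S x -> lim B0 x -> x = e \/ exists2 i, blocks S i & a i = x.
Proof. by case=> [[Bx|->]|[i Si <-]] Lx; [case: (lim_notin oB0 Bx)|left|right; exists i]. Qed.

Let pts_countable S : countable (pts S).
Proof.
pose f (s : ('I_d + bool) + (nat * int)) : C := match s with inl i => base i | inr j => a j end.
have sub : pts S `<=` range f.
  by move=> x [/base_range[i <-]|[i _ <-]]; [exists (inl i)|exists (inr i)].
apply: card_le_trans (subset_card_le sub) _; apply: card_le_trans (card_image_le _ _) _.
exact: countableP.
Qed.

Definition good_model S N := [/\ countable N, pts S `<=` N, tv_closed N &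
  forall x, N x -> ~ thick S x].

Lemma good_model_exists S : exists N, good_model S N.
Proof.
have [cf [_ cf_inj]] := card_le_fun 0 (hL.1 : _ #<= [set: nat]).
have [cr [_ cr_inj]] := card_le_fun 0 (hL.2 : _ #<= [set: nat]).
have pe : pts S e by left; right.
have ae i : lim B0 (a i) by exact: lim_sub1 (ha i).
have [p pE] := enumerate (@pts_countable S) pe.
have B0p : B0 `<=` pts S by move=> x Bx; left; left.
have [||N [cN pN tN nN]] := @omitting _ _ _ _ hC p (thick S) _ _ cf cr
    (fun x y => cf_inj x y I I) (fun x y => cr_inj x y I I).
- rewrite pE => x; apply: incomparable_closed => //.
  move=> y py; have [Ly|] := pselect (lim B0 y); [right|by left].
  by case: (pts_lim py Ly) => [->|[i _ <-]]; [left|right].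
- rewrite pE => Y y0 dY Yy; apply: (no_isolated oB0 he pe _ _ dY Yy).
    move=> x [[Bx|->]|[i _ <-]]; [by left|by right; left|by right; right].
  move=> x y px py Lx Ly ne.
  case: (pts_lim px Lx) ne => [->|[i _ <-]]; case: (pts_lim py Ly) => [->|[j _ <-]] ne.
  + by [].
  + by left.
  + by right.
  + have [ij|ji] : lexi_lt i j \/ lexi_lt j i by apply: lexi_total => ij; apply: ne; rewrite ij.
      by right; exact: hlex.
    by left; exact: hlex.
by exists N; split=> //; rewrite -pE.
Qed.

(** Two uses of [lim_split]: incomparable elements occupy the same place in the order. *)
Let incomp_lim u u' v v' : lim B0 u -> lim B0 u' -> lim B0 v -> lim B0 v' ->
  ~ comparable B0 u u' -> ~ comparable B0 v v' -> lim (B0 `|` [set u]) v -> lim (B0 `|` [set u']) v'.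
Proof.
move=> Lu Lu' Lv Lv' nu nv uv.
have [u'v|h] := lim_split oB0 Lu Lu' uv; last by case: nu; left.
by have [h|//] := lim_split oB0 Lu' Lv' u'v; case: nv; right.
Qed.

Let incomp_sym u v : ~ comparable B0 u v -> ~ comparable B0 v u.
Proof. by move=> n [h|h]; apply: n; [right|left]. Qed.

Let incomp_refl u : lim B0 u -> ~ comparable B0 u u.
Proof. by move=> Lu [|] /(lim_lt oB0 Lu)/(lt_irr hlt). Qed.

Section Iso.
Variables (S S' : set nat) (N N' : set C) (tN : tv_closed N) (tN' : tv_closed N').
Hypotheses (gN : good_model S N) (gN' : good_model S' N').
Variable h : substructure tN -> substructure tN'.
Hypotheses (hI : isomorphism h) (hB : forall x, B1 (sval x) -> sval (h x) = sval x).

(** Both models are elementary in [C], so [h] preserves types over [B1]; homogeneity extends its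
    action on two points to an automorphism. *)
Lemma iso_autom (x y : substructure tN) : exists s, [/\ autom B1 s,
  s (sval x) = sval (h x) & s (sval y) = sval (h y)].
Proof.
have [sB1 _ _] := okU1 e oB0.
pose v (w : bool) := sval (if w then x else y).
pose v' (w : bool) := sval (h (if w then x else y)).
have BN z : B1 z -> N z by case: gN => _ h' _ _ Bz; apply: h'; left.
have [|||s [As sv]] := @eqt_small _ C _ _ hC B1 bool v v'.
- exact: sB1.
- by apply: (small_countable hK); exact: countableP.
- move=> P [k [f [z [zB HP]]]]; rewrite !HP.
  have /choice[w wP] : forall i, exists w : substructure tN,
      sval w = aval v (z i) /\ sval (h w) = aval v' (z i).
    move=> i; move: (zB i); case: (z i) => [t _|t Bt]; first by exists (if t then x else y).
    by exists (exist _ t (BN _ Bt)); split=> //; exact: hB.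
  have -> : aval v \o z = fun i => sval (w i) by apply/funext => i; case: (wP i).
  have -> : aval v' \o z = fun i => sval ((h \o w) i) by apply/funext => i; case: (wP i).
  by rewrite -!sat_substructure (iso_sat hI).
exists s; split=> //; [exact: (sv true)|exact: (sv false)].
Qed.

(** No image of a chosen point is [thick], so [h] takes [a i] to an element incomparable with some
    [a j]. The resulting map [g] of indices respects the order and is onto, and [blocks_iso]
    applies. *)
Lemma iso_blocks_sub : S `<=` S'.
Proof.
have oB1 := okU1 e oB0.
have B01 : B0 `<=` B1 by left.
have iso1 x : lim B1 (sval x) -> lim B1 (sval (h x)).
  by have [s [As <- _]] := iso_autom x x; exact: lim_autom.
have iso2 x y : lim (B0 `|` [set sval x]) (sval y) -> lim (B0 `|` [set sval (h x)]) (sval (h y)).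
  by have [s [As <- <-]] := iso_autom x y; apply: lim_autom1 => //; exact: autom_sub As.
have [_ pN _ thN] := gN; have [_ pN' _ thN'] := gN'.
have [[h' hK' h'K] _ _] := hI.
have find R M x : good_model R M -> M x -> lim B1 x ->
    exists i, blocks R i /\ ~ comparable B0 (a i) x.
  move=> [_ _ _ thM] Mx Lx; apply: contrapT => no; apply: (thM x) => //; split=> // y py Ly.
  apply: contrapT => nc; case: (pts_lim py Ly) => [Ey|[i Ri Ey]].
    by apply: nc; rewrite Ey; left.
  by apply: no; exists i; rewrite Ey.
have aN i : blocks S i -> N (a i) by move=> Si; apply: pN; right; exists i.
have /choice[g gP] : forall i, exists j, forall (Si : blocks S i),
    blocks S' j /\ ~ comparable B0 (a j) (sval (h (exist _ (a i) (aN i Si)))).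
  move=> i; have [Si|nSi] := pselect (blocks S i); last by exists i.
  have [|j [Sj nj]] := find _ _ (sval (h (exist _ (a i) (aN i Si)))) gN' (svalP _).
    by apply: iso1; exact: ha.
  by exists j => Si'; rewrite (Prop_irrelevance Si' Si).
have La i : lim B0 (a i) by exact: lim_sub1 (ha i).
have Lh i (Si : blocks S i) : lim B0 (sval (h (exist _ (a i) (aN i Si)))).
  by apply: (@lim_sub1 B0 e); apply: iso1; exact: ha.
have lexE i j : lim (B0 `|` [set a j]) (a i) -> lexi_lt i j.
  move=> l; have ne : i <> j by move=> ij; rewrite ij in l; exact: (lt_irr hlt (lim_lt oB0 (La _) l)).
  have [//|ji] := lexi_total ne.
  by case: (lt_asym hlt (lim_lt oB0 (La j) l) (lim_lt oB0 (La i) (hlex ji))).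
apply: (@blocks_iso _ _ g).
- by move=> i Si; have [] := gP i Si.
- move=> i j Si Sj ij; have [Si' ni] := gP i Si; have [Sj' nj] := gP j Sj.
  apply: lexE; apply: (incomp_lim (Lh j Sj) (La _) (Lh i Si) (La _) (incomp_sym nj) (incomp_sym ni)).
  by apply: iso2; exact: hlex.
- move=> j Sj'; have Naj : N' (a j) by apply: pN'; right; exists j.
  pose y := h' (exist _ (a j) Naj).
  have hy : h y = exist _ (a j) Naj by exact: h'K.
  have Ly : lim B1 (sval y).
    have [s [As sy _]] := iso_autom y y; rewrite hy /= in sy.
    have [s' [As' sK _]] := autom_inv As.
    by rewrite -(sK (sval y)) sy; apply: lim_autom => //; exact: ha.
  have [i [Si nc]] := find _ _ (sval y) gN (svalP y) Ly.
  exists i; split=> //; have [Sgi ni] := gP i Si; apply: contrapT => ne.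
  have nc' : ~ comparable B0 (sval (h (exist _ (a i) (aN i Si)))) (a j).
    move=> cm; apply: nc.
    have [s [As sx sy]] := iso_autom (exist _ (a i) (aN i Si)) y.
    rewrite hy /= in sx sy; have [s' [As' sK _]] := autom_inv As.
    have As0 := autom_sub B01 As'.
    have ex : a i = s' (sval (h (exist _ (a i) (aN i Si)))) by rewrite -sx sK.
    have ey : sval y = s' (a j) by rewrite -sy sK.
    by rewrite ex ey; case: cm => h0; [left|right]; exact: lim_autom1.
  have := lexi_total ne; case=> /hlex l.
    apply: (incomp_refl (Lh i Si)); left.
    exact: (incomp_lim (La j) (Lh i Si) (La (g i)) (Lh i Si) (incomp_sym nc') ni l).
  apply: (incomp_refl (Lh i Si)); left.
  exact: (incomp_lim (La (g i)) (Lh i Si) (La j) (Lh i Si) ni (incomp_sym nc') l).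
Qed.

End Iso.

(** Isomorphisms need not fix the parameters [c], [b], [e]. The [key] records where these go in a
    representative of the isomorphism class. Class and key together determine [S], keys are
    integers, and [koenig] leaves continuum many classes. *)
Lemma many_models : ~ few_countable_models T.
Proof.
have mC : model T C by case: hC.
apply; apply: koenig.
have [N gN] := choice good_model_exists.
have tN S : tv_closed (N S) by case: (gN S).
pose M S : structure L := substructure (tN S).
have cM S : countable [set: M S].
  have [cN _ _ _] := gN S; apply: card_le_trans cN.
  apply: (@card_le_of _ _ _ _ (fun x : M S => sval x)) => [x _|x y _ _]; first exact: svalP.
  by case: x y => [x Nx] [y Ny] /= xy; exact: eq_exist.
have mM S : countable_models T (M S) by split; [exact: substructure_model|exact: cM].
pose cls S := [set Q | countable_models T Q /\ isomorphic (M S) Q].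
have isoid (Q : structure L) : isomorphism (@id Q) by split=> //; exists id.
have cls_refl S : cls S (M S) by split=> //; exists id; exact: isoid.
pose rep (q : set (structure L)) : set nat := match pselect (exists S, cls S = q) with
  | left ex => sval (cid ex) | right _ => set0 end.
have repP S : cls (rep (cls S)) = cls S.
  rewrite /rep; case: pselect => [ex|[]]; [exact: svalP (cid ex)|by exists S].
have code_ex q : exists code : M (rep q) -> nat, injective code.
  have [f [_ f_inj]] := card_le_fun 0 (cM (rep q) : _ #<= [set: nat]).
  by exists f => x y; exact: f_inj.
pose code q := sval (cid (code_ex q)); have codeP q : injective (code q) := svalP (cid (code_ex q)).
have iso S : exists h : M S -> M (rep (cls S)), isomorphism h.
  have := cls_refl S; rewrite -{1}(repP S) => -[_ [h0 /iso_inverse[h [hI _ _]]]].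
  by exists h.
have BN S i : N S (base i).
  by have [_ pN _ _] := gN S; apply: pN; left; apply/base_range; exists i.
pose hh S := sval (cid (iso S)); have hhI S : isomorphism (hh S) := svalP (cid (iso S)).
pose key S : nat := pickle [ffun i : 'I_d + bool => code (cls S) (hh S (exist _ _ (BN S i)))].
apply: (@card_le_of _ _ _ _ (fun S => (cls S, key S))) => [S _|S S' _ _ [Ec Ek]].
  by exists (M S).
have {}Ek : [ffun i : 'I_d + bool => code (cls S) (hh S (exist _ _ (BN S i)))] =
    [ffun i : 'I_d + bool => code (cls S') (hh S' (exist _ _ (BN S' i)))].
  exact: (pcan_inj pickleK) Ek.
(* When the keys agree, the isomorphism through the common representative fixes the parameters. *)
have glue (R R' : set nat) : cls R = cls R' ->
    (forall i, code (cls R) (hh R (exist _ _ (BN R i))) =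
      code (cls R') (hh R' (exist _ _ (BN R' i)))) -> R `<=` R'.
  move: (hh R') (hhI R') => f' + Ec'; case: _ / Ec' f' => f' /iso_inverse[g [[gb gf gr] fK gK]] Eb.
  have [[hb hf hr0] hI] := (hhI R, hhI R).
  apply: (@iso_blocks_sub R R' (N R) (N R') (tN R) (tN R') (gN R) (gN R') (g \o hh R)).
    split; first exact: bij_comp.
      by move=> f u /=; rewrite hf gf.
    by move=> r u; rewrite (hr0 r u); exact: gr.
  move=> x /base_range[i Ei].
  have -> : x = exist _ _ (BN R i) by case: x Ei => x Nx /= Ei; apply: eq_exist.
  by rewrite /= (codeP _ _ _ (Eb i)) fK.
apply/seteqP; split; apply: glue => //; first by move=> i; have := congr1 (fun f : {ffun _} => f i) Ek; rewrite !ffunE.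
by move=> i; have := congr1 (fun f : {ffun _} => f i) Ek; rewrite !ffunE.
Qed.

End Models.

Lemma discrete_many_models : countable_language L -> ~ few_countable_models T.
Proof.
move=> hL; have oB0 : ok (range c `|` [set b]).
  split; [|by left|by right].
  by apply: (smallU hK); [exact: (range_small hC)|exact: small1].
have [e he] := lim_neq0 oB0.
have [a [ha hlex]] := @lim_family _ lexi_lt _ e lexi_irr lexi_trans oB0 he.
exact: (many_models hL he ha hlex).
Qed.

End Limit.

(** * Condition (R) from finite ranks *)

Section ConditionR.
Variables (L : language) (C : structure L) (lt : formula L 2) (K : Type) (T : theory L).
Hypothesis hC : monster_model K T C.
Hypothesis hlt : weakly_quasi_o_minimal_wrt C lt.
Hypothesis hL : countable_language L.
Hypothesis hfew : few_countable_models T.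

Lemma realizations_same A (p : set (pform C 1)) a : complete_type A p -> realizations p a ->
  realizations p = [set x | same A a x].
Proof.
move=> [pA pfin pc] pa; apply/seteqP; split=> x /=.
  move=> px; apply: same_half => P dP Pa.
  have /Dfn_pform[f [fA fP]] : Dfn A (fun v : 'I_1 -> C => P (v ord0)).
    exact: D1_at dP (Trm_var _ _).
  have [/px/fP //|/pa nf] := pc f fA.
  by case: nf; apply/fP.
move=> ax f pf; apply/(ax (fun z => psat f (tup1 z))); last exact: pa.
exact: Dfn_ext (Dfn_ren (fun=> tt) (psat_Dfn (pA _ pf))).
Qed.

Lemma finite_ranks_condition_R : finite_ranks C lt -> condition_R K C.
Proof.
move=> hr A p sA cp E [[f fA Ef] eE].
have [a0 pa0] : realizations p !=set0 by case: hC => _ _ sat _; exact: sat sA cp.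
have rE := realizations_same cp pa0.
have Er x y : E x y <-> psat f (tup2 x y) /\ same A a0 x /\ same A a0 y.
  have := congr1 (fun X : set ('I_2 -> C) => X (tup2 x y)) Ef.
  rewrite /graph2 /= /tup2 /= => ->; rewrite rE; split=> [[fxy h]|[fxy [hx hy]]].
    by split=> //; split; [exact: (h ord0)|exact: (h ord_max)].
  by split=> // i /=; case: ifP.
pose F x y := psat f (tup2 x y).
have dF : D2 A F.
  apply: Dfn_ext (Dfn_ren (fun i : 'I_2 => i == ord0) (psat_Dfn fA)) => v.
  rewrite /F; have -> // : v \o (fun i : 'I_2 => i == ord0) = tup2 (v true) (v false).
  by apply/funext => i; rewrite /tup2 /=; case: ifP.
have eF : equivalence_on [set x | same A a0 x] F.
  rewrite -rE; case: eE => h1 h2 h3.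
  have EF x y : realizations p x -> realizations p y -> (F x y <-> E x y).
    by rewrite rE => hx hy; rewrite Er /F; tauto.
  split=> [x px|x y px py|x y z px py pz]; rewrite !EF //; [exact: h1|exact: h2|exact: h3].
have [[G [dG GF]]|[d [E' [c [b [hE' hd]]]]]] := discrete_or_definable hC hlt hr sA dF eF.
  have /Dfn_pform[g [g0 gP]] : Dfn set0 (fun v : 'I_2 -> C => G (v ord0) (v ord_max)).
    exact: D2_at dG (Trm_var _ _) (Trm_var _ _).
  exists g => //; apply/seteqP; split=> v; rewrite /graph2 /= Er gP rE.
    by move=> [Fv [h0 h1]]; split; [exact/GF|move=> i /=; case: (unliftP ord0 i) => [j|] -> //;
      rewrite (ord1 j); have <- // : ord_max = lift ord0 (ord0 : 'I_1) by exact: val_inj].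
  by move=> [Gv hv]; split; [exact/(GF _ _ (hv _) (hv _))|split; exact: hv].
by case: (discrete_many_models hC hlt hE' hd hr hL).
Qed.

End ConditionR.

(** * Long chains from infinite ranks *)

Section SmallTypes.
Variables (K : Type) (hK : uncountable_strong_limit K).

Lemma smallT_sum T U : small K [set: T] -> small K [set: U] -> small K [set: T + U].
Proof. by move=> sT sU; apply: (@small_sub K) (small_sum hK sT sU) => -[]. Qed.

Lemma smallT_prod T U : small K [set: T] -> small K [set: U] -> small K [set: T * U].
Proof.
move=> sT sU; apply: (small_le _ (smallT_pow hK (smallT_sum sT sU))).
apply: (@card_le_of _ _ _ _ (fun p => [set s | s = inl p.1 \/ s = inr p.2])) => // -[t u] [t' u'] _ _ E.
have : [set s | s = inl t \/ s = inr u] (inl t) by left.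
have : [set s | s = inl t \/ s = inr u] (inr u) by right.
by rewrite E /= => -[//|[->]] [[->]|].
Qed.

End SmallTypes.

Section BoundedOrder.
Variables (K : Type) (hK : uncountable_strong_limit K) (S : set K).
Hypothesis sS : small K S.

Let sT : Type := {x : K | S x}.
(** An element of [option sT] can be put in front of a sequence, so [Z] absorbs products with
    [option sT]; the extra value [None] leaves room for one more element. *)
Let Z : Type := nat -> set (option sT).
Let Y : Type := set Z.

(** A small order in which sets of cardinality at most that of [S] are bounded; it replaces a
    regular cardinal above [S], since [K] may be singular. *)
Definition stage : Type := {U : set Y | U #<= [set: Z]}.

Definition stage_lt (i j : stage) : bool :=
  `[< sval i `<=` sval j /\ exists y, sval j y /\ ~ sval i y >].

Lemma stage_irr : irreflexive stage_lt.
Proof. by move=> i; apply/asboolP => -[_ [y [iy niy]]]. Qed.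

Lemma stage_trans : transitive stage_lt.
Proof.
move=> j i k /asboolP[ij [y [jy niy]]] /asboolP[jk _]; apply/asboolP.
by split=> [x /ij/jk//|]; exists y; split=> //; exact: jk.
Qed.

Let small_sT : small K [set: sT].
Proof.
apply: (@small_le K _ _ _ S) sS.
by apply: (@card_le_of _ _ _ _ (fun x : sT => sval x)) => [[]//|[x Sx] [y Sy] _ _ /= E]; exact: eq_exist.
Qed.

Let small_Z : small K [set: Z].
Proof.
have s1 : small K [set: option sT].
  apply: (@small_le K _ _ _ [set: sT + unit]); last first.
    by apply: smallT_sum => //; apply: (small_countable hK); exact: countableP.
  apply: (@card_le_of _ _ _ _ (fun o => match o with
    | Some w => inl w | None => inr tt end)) => [[]//|[x|] [y|] _ _ //].
  by case=> ->.
have s2 : small K [set: set (nat * option sT)] by apply: smallT_pow => //; exact: smallT_prod hK.1 s1.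
apply: (small_le _ s2); apply: (@card_le_of _ _ _ _ (fun f : Z => [set p | f p.1 p.2])) => // f g _ _ E.
apply/funext => n; apply/seteqP; split=> o h.
  by have : [set p | f p.1 p.2] (n, o) by []; rewrite E.
by have : [set p | g p.1 p.2] (n, o) by []; rewrite -E.
Qed.

Lemma small_stage : small K [set: stage].
Proof.
have s1 : small K [set: set Y] by do 2!apply: smallT_pow => //.
apply: (small_le _ s1); apply: (@card_le_of _ _ _ _ (fun x : stage => sval x)) => //.
by move=> [x Sx] [y Sy] _ _ /= E; exact: eq_exist.
Qed.

(** A union of at most [S] many sets of size at most that of [Z] has size at most that of [Z]. By
    Cantor's theorem it misses an element of [Y], and adding this element makes the bound strict. *)
Lemma stage_bounded (J : set stage) : J #<= S -> exists i, forall j, J j -> stage_lt j i.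
Proof.
move=> JS; have [k0 _] := K_inh hK; have [f [fS f_inj]] := card_le_fun k0 JS.
have [z0] : inhabited Z by exact: inhabits (fun=> set0).
pose U : set Y := [set y | exists2 j, J j & sval j y].
have /choice[g gP] : forall j : stage, exists g : Y -> Z,
    forall x y, sval j x -> sval j y -> g x = g y -> x = y.
  by move=> j; have [g [_ g_inj]] := card_le_fun z0 (svalP j); exists g.
pose enc (o : option sT) (z : Z) : Z := fun n => if n is m.+1 then z m else [set o].
have enc_inj o o' z z' : enc o z = enc o' z' -> o = o' /\ z = z'.
  move=> E; split; last by apply/funext => n; exact: (congr1 (fun f => f n.+1) E).
  have /= := congr1 (fun f => f 0) E; move=> E0; have : [set o] o by [].
  by rewrite E0.
have [y0 ny0] : exists y0, ~ U y0.
  apply: contrapT => no; apply: (@cantor Z).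
  have /choice[h hP] : forall y, exists j, J j /\ sval j y.
    move=> y; apply: contrapT => nj; apply: no; exists y => -[j Jj jy]; apply: nj; by exists j.
  apply: (@card_le_of _ _ _ _ (fun y => enc (Some (exist _ (f (h y)) (fS _ (hP y).1))) (g (h y) y))) => //.
  move=> x y _ _ /enc_inj[[Ef] Eg]; have Eh : h x = h y by apply: f_inj => //; [case: (hP x)|case: (hP y)].
  apply: (gP (h x)); [by case: (hP x)|by rewrite Eh; case: (hP y)|by rewrite {2}Eh].
have hU : U `|` [set y0] #<= [set: Z].
  have /choice[h hP] : forall y, exists j, U y -> J j /\ sval j y.
    move=> y; have [[j Jj jy]|nU] := pselect (U y); first by exists j.
    by exists (exist _ set0 (card_ge0 _ _)).
  pose c y : Z := match pselect (U y) with
    | left Uy => enc (Some (exist _ (f (h y)) (fS _ (hP y Uy).1))) (g (h y) y)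
    | right _ => enc None z0 end.
  apply: (@card_le_of _ _ _ _ c) => // x y [Ux|->] [Uy|->]; rewrite /c.
  - case: pselect => // Ux'; case: pselect => // Uy' /enc_inj[[Ef] Eg].
    have Eh : h x = h y by apply: f_inj => //; [case: (hP x Ux)|case: (hP y Uy)].
    apply: (gP (h x)); [by case: (hP x Ux)|by rewrite Eh; case: (hP y Uy)|by rewrite {2}Eh].
  - by case: pselect => // Ux'; case: pselect => // ? /enc_inj[].
  - by case: pselect => // ?; case: pselect => // ? /enc_inj[].
  - by [].
exists (exist (fun U : set Y => U #<= [set: Z]) _ hU) => j Jj; apply/asboolP; split=> /=; first by move=> y jy; left; exists j.
exists y0; split; first by right.
by move=> jy0; apply: ny0; exists j.
Qed.

End BoundedOrder.

Section Chains.
Variables (L : language) (C : structure L) (lt : formula L 2) (K : Type) (T : theory L).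
Hypothesis hC : monster_model K T C.
Hypothesis hL : countable_language L.
Implicit Types (A : set C).

Let hK : uncountable_strong_limit K. Proof. by case: hC. Qed.

Lemma Dfn_formula n (P : ('I_n -> C) -> Prop) : Dfn set0 P ->
  exists phi : formula L n, forall v, P v <-> sat phi v.
Proof.
move=> [k [phi [x [x0 H]]]].
have /choice[r rP] : forall i, exists j, x i = inl j.
  by move=> i; move: (x0 i); case: (x i) => // j; exists j.
exists (fren phi r) => v; rewrite H sat_fren.
by have -> : aval v \o x = v \o r by apply/funext => i; rewrite /= rP.
Qed.

(** Formulas of a countable language are coded by integers, so [big_pigeonhole] finds [big] many
    elements of the same type over a finite tuple. *)
Lemma type_code n (w : 'I_n -> C) : exists f : C -> set nat,
  forall x y, f x = f y -> same (range w) x y.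
Proof.
have [cf [_ cf_inj]] := card_le_fun 0 (hL.1 : _ #<= [set: nat]).
have [cr [_ cr_inj]] := card_le_fun 0 (hL.2 : _ #<= [set: nat]).
have code_inj := @fcode_inj L cf cr (fun x y => cf_inj x y I I) (fun x y => cr_inj x y I I) n.+1.
exists (fun x => [set m | exists phi : formula L n.+1, m = pickle (fcode cf cr phi) /\
  sat phi (tcons x w)]) => x y E P dP.
have [|Q [dQ HQ]] := @Dfn_absorb _ C set0 _ _ 'I_n w _ _ dP; first by right.
pose r (s : unit + 'I_n) : 'I_n.+1 := if s is inr i then lift ord0 i else ord0.
have [phi Hphi] := Dfn_formula (Dfn_ren r dQ).
have Hz z : P z <-> sat phi (tcons z w).
  rewrite -Hphi (HQ (fun=> z)); split=> Qz; congr Q: Qz; apply/funext => -[i|i] /=;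
    by rewrite /tcons ?liftK ?unlift_none.
have Hc z : sat phi (tcons z w) <-> exists phi' : formula L n.+1,
    pickle (fcode cf cr phi) = pickle (fcode cf cr phi') /\ sat phi' (tcons z w).
  split=> [h|[phi' [/(pcan_inj pickleK)/code_inj <-]] //]; by exists phi.
have /= ES := congr1 (fun S : set nat => S (pickle (fcode cf cr phi))) E.
by rewrite !Hz !Hc ES.
Qed.

Variables (d : nat) (E : ('I_d -> C) -> C -> C -> Prop).
Hypothesis hE : eqfam lt E.

Lemma rank_decr n X : rank_ge E n.+1 X -> rank_ge E n X.
Proof.
elim: n X => [|n IH] X [z [A [bA EA HA]]].
  by have [a /HA[x [Xx _]]] := big_neq0 bA; exists x.
by exists z, A; split=> // a /HA/IH.
Qed.

Lemma rank_le m n X : m <= n -> rank_ge E n X -> rank_ge E m X.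
Proof.
elim: n => [|n IH]; first by rewrite leqn0 => /eqP ->.
by rewrite leq_eqVlt => /orP[/eqP -> //|mn /rank_decr]; exact: IH.
Qed.

Lemma rank_union n X Y : rank_ge E n (X `|` Y) -> rank_ge E n X \/ rank_ge E n Y.
Proof.
elim: n X Y => [|n IH] X Y; first by move=> [x [Xx|Yx]]; [left|right]; exists x.
move=> [z [A [bA EA HA]]].
have [b|b] := big_split [set a | rank_ge E n (X `&` [set x | E z a x])] bA; [left|right].
  exists z, (A `&` [set a | rank_ge E n (X `&` [set x | E z a x])]); split=> //.
    by move=> x y [Ax _] [Ay _]; exact: EA.
  by move=> a [].
exists z, (A `&` ~` [set a | rank_ge E n (X `&` [set x | E z a x])]); split=> //.
  by move=> x y [Ax _] [Ay _]; exact: EA.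
move=> a [Aa nXa]; have := HA a Aa; rewrite setIUl => /IH[//|//].
Qed.

(** By [rank_union] the sets whose complement has finite rank are closed under intersection. A
    common point of the 0-definable ones lies in no 0-definable set of finite rank. *)
Lemma infinite_rank_point : (forall n, rank_ge E n [set: C]) ->
  exists x, forall th : set C, D1 set0 th -> th x -> forall n, rank_ge E n th.
Proof.
move=> hr.
have [|||x xP] := @saturated1 _ _ _ _ hC set0 [set th | D1 set0 th /\ exists n, ~ rank_ge E n (~` th)].
- exact: small_set0.
- by move=> P [].
- move=> s sF.
  have [n Hn] : exists n, ~ rank_ge E n (~` [set x | All (fun P : set C => P x) s]).
    elim: s sF => [_|P s IH [[_ [m Hm]] /IH[n Hn]]].
      by exists 0 => -[x]; apply.
    exists (maxn m n) => H; have {H} : rank_ge E (maxn m n)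
        (~` P `|` ~` [set x | All (fun P : set C => P x) s]).
      by apply: rank_mono H => x /= nPs; apply: contrapT => /not_orP[/contrapT Px /contrapT sx];
        apply: nPs.
    move=> /rank_union[]; first by move=> /(rank_le (leq_maxl _ _)).
    by move=> /(rank_le (leq_maxr _ _)).
  apply: contrapT => no; apply: Hn; apply: rank_mono (hr n) => x _ /= Px.
  by apply: no; exists x.
exists x => th dth thx n; apply: contrapT => nr.
have : ~ th x by apply: (xP (fun x => ~ th x)); split; [exact: Dfn_not|exists n => H; apply: nr;
  by apply: rank_mono H => y /= /contrapT].
by [].
Qed.

(** The rank is unfolded from the outside in: at each level the classes are thinned out to
    representatives of one type over the data chosen before, collected in [w], and the next level
    lives inside the class of the first representative. *)
Lemma finite_chain m X n (w : 'I_n -> C) : rank_ge E m X ->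
  exists (x : nat -> nat -> C) (z : nat -> 'I_d -> C) y, X y /\ forall i, i < m ->
    [/\ forall k l, k <> l -> ~ E (z i) (x i k) (x i l),
      forall k, same (range w `|` (range (z i) `|`
        [set c | exists2 j, j < i & c = x j 0 \/ range (z j) c])) (x i 0) (x i k)
      & E (z i) y (x i 0)].
Proof.
elim: m X n w => [|m IH] X n w.
  by move=> [y Xy]; have [c0] := carrier_inh C; exists (fun _ _ => y), (fun _ _ => y), y.
move=> [z0 [A [bA EA HA]]].
have [f Hf] := type_code (tcat w z0).
have [cd bA'] := big_pigeonhole f bA.
have [b [bA2 b_inj]] := big_nat bA'.
have [x [z [y [[Xy Eby] H]]]] := IH _ _ (tcons (b 0) (tcat w z0)) (HA _ (bA2 0).1).
exists (fun i => if i is i'.+1 then x i' else b), (fun i => if i is i'.+1 then z i' else z0), y.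
have rw t : range w t -> range (tcat w z0) t.
  by move=> [i _ <-]; exists (lshift d i) => //; rewrite /tcat -[lshift d i]/(unsplit (inl i)) unsplitK.
have rz t : range z0 t -> range (tcat w z0) t.
  by move=> [i _ <-]; exists (rshift n i) => //; rewrite /tcat -[rshift n i]/(unsplit (inr i)) unsplitK.
have rc t : range (tcat w z0) t -> range (tcons (b 0) (tcat w z0)) t.
  by move=> [i _ <-]; exists (lift ord0 i) => //; rewrite tconsS.
split=> // -[_|i im]; last first.
  have [h1 h2 h3] := H i im; split=> // k; apply: same_mono (h2 k) => t.
  case=> [h|]; [left; exact: rc (rw _ h)|].
  case=> [h|[[_ [->|h]|j ji h]]]; [by right; left| | |by right; right; exists j].
    by left; exists ord0 => //; rewrite tcons0.
  by left; exact: rc (rz _ h).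
split.
- by move=> k l kl; apply: EA; [exact: (bA2 k).1|exact: (bA2 l).1|move=> /b_inj].
- move=> k; have : f (b 0) = f (b k) by rewrite (bA2 0).2 (bA2 k).2.
  by move=> fe; apply: same_mono (Hf _ _ fe) => t [h|[h|[]//]]; [exact: rw|exact: rz].
- exact: (eqfam_sym hE).
Qed.

(** Compactness joins the finite chains; finitely many indices are placed in a finite chain by
    counting predecessors. The common point obtained only has the type of [x0] over the empty set,
    and an automorphism moves it to [x0]. *)
Lemma long_chain (Th : Type) (r : Th -> Th -> bool) x0 : small K [set: Th] ->
  irreflexive r -> transitive r ->
  (forall th : set C, D1 set0 th -> th x0 -> forall n, rank_ge E n th) ->
  exists (x : Th -> nat -> C) (z : Th -> 'I_d -> C), forall i,
    [/\ forall k l, k <> l -> ~ E (z i) (x i k) (x i l),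
      forall k, same (range (z i) `|` [set c | exists2 j, r j i & c = x j 0 \/ range (z j) c])
        (x i 0) (x i k)
      & E (z i) x0 (x i 0)].
Proof.
move=> sTh rI rT hx0.
pose V : Type := ((Th * nat) + (Th * 'I_d) + unit)%type.
pose xv (v : V -> C) i k := v (inl (inl (i, k))).
pose zv (v : V -> C) i (t : 'I_d) := v (inl (inr (i, t))).
pose par (l : seq {classic Th}) (v : V -> C) i : set C := range (zv v i) `|`
  [set c | exists j, [/\ j \in l, r j i & c = xv v j 0 \/ range (zv v j) c]].
pose config (l : seq {classic Th}) v := forall i, i \in l ->
  [/\ forall k k', k <> k' -> ~ E (zv v i) (xv v i k) (xv v i k'),
    forall k, same (par l v i) (xv v i 0) (xv v i k) & E (zv v i) (v (inr tt)) (xv v i 0)].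
pose F : set (set (V -> C)) := [set P | Dfn set0 P /\ exists l th,
  [/\ D1 set0 th, th x0 & forall v, config l v -> th (v (inr tt)) -> P v]].
have config_mono l l' v : (forall i, i \in l -> i \in l') -> config l' v -> config l v.
  move=> ll' H i /ll'/H[h1 h2 h3]; split=> // k; apply: same_mono (h2 k) => t.
  by case=> [|[j [jl ji h]]]; [left|right; exists j; split=> //; exact: ll'].
have [||||v vF] := @compactness _ _ _ _ hC set0 V F.
- exact: small_set0.
- apply: (smallT_sum hK); last by apply: (small_countable hK); exact: countableP.
  apply: (smallT_sum hK); apply: (smallT_prod hK) => //; first exact: hK.1.
  by apply: (small_countable hK); exact: countableP.
- by move=> P [].
- move=> s sF; have [l [th [dth thx Hl]]] : exists l th, [/\ D1 set0 th, th x0 &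
      forall v, config l v -> th (v (inr tt)) -> All (fun P : set (V -> C) => P v) s].
    elim: s sF => [_|P s IH [[_ [l [th [dth thx Hl]]]] /IH[l' [th' [dth' thx' Hl']]]]].
      by exists [::], (fun=> True); split=> //; exact: Dfn_True.
    exists (l ++ l'), (fun x => th x /\ th' x); split=> //; first exact: Dfn_and.
    move=> v cv [thv th'v]; split; [apply: Hl => //|apply: Hl' => //]; apply: config_mono cv => i il.
      by rewrite mem_cat il.
    by rewrite mem_cat il orbT.
  have [x [z [y [thy H]]]] := @finite_chain (size l) _ _ (fun i : 'I_0 => x0) (hx0 _ dth thx (size l)).
  pose rk i := count (fun j => r j i) l.
  pose v (w : V) : C := match w with
    | inl (inl (i, k)) => x (rk i) k | inl (inr (i, t)) => z (rk i) t | inr _ => y end.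
  exists v; apply: Hl => // i il.
  have rkl : rk i < size l.
    rewrite /rk -count_predT; apply: (@count_lt {classic Th} _ _ _ i) => //=.
    by rewrite rI.
  have [h1 h2 h3] := H _ rkl; split=> // k; apply: same_mono (h2 k) => t.
  case=> [zt|[j [jl ji h]]]; first by right; left.
  right; right; exists (rk j) => //.
  apply: (@count_lt {classic Th} _ _ _ j) => //=; last by rewrite rI.
  by move=> u uj; exact: rT uj ji.
have thv th : D1 set0 th -> th x0 -> th (v (inr tt)).
  move=> dth thx; apply: (vF [set v | th (v (inr tt))]); split.
    exact: D1_at dth (Trm_var _ _).
  by exists [::], th.
have sx : same set0 (v (inr tt)) x0 by apply: same_sym; exact: same_half.
have s0 : small K (@set0 C) by exact: small_set0.
have [s [As sv]] := same_autom hC s0 sx.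
have E1 i k k' : k <> k' -> ~ E (zv v i) (xv v i k) (xv v i k').
  move=> kk'; apply: (vF [set v | ~ E (zv v i) (xv v i k) (xv v i k')]); split.
    apply: Dfn_not; apply: (eqfam_Dfn (z := fun t v => v (inl (inr (i, t)))) hE _ (Trm_var _ _) (Trm_var _ _)) => t.
    exact: Trm_var.
  exists [:: i : {classic Th}], (fun=> True); split=> //; first exact: Dfn_True.
  by move=> u cu _; have [h _ _] := cu i (mem_head _ _); exact: h.
have E3 i : E (zv v i) (v (inr tt)) (xv v i 0).
  apply: (vF [set v | E (zv v i) (v (inr tt)) (xv v i 0)]); split.
    apply: (eqfam_Dfn (z := fun t v => v (inl (inr (i, t)))) hE _ (Trm_var _ _) (Trm_var _ _)) => t.
    exact: Trm_var.
  exists [:: i : {classic Th}], (fun=> True); split=> //; first exact: Dfn_True.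
  by move=> u cu _; have [_ _ h] := cu i (mem_head _ _); exact: h.
pose pars i : set C := range (zv v i) `|` [set c | exists2 j, r j i & c = xv v j 0 \/ range (zv v j) c].
(* Equality of types over the possibly infinite set [pars i] is checked one formula at a time; the
   finitely many variables of the formula determine the list [l]. *)
have E2 i k : same (pars i) (xv v i 0) (xv v i k).
  pose W := {w : V | match w with
    | inl (inl (j, m)) => m = 0 /\ r j i | inl (inr (j, _)) => j = i \/ r j i | inr _ => False end}.
  move=> P dP; have [|Q [dQ HQ]] := @Dfn_absorb _ C set0 _ _ W (fun w => v (sval w)) _ _ dP.
    move=> t [[u _ <-]|[j ji [->|[u _ <-]]]]; right.
    - have h : match inl (inr (i, u)) : V with
        | inl (inl (j, m)) => m = 0 /\ r j i | inl (inr (j, _)) => j = i \/ r j i | inr _ => False end.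
        by left.
      by exists (exist _ (inl (inr (i, u))) h).
    - have h : match inl (inl (j, 0)) : V with
        | inl (inl (j, m)) => m = 0 /\ r j i | inl (inr (j, _)) => j = i \/ r j i | inr _ => False end.
        by [].
      by exists (exist _ (inl (inl (j, 0))) h).
    - have h : match inl (inr (j, u)) : V with
        | inl (inl (j, m)) => m = 0 /\ r j i | inl (inr (j, _)) => j = i \/ r j i | inr _ => False end.
        by right.
      by exists (exist _ (inl (inr (j, u))) h).
  pose at_ m (u : V -> C) := Q (sumv (fun=> xv u i m) (fun w : W => u (sval w))).
  have Pat m : P (xv v i m) <-> at_ m v.
    by rewrite (HQ (fun=> xv v i m)) /at_; split=> Qv; congr Q: Qv; apply/funext => -[].
  rewrite !Pat; apply: (vF [set u | at_ 0 u <-> at_ k u]); split.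
    have dat m : Dfn set0 (at_ m).
      pose f (s : unit + W) : V := match s with inl _ => inl (inl (i, m)) | inr w => sval w end.
      by apply: Dfn_ext (Dfn_ren f dQ) => u; split=> Qv; congr Q: Qv; apply/funext => -[].
    by apply: Dfn_iff; exact: dat.
  have [n [phi [y [y0 HQ']]]] := dQ.
  pose ix (w : V) : {classic Th} := match w with inl (inl (j, _)) => j | inl (inr (j, _)) => j | inr _ => i end.
  pose iy t : {classic Th} := match y t with inl (inr w) => ix (sval w) | _ => i end.
  pose l : seq {classic Th} := (i : {classic Th}) :: [seq iy t | t <- enum 'I_n].
  exists l, (fun=> True); split=> //; first exact: Dfn_True.
  move=> u cu _; have [_ h _] := cu i (mem_head _ _).
  apply: (h k (fun t => Q (sumv (fun=> t) (fun w : W => u (sval w))))).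
  exists n, phi, (fun t => match y t with
    | inl (inl o) => inl o | inl (inr w) => inr (u (sval w)) | inr a => inr a end).
  split=> [t|a]; last first.
    rewrite HQ'; set e1 := _ \o _; set e2 := _ \o _; have -> // : e1 = e2.
    by apply/funext => t; rewrite /e1 /e2 /=; case: (y t) => [[[]|]|].
  have : iy t \in l by rewrite in_cons map_f ?mem_enum ?orbT.
  rewrite /iy; move: (y0 t); case: (y t) => [[//|w]|//] _ /=; case: w => -[[[j m]|[j t']]|[]] //= => [[-> ji]|ji] jl.
    by right; exists j; split=> //; left.
  case: ji => [<-|ji]; first by left; exists t'.
  by right; exists j; split=> //; right; exists t'.
exists (fun i k => s (xv v i k)), (fun i => s \o zv v i) => i; split.
- by move=> k l kl; rewrite -(eqfam_autom hE _ _ _ As); exact: E1.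
- move=> k P dP.
  have im : range (s \o zv v i) `|` [set c | exists2 j, r j i & c = s (xv v j 0) \/ range (s \o zv v j) c]
      `<=` s @` pars i.
    move=> t [[u _ <-]|[j ji [->|[u _ <-]]]].
    + by exists (zv v i u) => //; left; exists u.
    + by exists (xv v j 0) => //; right; exists j => //; left.
    + by exists (zv v j u) => //; right; exists j => //; right; exists u.
  apply: (E2 i k (fun t => P (s t))).
  exact: (iso_Dfn As.1 (Dfn_mono im dP)).
- by rewrite -sv -(eqfam_autom hE _ _ _ As); exact: E3.
Qed.

End Chains.

(** * Rosy theories have finite ranks *)

Section EqLift.
Variables (L : language) (C : structure L).

Lemma tcat_comp X Y (s : X -> Y) n m (a : 'I_n -> X) (b : 'I_m -> X) :
  tcat (s \o a) (s \o b) = s \o tcat a b.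
Proof. by apply/funext => i; rewrite /tcat /=; case: (fintype.split i). Qed.

Lemma tcat_lshift X n m (a : 'I_n -> X) (b : 'I_m -> X) i : tcat a b (lshift m i) = a i.
Proof. by rewrite /tcat -[lshift m i]/(unsplit (inl i)) unsplitK. Qed.

Lemma tcat_rshift X n m (a : 'I_n -> X) (b : 'I_m -> X) i : tcat a b (rshift n i) = b i.
Proof. by rewrite /tcat -[rshift n i]/(unsplit (inr i)) unsplitK. Qed.

Lemma tcons_comp X Y (s : X -> Y) n (x : X) (a : 'I_n -> X) : s \o tcons x a = tcons (s x) (s \o a).
Proof. by apply/funext => i; rewrite /tcons /=; case: (unlift _ _). Qed.

Lemma eqclass_iso (s : C -> C) n (E : formula L (n + n)) a : isomorphism s ->
  [set s \o b | b in eqclass E a] = eqclass E (s \o a).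
Proof.
move=> sI; have [s' [_ sK s'K]] := iso_inverse sI.
apply/seteqP; split=> [_ [b /= Eb <-]|b /= Eb]; first by rewrite /eqclass /= tcat_comp -(iso_sat sI).
exists (s' \o b); last by apply/funext => i /=.
have e : b = s \o (s' \o b) by apply/funext => i /=.
by move: Eb; rewrite /eqclass /= {1}e tcat_comp -(iso_sat sI).
Qed.

Definition class_lift (s : C -> C) (sI : isomorphism s) n (E : formula L (n + n))
    (X : {X : set ('I_n -> C) | exists a, X = eqclass E a}) :
  exists a, [set s \o b | b in sval X] = eqclass E a.
Proof. by case: X => X [a Xa] /=; exists (s \o a); rewrite Xa eqclass_iso. Qed.

Definition carrier_lift (s : C -> C) (sI : isomorphism s) (so : eqsort C) :
    eqsort_carrier so -> eqsort_carrier so :=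
  match so return eqsort_carrier so -> eqsort_carrier so with
  | Home => s
  | @Quot _ _ n E hE => fun X => exist _ _ (class_lift sI X)
  end.

(** The action of an automorphism on imaginaries, used to produce conjugates in the sense of
    [same_eqtype]. *)
Definition eqlift (s : C -> C) (sI : isomorphism s) (e : eqelt C) : eqelt C :=
  existT (@eqsort_carrier L C) (projT1 e) (carrier_lift sI (projT2 e)).

Lemma quot_elt_eq n (E : formula L (n + n))
    (hE : equivalence_on [set: 'I_n -> C] (fun a b => sat E (tcat a b))) a b :
  sat E (tcat a b) -> quot_elt hE a = quot_elt hE b.
Proof.
move=> ab; apply: (congr1 (fun X => existT (@eqsort_carrier L C) (Quot hE) X)); apply: eq_exist.
case: hE => _ sE tE; apply/seteqP; split=> c /= h; last exact: tE h.
by apply: tE h => //; exact: sE.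
Qed.

Lemma quot_elt_inj n (E : formula L (n + n))
    (hE : equivalence_on [set: 'I_n -> C] (fun a b => sat E (tcat a b))) a b :
  quot_elt hE a = quot_elt hE b -> sat E (tcat a b).
Proof.
move=> e; have := projT2_eq e; rewrite (Prop_irrelevance (projT1_eq e) erefl) /= => /(congr1 sval) /= H.
by have [rE _ _] := hE; have : eqclass E b b; [exact: rE|rewrite -H].
Qed.

Lemma home_elt_inj : injective (@home_elt L C).
Proof.
move=> a b e; have := projT2_eq e.
by rewrite (Prop_irrelevance (projT1_eq e) erefl).
Qed.

Lemma eqelt_cases (e : eqelt C) : (exists a, e = home_elt a) \/
  exists n (E : formula L (n + n)) hE a, e = @quot_elt L C n E hE a.
Proof.
case: e => -[x|n E hE [X [a Xa]]]; first by left; exists x.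
right; exists n, E, hE, a.
by apply: (congr1 (fun X => existT (@eqsort_carrier L C) (Quot hE) X)); exact: eq_exist.
Qed.

Lemma eqlift_home (s : C -> C) (sI : isomorphism s) a : eqlift sI (home_elt a) = home_elt (s a).
Proof. by []. Qed.

Lemma eqlift_quot (s : C -> C) (sI : isomorphism s) n (E : formula L (n + n)) hE a :
  eqlift sI (@quot_elt L C n E hE a) = quot_elt hE (s \o a).
Proof.
apply: (congr1 (fun X => existT (@eqsort_carrier L C) (Quot hE) X)); apply: eq_exist.
exact: eqclass_iso.
Qed.

Lemma eqlift_cancel (s : C -> C) (sI : isomorphism s) (s' : C -> C) (s'I : isomorphism s') : cancel s s' ->
  cancel (eqlift sI) (eqlift s'I).
Proof.
move=> sK e; case: (eqelt_cases e) => [[a ->]|[n [E [hE [a ->]]]]].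
  by rewrite !eqlift_home sK.
by rewrite !eqlift_quot; congr quot_elt; apply/funext => i /=.
Qed.

Lemma eqsat_lift (s : C -> C) (sI : isomorphism s) n (phi : eqform C n) v :
  eqsat phi v <-> eqsat phi (eqlift sI \o v).
Proof.
have [s' [s'I sK s'K]] := iso_inverse sI.
have LK := eqlift_cancel sI s'I sK; have L'K := eqlift_cancel s'I sI s'K.
have vK m (u : 'I_m -> eqelt C) : eqlift s'I \o (eqlift sI \o u) = u by apply/funext => i /=.
elim: phi v => {n} [n|n i j|n k f x|n k E hE x y|n f IHf g IHg|n so f IHf] v /=.
- by [].
- by split=> [-> //|/(congr1 (eqlift s'I))]; rewrite !LK.
- have half (t : C -> C) (tI : isomorphism t) (u : 'I_n -> eqelt C) :
      (exists2 a : 'I_k -> C, forall i, u (x i) = home_elt (a i) & sat f a) ->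
      exists2 a : 'I_k -> C, forall i, eqlift tI (u (x i)) = home_elt (a i) & sat f a.
    move=> [a ua fa]; exists (t \o a); last by rewrite -(iso_sat tI).
    by move=> i; rewrite ua.
  split; first exact: half.
  move=> /(half _ s'I (eqlift sI \o v))[a ua fa]; exists a => // i.
  by rewrite -ua /= LK.
- have half (t : C -> C) (tI : isomorphism t) (u : 'I_n -> eqelt C) :
      (exists2 a : 'I_k -> C, forall i, u (x i) = home_elt (a i) & u y = quot_elt hE a) ->
      exists2 a : 'I_k -> C, forall i, eqlift tI (u (x i)) = home_elt (a i) &
        eqlift tI (u y) = quot_elt hE a.
    move=> [a ua fa]; exists (t \o a); last by rewrite fa eqlift_quot.
    by move=> i; rewrite ua.
  split; first exact: half.
  move=> /(half _ s'I (eqlift sI \o v))[a ua fa]; exists a; last by rewrite -fa /= LK.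
  by move=> i; rewrite -ua /= LK.
- by rewrite IHf IHg.
- split=> H e es.
    have E : eqlift sI \o tcons (eqlift s'I e) v = tcons e (eqlift sI \o v).
      by rewrite tcons_comp L'K.
    by rewrite -E -IHf; exact: H.
  by rewrite IHf tcons_comp; exact: H.
Qed.

Lemma same_eqtype_lift (s : C -> C) (sI : isomorphism s) n (A : set (eqelt C)) (a : 'I_n -> eqelt C) :
  (forall e, A e -> eqlift sI e = e) -> same_eqtype A a (eqlift sI \o a).
Proof.
move=> sA f fA; rewrite /peqsat (eqsat_lift sI) -tcat_comp.
by have -> // : eqlift sI \o @pe_par _ _ _ f = @pe_par _ _ _ f by apply/funext => i /=; exact: sA.
Qed.

End EqLift.

Section Rosy.
Variables (L : language) (C : structure L) (lt : formula L 2) (K : Type) (T : theory L).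
Hypothesis hC : monster_model K T C.
Hypothesis hL : countable_language L.

Let hK : uncountable_strong_limit K. Proof. by case: hC. Qed.

(** The imaginary for an element and parameters is the class as a set, so one sort serves for all
    parameters. Index [0] carries the element, the other indices the parameters. *)
Lemma class_formula d (E : ('I_d -> C) -> C -> C -> Prop) : eqfam lt E ->
  exists phi : formula L (d.+1 + d.+1), forall a b : 'I_d.+1 -> C, sat phi (tcat a b) <->
    forall t, E (a \o lift ord0) (a ord0) t <-> E (b \o lift ord0) (b ord0) t.
Proof.
move=> hE.
have [|phi Hphi] := @Dfn_formula L C _ (fun v : 'I_(d.+1 + d.+1) -> C =>
    forall t, E (fun i => v (lshift d.+1 (lift ord0 i))) (v (lshift d.+1 ord0)) t <->
      E (fun i => v (rshift d.+1 (lift ord0 i))) (v (rshift d.+1 ord0)) t).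
  apply: Dfn_all; apply: Dfn_iff.
    apply: (eqfam_Dfn (z := fun i v => v (Some (lshift d.+1 (lift ord0 i)))) hE _
      (Trm_var _ _) (Trm_var _ _)) => i; exact: Trm_var.
  apply: (eqfam_Dfn (z := fun i v => v (Some (rshift d.+1 (lift ord0 i)))) hE _
      (Trm_var _ _) (Trm_var _ _)) => i; exact: Trm_var.
exists phi => a b; rewrite -Hphi !tcat_lshift !tcat_rshift.
have -> : (fun i => tcat a b (lshift d.+1 (lift ord0 i))) = a \o lift ord0.
  by apply/funext => i; rewrite tcat_lshift.
by have -> : (fun i => tcat a b (rshift d.+1 (lift ord0 i))) = b \o lift ord0
  by apply/funext => i; rewrite tcat_rshift.
Qed.

(** An infinite rank puts [x0] into a chain of classes indexed by [stage S]. A set [A] of at most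
    [S] many of its parameters is bounded by an index [i]. Over [A] and [z i] the class at [i] has
    infinitely many pairwise disjoint conjugates, so the formula placing [x0] in it thorn-divides
    over [A], against local character. *)
Lemma rosy_finite_ranks : rosy K C -> finite_ranks C lt.
Proof.
move=> hR d E hE; apply: contrapT => nr.
have {}nr n : rank_ge E n [set: C] by apply: contrapT => h; apply: nr; exists n.
have [x0 hx0] := infinite_rank_point hC nr.
have [S sS HS] := hR 1 (tup1 (home_elt x0)).
pose Th := stage S.
have sTh : small K [set: Th] by exact: small_stage.
have [x [z Hxz]] := long_chain hC hL hE sTh (@stage_irr K S) (@stage_trans K S) hx0.
have [phi Hphi] := class_formula hE.
have hphi : equivalence_on [set: 'I_d.+1 -> C] (fun a b => sat phi (tcat a b)).
  split=> [a _|a b _ _|a b e _ _ _]; rewrite !Hphi //.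
    by move=> H t; rewrite H.
  by move=> H H' t; rewrite H.
have phiE (i : Th) u w : sat phi (tcat (tcons u (z i)) (tcons w (z i))) <-> E (z i) u w.
  rewrite Hphi !tcons0.
  have zl y : tcons y (z i) \o lift ord0 = z i by apply/funext => t /=; rewrite tconsS.
  rewrite !zl; split=> [H|Euw t]; first by apply/H; exact: (eqfam_refl hE).
  split=> h; first exact: (eqfam_trans hE (eqfam_sym hE Euw) h).
  exact: (eqfam_trans hE Euw h).
pose q (i : Th) y := quot_elt hphi (tcons y (z i)).
pose par (i : Th) y : 'I_d.+1 -> eqelt C := tcons (q i y) (@home_elt L C \o z i).
pose B : set (eqelt C) := [set w | exists i : Th, w = q i (x i 0) \/ exists t, w = home_elt (z i t)].
have sB : small K B.
  have s1 : small K [set: Th * option 'I_d].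
    by apply: (smallT_prod hK) => //; apply: (small_countable hK); exact: countableP.
  apply: (@small_sub K _ _ _ _ (@small_image K _ _ _ (fun p : Th * option 'I_d =>
    if p.2 is Some t then home_elt (z p.1 t) else q p.1 (x p.1 0)) s1)).
  by move=> w [i [->|[t ->]]]; [exists (i, None)|exists (i, Some t)].
have [A [AB AS nf]] := HS B sB.
have /choice[ix ixP] : forall w : eqelt C, exists i : Th,
    B w -> w = q i (x i 0) \/ exists t, w = home_elt (z i t).
  move=> w; have [[i Bi]|nB] := pselect (B w); first by exists i.
  by have [i _] := @stage_bounded K hK S set0 (card_ge0 _ _); exists i.
have [i Hi] := @stage_bounded K hK S (ix @` A) (card_le_trans (card_image_le _ _) AS).
apply: nf.
have [h1 h2 h3] := Hxz i.
(* The free variable is the element, parameter [0] is the class and the remaining parameters are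
   [z i]; [xs] selects the arguments of the projection. *)
pose xs (t : 'I_d.+1) : 'I_(1 + d.+1) := if unlift ord0 t is Some j
  then rshift 1 (lift ord0 j) else lshift d.+1 ord0.
pose f : peqform C 1 := PEqForm (EProj hphi xs (rshift 1 ord0)) (par i (x i 0)).
exists f; split.
- move=> t; rewrite /= /par /tcons; case: unliftP => [j _|_] /=; exists i; [right|by left].
  by exists j.
- exists (tcons x0 (z i)).
    move=> t; rewrite /xs /tcons; case: (unliftP ord0 t) => [j _|_] /=.
      by rewrite tcat_rshift /par tconsS.
    by rewrite tcat_lshift.
  rewrite tcat_rshift [@pe_par _ _ _ f ord0]tcons0; apply: quot_elt_eq; apply/phiE; exact: (eqfam_sym hE).
exists 1, (fun=> f); split; last by move=> y fy; exists ord0.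
move=> _; exists d, (@home_elt L C \o z i).
pose A' := A `|` range (@home_elt L C \o z i).
have conj k : same_eqtype A' (par i (x i 0)) (par i (x i k)).
  pose P := range (z i) `|` [set c | exists2 j, stage_lt j i & c = x j 0 \/ range (z j) c].
  have sP : small K P.
    have s1 : small K [set: Th * option 'I_d].
      by apply: (smallT_prod hK) => //; apply: (small_countable hK); exact: countableP.
    apply: (@small_sub K _ _ _ _ (@small_image K _ _ _ (fun p : Th * option 'I_d =>
      if p.2 is Some t then z p.1 t else x p.1 0) s1)).
    move=> w [[t _ <-]|[j _ [->|[t _ <-]]]]; [by exists (i, Some t)|by exists (j, None)|].
    by exists (j, Some t).
  have [s [[sI sfix] sx]] := same_autom hC sP (h2 k).
  have zi : s \o z i = z i by apply/funext => t /=; apply: sfix; left; exists t.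
  have -> : par i (x i k) = eqlift sI \o par i (x i 0).
    rewrite /par tcons_comp; congr tcons; first by rewrite /q eqlift_quot tcons_comp sx zi.
    by apply/funext => t /=; rewrite eqlift_home -[s (z i t)]/((s \o z i) t) zi.
  apply: same_eqtype_lift => w [Aw|[t _ <-]]; last first.
    by rewrite /= eqlift_home -[s (z i t)]/((s \o z i) t) zi.
  have ji : stage_lt (ix w) i by apply: Hi; exists w.
  have zj : s \o z (ix w) = z (ix w).
    by apply/funext => t /=; apply: sfix; right; exists (ix w) => //; right; exists t.
  have xj : s (x (ix w) 0) = x (ix w) 0 by apply: sfix; right; exists (ix w) => //; left.
  move: (ixP w (AB _ Aw)) zj xj; move: (ix w) => j [->|[t ->]] zj xj.
    by rewrite /q eqlift_quot tcons_comp zj xj.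
  by rewrite eqlift_home -[s (z _ t)]/((s \o z _) t) zj.
have par_inj k l : par i (x i k) = par i (x i l) -> k = l.
  move=> /(congr1 (fun u => u ord0)); rewrite /par !tcons0 => /quot_elt_inj/phiE Ekl.
  by apply: contrapT => kl; exact: h1 kl Ekl.
split.
  apply/infiniteP; apply: (@card_le_of _ _ _ _ (fun k => par i (x i k))) => [k _|k l _ _].
    exact: conj.
  exact: par_inj.
(* Conjugates over [A'] keep [z i], so two instances with a common solution name the same class and
   have equal parameters. *)
exists 2 => w w_inj Hw [y Hy].
have hz k t : w k (lift ord0 t) = home_elt (z i t).
  pose g : peqform C d.+1 := PEqForm (EEq C (lshift 1 (lift ord0 t)) (rshift d.+1 ord0))
    (fun _ : 'I_1 => home_elt (z i t)).
  have gA : eqover A' g by move=> u; right; exists t.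
  have := Hw k g gA; rewrite /peqsat /= !tcat_lshift !tcat_rshift => -[+ _]; apply.
  by rewrite /f /= /par tconsS.
have [a0 a0y a0q] := Hy ord0; have [a1 a1y a1q] := Hy ord_max.
have a01 : a0 = a1.
  apply/funext => t; apply: (@home_elt_inj L C); rewrite -a0y -a1y /xs.
  by case: (unliftP ord0 t) => [j _|_]; rewrite ?tcat_rshift ?tcat_lshift // !hz.
have /w_inj // : w ord0 = w ord_max.
apply/funext => t; case: (unliftP ord0 t) => [j|] ->; first by rewrite !hz.
by move: a0q a1q; rewrite !tcat_rshift a01 => -> ->.
Qed.

End Rosy.

Theorem mainTheorem9
  (L : language) (T : theory L) (K : Type) (C : structure L)
  (hL : countable_language L)
  (hT : complete_theory T)
  (hC : monster_model K T C)
  (lt : formula L 2)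
  (hlt : weakly_quasi_o_minimal_wrt C lt)
  (hfew : few_countable_models T) :
  (finite_convexity_rank C lt -> condition_R K C) /\
  (rosy K C -> condition_R K C).
Proof.
split=> h; apply: (finite_ranks_condition_R hC hlt hL hfew).
  exact: finite_convexity_rank_ranks.
exact: rosy_finite_ranks hC hL h.
Qed.
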